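(* Let $\alpha\in(0,1)$, let $A\in\mathbb{R}^{d\times d}$, and let $\hat\lambda_1,\dots,\hat\lambda_m$ denote the eigenvalues of $A$ in $\mathbb{C}$. Assume that $$|\arg(\hat\lambda_i)|>\frac{\alpha\pi}{2},\qquad i=1,\dots,m.$$ Let $f:\mathbb{R}^d\to\mathbb{R}^d$ be a locally Lipschitz continuous function satisfying $$f(0)=0,\qquad \lim_{r\to 0}\ell_f(r)=0,$$ where $\ell_f(r)$ denotes the Lipschitz constant of $f$ on the closed ball of radius $r$ centered at $0$. Then the trivial solution of the nonlinear Caputo fractional differential equation $${}^{C}D_{0+}^{\alpha}x(t)=Ax(t)+f(x(t))$$ is asymptotically stable.
   Context: $\mathbb{R}^d$ carries the max norm $\|x\|=\max(|x_1|,\dots,|x_d|)$. For $r>0$, $$\ell_f(r):=\sup_{x,y\in\mathbb{R}^d,\ \|x\|\le r,\ \|y\|\le r,\ x\ne y}\frac{\|f(x)-f(y)\|}{\|x-y\|}.$$ $\arg$ is the principal argument in $(-\pi,\pi]$ of a nonzero complex number; the hypothesis on eigenvalues includes that they are nonzero. Solutions: for $\alpha\in(0,1)$ the Caputo derivative of a $C^1$ function is ${}^{C}D^\alpha_{0+}x(t)=\frac{1}{\Gamma(1-\alpha)}\int_0^t(t-\tau)^{-\alpha}x'(\tau)\,d\tau$, taken componentwise for vector-valued functions. A solution of ${}^{C}D_{0+}^{\alpha}x(t)=g(x(t))$, $x(0)=x_0$, on $[0,T)$ is understood in the usual sense as a continuous function $x:[0,T)\to\mathbb{R}^d$ satisfying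 $x(t)=x_0+\frac{1}{\Gamma(\alpha)}\int_0^t(t-\tau)^{\alpha-1}g(x(\tau))\,d\tau$ for all $t\in[0,T)$. For locally Lipschitz $g$ there is a unique solution $\phi(\cdot,x_0)$ on a maximal interval of existence $[0,t_{\max}(x_0))$, $0<t_{\max}(x_0)\le\infty$. Stability notions: the trivial solution $x\equiv 0$ is stable if for every $\varepsilon>0$ there is $\delta>0$ such that for every $x_0$ with $\|x_0\|<\delta$ we have $t_{\max}(x_0)=\infty$ and $\|\phi(t,x_0)\|\le\varepsilon$ for all $t\ge 0$. It is attractive if there is $\hat\delta>0$ such that $\lim_{t\to\infty}\phi(t,x_0)=0$ (in particular $t_{\max}(x_0)=\infty$) whenever $\|x_0\|<\hat\delta$. It is asymptotically stable if it is both stable and attractive. *)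

(* Defs.v *)
From HB Require Import structures.
From mathcomp Require Export all_boot all_order all_algebra.
From mathcomp Require Export all_classical all_reals all_analysis.
From mathcomp Require Export complex.
Export numFieldNormedType.Exports.
Set Implicit Arguments.
Unset Strict Implicit.
Unset Printing Implicit Defensive.
Import Order.TTheory GRing.Theory Num.Theory.
Local Open Scope classical_set_scope.
Local Open Scope ring_scope.

(* Principal argument in ]-pi, pi]; the set is a singleton when z != 0 and is
   empty when z = 0, where the value is a default. *)
Definition carg (R : realType) (z : R[i]) : R :=
  get [set theta | - pi < theta <= pi /\
    exists2 r : R, 0 < r & z = Complex (r * cos theta) (r * sin theta)].

Definition Gamma (R : realType) (a : R) : R :=
  \int[@lebesgue_measure R]_(t in `]0, +oo[) (t `^ (a - 1) * expR (- t)).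

Definition locally_lipschitz (R : realType) (d : nat)
    (f : 'cV[R]_d -> 'cV[R]_d) : Prop :=
  forall x : 'cV[R]_d, exists2 U : set 'cV[R]_d, nbhs x U & [lipschitz f y | y in U].

(* The norm on 'cV[R]_d is the max norm.  The supremum is taken in \bar R, so
   that it is +oo when f is not Lipschitz on the ball. *)
Definition lip_const (R : realType) (d : nat)
    (f : 'cV[R]_d -> 'cV[R]_d) (r : R) : \bar R :=
  ereal_sup [set (`|f xy.1 - f xy.2| / `|xy.1 - xy.2|)%:E | xy in
    [set xy : 'cV[R]_d * 'cV[R]_d |
      [/\ `|xy.1| <= r, `|xy.2| <= r & xy.1 != xy.2]]].

(* The interval [0, T[ with T possibly infinite. *)
Definition time_interval (R : realType) (T : \bar R) : set R :=
  [set t | 0 <= t /\ (t%:E < T)%E].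

(* x solves the Caputo equation D^alpha x = g(x), x(0) = x0, on [0, T[, in the
   sense of the equivalent Volterra equation; the values of x outside [0, T[
   are irrelevant. *)
Definition caputo_solution (R : realType) (d : nat) (alpha : R)
    (g : 'cV[R]_d -> 'cV[R]_d) (x0 : 'cV[R]_d) (T : \bar R)
    (x : R -> 'cV[R]_d) : Prop :=
  [/\ (0 < T)%E,
      {within time_interval T, continuous x} &
      forall t, time_interval T t ->
        x t = x0 + (Gamma alpha)^-1 *:
          \col_i \int[@lebesgue_measure R]_(tau in `[0, t])
                   ((t - tau) `^ (alpha - 1) * g (x tau) i ord0)].

(* x is the solution phi(., x0) and T is t_max(x0): every solution starting at
   x0 is a restriction of x to some [0, S[ with S <= T. *)
Definition maximal_solution (R : realType) (d : nat) (alpha : R)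
    (g : 'cV[R]_d -> 'cV[R]_d) (x0 : 'cV[R]_d) (T : \bar R)
    (x : R -> 'cV[R]_d) : Prop :=
  caputo_solution alpha g x0 T x /\
  forall S y, caputo_solution alpha g x0 S y ->
    (S <= T)%E /\ forall t, time_interval S t -> y t = x t.

Definition trivial_stable (R : realType) (d : nat) (alpha : R)
    (g : 'cV[R]_d -> 'cV[R]_d) : Prop :=
  forall eps : R, 0 < eps -> exists2 delta : R, 0 < delta &
    forall x0 : 'cV[R]_d, `|x0| < delta ->
      exists2 phi, maximal_solution alpha g x0 +oo%E phi &
        forall t, 0 <= t -> `|phi t| <= eps.

Definition trivial_attractive (R : realType) (d : nat) (alpha : R)
    (g : 'cV[R]_d -> 'cV[R]_d) : Prop :=
  exists2 delta : R, 0 < delta &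
    forall x0 : 'cV[R]_d, `|x0| < delta ->
      exists2 phi, maximal_solution alpha g x0 +oo%E phi &
        phi t @[t --> +oo] --> (0 : 'cV[R]_d).

Definition trivial_asymptotically_stable (R : realType) (d : nat) (alpha : R)
    (g : 'cV[R]_d -> 'cV[R]_d) : Prop :=
  trivial_stable alpha g /\ trivial_attractive alpha g.

(* Main.v *)
From mathcomp Require Import ring lra.
From mathcomp Require Import measurable_realfun.
Require Import Defs.
Set Implicit Arguments.
Unset Strict Implicit.
Unset Printing Implicit Defensive.
Import Order.TTheory GRing.Theory Num.Theory.
Local Open Scope classical_set_scope.
Local Open Scope ring_scope.

(** With k_p(s) = s^(p-1), [pker p], and b = 1 / Gamma(alpha), the equation
    reads x = x0 + k_alpha * (b (A x + f(x))), where * is the convolution on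
    ]0, t[.  The whole difficulty is one linear estimate: if
    X = k_alpha * (b A X + H), then X is controlled by H both uniformly,
    sup |X| <= D sup |H| on every ]0, T], and at infinity,
    limsup |X| <= D limsup |H|.  This is [dominated], and the estimate is
    [linear_dominated].  It is obtained from the Volterra equation alone,
    without Laplace transforms or asymptotics of Mittag-Leffler functions.

    A change of basis makes A triangular over the complex numbers, which
    reduces the estimate, one coordinate after another, to scalar equations
    X = k_p * (z X + H) with z = b lambda; [stable_coef p z] says that such an
    equation is dominated by its forcing.  Four steps give it for all z with
    |arg z| > p pi / 2 ([stable_coef_sector]).
    - For z = -c < 0 one has X = r * H with the resolvent r = k_p - c k_p * r.
      Log-convexity of k_p makes r positive ([resolvent_gt0]), and monotonicity
      of k_p bounds its integral by 1 / c ([resolvent_mass]); a convolution with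
      an integrable kernel is dominated ([dominated_conv]).
    - If Re z < 0, then z lies at distance < c from -c for c large, and the
      perturbation can be absorbed ([stable_coef_halfplane]).
    - If m p <= 1 and Re z^m < 0, iterating the equation m times gives one of
      order m p whose coefficient is a positive multiple of z^m
      ([stable_coef_power]).
    - If X+ and X- solve the equations of order p with coefficients mu and
      -mu, then (X+ - X-) / (2 mu B) solves the equation of order 2 p with
      coefficient B mu^2, B = beta p p ([stable_coef_double]).  Halving both
      the order and the argument in this way doubles the gap
      1 / p - pi / (2 |arg z|).  Once the gap is at least 1, an integer m with
      m |arg z| > pi / 2 and m p <= 1 exists and the previous step applies.

    For the nonlinear equation, f is composed with the projection onto a small
    cube, which makes it globally Lipschitz with a small constant q and gives a
    global solution x by Picard iteration.  Write x = R x0 + z with R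
    the scalar function 1 - k_alpha * R, which decreases to 0 ([rtail]).  Then
    z = k_alpha * (b A z + H), where |H| <= K0 R |x0| + b q |z|.  For q small
    the linear estimate absorbs the last term, so that |x| <= K |x0| and
    x tends to 0 ([truncated_decay]).  If K |x0| is smaller than the size of the
    cube, then x never sees the truncation, and any other solution coincides
    with it until it leaves the cube, hence for ever ([truncated_maximal]). *)

(** * Invariance of the Lebesgue integral on the line *)

Section Invariance.
Variable R : realType.
Local Notation mu := (@lebesgue_measure R).
Implicit Types f : R -> \bar R.
Local Open Scope ereal_scope.

Lemma pushforward_reflect (t : R) (A : set R) : measurable A ->
  pushforward mu (fun x => (t - x)%R : measurableTypeR R) A = mu A.
Proof.
move=> mA.
have mphi : measurable_fun [set: R] (fun x : R => (t - x)%R).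
  by apply: measurable_funB => //; exact: measurable_id.
apply/esym/lebesgue_measure_unique => //= _ [[a b]] _ <-.
rewrite /pushforward.
have -> : (fun x : R => (t - x)%R : measurableTypeR R) @^-1` `]a, b]%classic =
   `[(t - b)%R, (t - a)%R[%classic.
  by apply/seteqP; split => x /=; rewrite !in_itv/= => /andP[h1 h2]; apply/andP; split; lra.
rewrite !lebesgue_measure_itv/= !lte_fin.
have -> : (t - b < t - a)%R = (a < b)%R by apply/idP/idP => h; lra.
by case: ifP => // _; rewrite -!EFinB; congr EFin; lra.
Qed.

Lemma pushforward_scale (a : R) (A : set R) : (0 < a)%R -> measurable A ->
  pushforward mu (fun x => (a * x)%R : measurableTypeR R) A = (a^-1)%:E * mu A.
Proof.
move=> a0 mA.
have a0' : (0 <= a^-1)%R by rewrite invr_ge0 ltW.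
have mphi : measurable_fun [set: R] (fun x : R => (a * x)%R).
  by apply: measurable_funM => //; exact: measurable_id.
suff : (mscale (NngNum (ltW a0)) (pushforward mu (fun x => (a * x)%R : measurableTypeR R))) A = mu A.
    move=> /(_ mphi) e.
  have {}e : a%:E * pushforward mu (fun x => (a * x)%R : measurableTypeR R) A = mu A := e.
  by rewrite -e muleA -EFinM mulVf ?mul1e// gt_eqF.
move=> m; apply/esym/lebesgue_measure_unique => //= _ [[x y]] _ <-.
rewrite [RHS]/(a%:E * mu ((fun x : R => (a * x)%R : measurableTypeR R) @^-1` `]x, y])).
have -> : (fun x : R => (a * x)%R : measurableTypeR R) @^-1` `]x, y]%classic =
   `](x / a)%R, (y / a)%R]%classic.
  apply/seteqP; split => z /=; rewrite !in_itv/=;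
  by rewrite ltr_pdivrMr// ler_pdivlMr// ![(z * a)%R]mulrC.
rewrite !lebesgue_measure_itv/= !lte_fin ltr_pM2r ?invr_gt0//=.
case: (x < y)%R => /=; last by rewrite mulr0.
by rewrite -!EFinB; congr EFin; field; rewrite gt_eqF.
Qed.

Lemma ge0_integral_reflect (t : R) f : measurable_fun setT f ->
  (forall x, 0 <= f x) -> \int[mu]_x f (t - x)%R = \int[mu]_x f x.
Proof.
move=> mf f0.
have mphi : measurable_fun [set: R] (fun x : R => (t - x)%R).
  by apply: measurable_funB => //; exact: measurable_id.
transitivity (\int[pushforward mu (fun x : R => (t - x)%R : measurableTypeR R)]_x f x).
  by rewrite ge0_integral_pushforward.
by apply: eq_measure_integral => A mA _; exact: pushforward_reflect.
Qed.

Lemma ge0_integral_scale (a : R) f : (0 < a)%R -> measurable_fun setT f ->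
  (forall x, 0 <= f x) -> \int[mu]_x f (a * x)%R = a^-1%:E * \int[mu]_x f x.
Proof.
move=> a0 mf f0.
have a0' : (0 <= a^-1)%R by rewrite invr_ge0 ltW.
have mphi : measurable_fun [set: R] (fun x : R => (a * x)%R).
  by apply: measurable_funM => //; exact: measurable_id.
transitivity (\int[pushforward mu (fun x : R => (a * x)%R : measurableTypeR R)]_x f x).
  by rewrite ge0_integral_pushforward.
transitivity (\int[mscale (NngNum a0') mu]_x f x).
  by apply: eq_measure_integral => A mA _; exact: (pushforward_scale a0 mA).
by rewrite ge0_integral_mscale.
Qed.

Lemma integral_reflect_itv (t : R) f : measurable_fun setT f ->
  \int[mu]_(x in `]0%R, t[) f (t - x)%R = \int[mu]_(x in `]0%R, t[) f x.
Proof.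
move=> mf.
have key g : measurable_fun setT g -> (forall x, 0 <= g x) ->
    \int[mu]_(x in `]0%R, t[) g (t - x)%R = \int[mu]_(x in `]0%R, t[) g x.
  move=> mg g0; rewrite [RHS]integral_mkcond -[RHS](ge0_integral_reflect t).
  - rewrite integral_mkcond; apply: eq_integral => x _; rewrite /patch.
    suff -> : (t - x)%R \in `]0%R, t[%classic = (x \in `]0%R, t[%classic) by [].
    by apply/idP/idP; rewrite !inE/= !in_itv/= => /andP[h1 h2]; apply/andP; split; lra.
  - by apply/(measurable_restrictT _ _).1 => //; exact: measurable_funS mg.
  - by move=> x; rewrite /patch; case: ifP.
rewrite integralE [RHS]integralE (funepos_comp f (fun x => t - x)%R) (funeneg_comp f (fun x => t - x)%R).
have e1 := key _ (measurable_funepos mf) (funepos_ge0 _).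
have e2 := key _ (measurable_funeneg mf) (funeneg_ge0 _).
by congr (_ - _); [exact: e1|exact: e2].
Qed.

Lemma ge0_integral_scale_itv (t : R) f : (0 < t)%R -> measurable_fun setT f ->
  (forall x, 0 <= f x) ->
  \int[mu]_(x in `]0%R, 1%R[) f (t * x)%R = t^-1%:E * \int[mu]_(x in `]0%R, t[) f x.
Proof.
move=> t0 mf f0; rewrite [in RHS]integral_mkcond -[RHS]ge0_integral_scale//.
- rewrite integral_mkcond; apply: eq_integral => x _; rewrite /patch.
  suff -> : (t * x)%R \in `]0%R, t[%classic = (x \in `]0%R, 1%R[%classic) by [].
  by apply/idP/idP; rewrite !inE/= !in_itv/= pmulr_rgt0// gtr_pMr.
- by apply/(measurable_restrictT _ _).1 => //; exact: measurable_funS mf.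
- by move=> x; rewrite /patch; case: ifP.
Qed.
End Invariance.

(** * The kernels of fractional integration *)

Section PowerKernel.
Variable R : realType.
Local Notation mu := (@lebesgue_measure R).
Implicit Types p q s t : R.

Definition pker p : R -> R := fun s => s `^ (p - 1).

Lemma measurable_pker p : measurable_fun setT (pker p).
Proof. exact: measurable_powR. Qed.

Lemma pker_ge0 p s : 0 <= pker p s.
Proof. exact: powR_ge0. Qed.

Lemma pker_gt0 p s : 0 < s -> 0 < pker p s.
Proof. exact: powR_gt0. Qed.

Lemma pker_nonincr p s t : p <= 1 -> 0 < s -> s <= t -> pker p t <= pker p s.
Proof.
move=> p1 s0 st; rewrite /pker.
have -> : p - 1 = - (1 - p) by lra.
rewrite !powRN lef_pV2 ?posrE ?powR_gt0 ?(lt_le_trans s0 st)//.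
by apply: ge0_ler_powR; rewrite ?nnegrE; lra.
Qed.

Lemma continuous_pker p t : 0 < t -> {for t, continuous (pker p)}.
Proof.
move=> t0; apply: differentiable_continuous; apply/derivable1_diffP.
by apply: derivable_powR; rewrite in_itv/= andbT.
Qed.

Lemma integral_pker_cc p (a b : R) : 0 < a -> a < b -> p != 0 ->
  (\int[mu]_(s in `[a, b]) (pker p s)%:E = ((b `^ p - a `^ p) / p)%:E)%E.
Proof.
move=> a0 ab p0.
have der (x : R) : 0 < x -> is_derive x 1 (fun s => s `^ p / p) (pker p x).
  move=> x0; have := is_derive1_powR p x0 => h.
  have -> : (fun s => s `^ p / p) = (fun s => p^-1 *: (s `^ p)) by apply/funext => s; rewrite mulrC.
  have := is_deriveZ (p^-1) h => {}h.
  by apply: is_derive_eq h _; rewrite /pker /GRing.scale/= mulrA mulVf ?mul1r.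
have cF (x : R) : 0 < x -> {for x, continuous (fun s => s `^ p / p)}.
  by move=> x0; apply: differentiable_continuous; apply/derivable1_diffP; apply: ex_derive; exact: der.
rewrite (continuous_FTC2 (F := fun s => s `^ p / p))//.
- by rewrite -EFinB -mulrBl.
- apply: continuous_in_subspaceT => x; rewrite inE/= in_itv/= => /andP[ax _].
  by apply: continuous_pker; exact: lt_le_trans ax.
- split.
  + move=> x; rewrite in_itv/= => /andP[ax _]; apply: ex_derive; apply: der; exact: lt_trans ax.
  + by apply: cvg_at_right_filter; apply: cF.
  + by apply: cvg_at_left_filter; apply: cF; exact: lt_trans ab.
- move=> x; rewrite in_itv/= => /andP[ax _]; rewrite derive1E.
  by have [_ ->] := der _ (lt_trans a0 ax).
Qed.

(** Improper at 0: the integrals over [t/(n+2), t] increase to it. *)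
Lemma integral_pker p t : 0 < p -> 0 < t ->
  (\int[mu]_(s in `]0%R, t[) (pker p s)%:E = (t `^ p / p)%:E)%E.
Proof.
move=> p0 t0.
rewrite integral_itv_bndo_bndc; last first.
  by apply/measurable_EFinP; apply: measurable_funS (measurable_pker p).
pose F n := `[t / n.+2%:R, t]%classic.
have Fb : `]0, t]%classic = \bigcup_n F n.
  apply/seteqP; split => x /=.
    rewrite in_itv/= => /andP[x0 xt].
    have [n tn] : exists n : nat, t / x < n%:R.
      by exists (Num.bound (t / x)); apply: archi_boundP; rewrite divr_ge0// ltW.
    exists n => //; rewrite /F/= in_itv/= xt andbT ler_pdivrMr// mulrC -ler_pdivrMr//.
    by rewrite (le_trans (ltW tn))// ler_nat -addn2 leq_addr.
  move=> [n _]; rewrite /F/= !in_itv/= => /andP[h ->]; rewrite andbT.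
  by apply: lt_le_trans h; rewrite divr_gt0.
have ndF : {homo F : n m / (n <= m)%N >-> (n <= m)%O}.
  move=> n m nm; rewrite subsetEset => x; rewrite /F/= !in_itv/= => /andP[h ->].
  rewrite andbT (le_trans _ h)// ler_pM2l// lef_pV2 ?posrE ?ltr0n// ler_nat.
  by rewrite !ltnS.
have h : ((\int[mu]_(s in F i) (pker p s)%:E) @[i --> \oo] -->
  (\int[mu]_(s in \bigcup_i F i) (pker p s)%:E))%E.
  apply: ge0_nondecreasing_set_cvg_integral => //.
  - by move=> i; exact: measurable_itv.
  - by move=> i; apply/measurable_EFinP; apply: measurable_funS (measurable_pker p).
  - by move=> i x _; rewrite lee_fin pker_ge0.
rewrite Fb; apply/esym; rewrite -(cvg_lim _ h)//; apply/esym/cvg_lim => //.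
have -> : (fun i => \int[mu]_(s in F i) (pker p s)%:E)%E =
   (fun i => ((t `^ p - (t / i.+2%:R) `^ p) / p)%:E).
  apply/funext => i; rewrite integral_pker_cc// ?divr_gt0 ?gt_eqF//.
  by rewrite gtr_pMr// invf_lt1 ?ltr0n// ltr1n.
apply: cvg_EFin; first exact: nearW.
have : (fun i : nat => (t / i.+2%:R) `^ p) @ \oo --> (0 : R).
  apply: ((cvg_at_rightP _ _ _).1 (powR_cvg0 p0)); split; first by move=> n; rewrite divr_gt0.
  rewrite -(mulr0 t); apply: cvgMr.
  have := @cvg_harmonic R; rewrite -cvg_shiftS; exact.
move=> hc; rewrite /comp/=.
have -> : t `^ p / p = (t `^ p - 0) / p by rewrite subr0.
by apply: cvgMl; apply: cvgB hc; exact: cvg_cst.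
Qed.
End PowerKernel.

(** * Convolution on the half-line *)

Section Convolution.
Variable R : realType.
Local Notation mu := (@lebesgue_measure R).
Implicit Types (p q s t : R) (f g h : R -> R).

(** Weakly singular functions of order p: measurable and O(s^(p-1)) at 0,
    locally uniformly on the half-line.  This class contains the kernels and
    the locally bounded functions and is stable under convolution, so that one
    hypothesis serves for all integrability conditions. *)
Definition wsing p f := [/\ 0 < p <= 1, measurable_fun setT f &
  forall T, exists2 C : R, 0 <= C & forall t, 0 < t <= T -> `|f t| <= C * pker p t].

Definition conv f g t := \int[mu]_(s in `]0, t[) (f (t - s) * g s).

Lemma measurable_rev f t : measurable_fun setT f -> measurable_fun setT (fun s => f (t - s)).
Proof.
move=> mf; apply: (measurableT_comp mf).
by apply: measurable_funB => //; exact: measurable_id.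
Qed.

Lemma integrable_pker p t : 0 < p -> mu.-integrable `]0, t[ (EFin \o pker p).
Proof.
move=> p0; have mp D : measurable_fun D (EFin \o pker p).
  by apply/measurable_EFinP; exact: measurable_funS (measurable_pker p).
have [t0|t0] := ltP 0 t; last by rewrite set_itv_ge ?bnd_simp -?leNgt//; exact: integrable_set0.
apply/integrableP; split; first exact: mp.
under eq_integral do rewrite /= ger0_norm ?pker_ge0//.
by rewrite integral_pker// ltry.
Qed.

Lemma integrable_rev f t : measurable_fun setT f ->
  mu.-integrable `]0, t[ (EFin \o f) -> mu.-integrable `]0, t[ (EFin \o (fun s => f (t - s))).
Proof.
move=> mf /integrableP[_ h]; apply/integrableP; split.
  by apply/measurable_EFinP; apply: measurable_funS (measurable_rev t mf).
have m2 : measurable_fun setT (fun s => `|(f s)%:E|)%E.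
  by apply: measurableT_comp => //; exact/measurable_EFinP.
by rewrite (integral_reflect_itv t m2).
Qed.

Lemma integrable_scale f c t : mu.-integrable `]0, t[ (EFin \o f) ->
  mu.-integrable `]0, t[ (fun s => (c * f s)%:E).
Proof.
move=> intf; have := @integrableZl _ _ _ mu `]0, t[%classic (measurable_itv _) c (EFin \o f) intf.
exact.
Qed.

Lemma integrable_add f g t : mu.-integrable `]0, t[ (EFin \o f) -> mu.-integrable `]0, t[ (EFin \o g) ->
  mu.-integrable `]0, t[ (fun s => (f s + g s)%:E).
Proof.
move=> intf intg; have := @integrableD _ _ _ mu `]0, t[%classic (measurable_itv _) _ _ intf intg.
exact.
Qed.

Lemma wsing_bound p f T : wsing p f ->
  exists2 C : R, 0 <= C & forall t, 0 < t < T -> `|f t| <= C * pker p t.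
Proof.
move=> [_ _ /(_ T)[C C0 hC]]; exists C => // t /andP[t0 tT].
by apply: hC; rewrite t0 ltW.
Qed.

Lemma wsing_integrable p f t : wsing p f -> mu.-integrable `]0, t[ (EFin \o f).
Proof.
move=> wf; have [C C0 hC] := wsing_bound t wf; have [/andP[p0 p1] mf _] := wf.
apply: (@le_integrable _ _ _ mu `]0, t[%classic _ _ (fun s => (C * pker p s)%:E)) => //.
- by apply/measurable_EFinP; exact: measurable_funS mf.
- move=> s; rewrite /= in_itv/= => st; rewrite lee_fin (le_trans (hC _ st))//.
  by rewrite ler_norm.
- by apply: integrable_scale; exact: integrable_pker.
Qed.

(** Of the two factors of the integrand of k_p * k_q, only one is singular on
    each half of ]0, t[. *)
Lemma pker_mul_le p q s t : 0 < p <= 1 -> 0 < q <= 1 -> 0 < s < t ->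
  pker p (t - s) * pker q s <= pker p (t / 2) * pker q s + pker q (t / 2) * pker p (t - s).
Proof.
move=> /andP[p0 p1] /andP[q0 q1] /andP[s0 st].
have [h|h] := leP s (t / 2).
- apply: ler_wpDr; first by rewrite mulr_ge0 ?pker_ge0.
  by rewrite ler_wpM2r ?pker_ge0//; apply: pker_nonincr => //; lra.
- apply: ler_wpDl; first by rewrite mulr_ge0 ?pker_ge0.
  by rewrite mulrC ler_wpM2r ?pker_ge0//; apply: pker_nonincr => //; lra.
Qed.

Lemma conv_integrable p q f g t : wsing p f -> wsing q g ->
  mu.-integrable `]0, t[ (fun s => (f (t - s) * g s)%:E).
Proof.
move=> wf wg; have [C C0 hC] := wsing_bound t wf; have [D D0 hD] := wsing_bound t wg.
have [pp mf _] := wf; have [qq mg _] := wg.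
have [/andP[p0 p1] /andP[q0 q1]] := (pp, qq).
apply: (@le_integrable _ _ _ mu `]0, t[%classic _ _ (fun s => ((C * D * pker p (t / 2)) * pker q s +
   (C * D * pker q (t / 2)) * pker p (t - s))%:E)) => //.
- apply/measurable_EFinP; apply: (@measurable_funS _ _ _ _ setT) => //.
  by apply: measurable_funM => //; exact: measurable_rev.
- move=> s; rewrite /= in_itv/= => /andP[s0 st]; rewrite lee_fin normrM.
  apply: le_trans (ler_norm _).
  apply: (@le_trans _ _ (C * D * (pker p (t - s) * pker q s))).
    rewrite [leRHS](_ : _ = (C * pker p (t - s)) * (D * pker q s)); last by ring.
    by apply: ler_pM => //; [apply: hC|apply: hD]; rewrite ?s0//; apply/andP; split; lra.
  rewrite -!mulrA -!mulrDr; do 2 rewrite ler_wpM2l//.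
  by apply: pker_mul_le => //; rewrite s0.
- apply: integrable_add.
  + by apply: integrable_scale; exact: integrable_pker.
  + apply: integrable_scale.
    by apply: (@integrable_rev (pker p)); [exact: measurable_pker|exact: integrable_pker].
Qed.

Lemma conv_le0 f g t : t <= 0 -> conv f g t = 0.
Proof. by move=> t0; rewrite /conv set_itv_ge ?bnd_simp -?leNgt// Rintegral_set0. Qed.

Lemma eq_conv f f' g g' t : (forall s, 0 < s < t -> f s = f' s) ->
  (forall s, 0 < s < t -> g s = g' s) -> conv f g t = conv f' g' t.
Proof.
move=> ff gg; apply: eq_Rintegral => s; rewrite inE/= in_itv/= => /andP[s0 st].
by rewrite gg ?s0// ff//; apply/andP; split; lra.
Qed.

Lemma convC f g t : measurable_fun setT f -> measurable_fun setT g -> conv f g t = conv g f t.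
Proof.
move=> mf mg; rewrite /conv /Rintegral; congr fine.
have m : measurable_fun setT (fun s => (f (t - s) * g s)%:E).
  by apply/measurable_EFinP; apply: measurable_funM => //; exact: measurable_rev.
rewrite -(integral_reflect_itv t m); apply: eq_integral => s _.
by rewrite opprB addrCA subrr addr0 mulrC.
Qed.

Lemma convDr p q f g h t : wsing p f -> wsing q g -> wsing q h ->
  conv f (fun s => g s + h s) t = conv f g t + conv f h t.
Proof.
move=> wf wg wh; rewrite /conv -RintegralD//; first last.
- exact: conv_integrable wf wh.
- exact: conv_integrable wf wg.
by apply: eq_Rintegral => s _; rewrite mulrDr.
Qed.

Lemma convZr p q f g c t : wsing p f -> wsing q g ->
  conv f (fun s => c * g s) t = c * conv f g t.
Proof.
move=> wf wg; rewrite /conv -RintegralZl//; last exact: conv_integrable wf wg.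
by apply: eq_Rintegral => s _; rewrite mulrCA.
Qed.

Lemma convZl p q f g c t : wsing p f -> wsing q g ->
  conv (fun s => c * f s) g t = c * conv f g t.
Proof.
move=> wf wg; rewrite /conv -RintegralZl//; last exact: conv_integrable wf wg.
by apply: eq_Rintegral => s _; rewrite mulrA.
Qed.

Lemma conv1l g t : conv (fun=> 1) g t = \int[mu]_(s in `]0, t[) g s.
Proof. by apply: eq_Rintegral => s _; rewrite mul1r. Qed.

Lemma wsingD p f g : wsing p f -> wsing p g -> wsing p (fun s => f s + g s).
Proof.
move=> [pp mf hf] [_ mg hg]; split => //; first exact: measurable_funD.
move=> T; have [C C0 hC] := hf T; have [D D0 hD] := hg T.
exists (C + D); first by rewrite addr_ge0.
by move=> t tT; rewrite (le_trans (ler_normD _ _))// mulrDl lerD ?hC ?hD.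
Qed.

Lemma wsingZ p f c : wsing p f -> wsing p (fun s => c * f s).
Proof.
move=> [pp mf hf]; split => //; first exact: measurable_funM.
move=> T; have [C C0 hC] := hf T; exists (`|c| * C); first by rewrite mulr_ge0.
by move=> t tT; rewrite normrM -mulrA ler_wpM2l ?hC.
Qed.

Lemma wsing_abs p f : wsing p f -> wsing p (fun s => `|f s|).
Proof.
move=> [pp mf hf]; split => //; first exact: measurableT_comp.
move=> T; have [C C0 hC] := hf T; exists C => // t tT; rewrite normr_id; exact: hC.
Qed.

Lemma wsing_pker p q : 0 < p <= 1 -> p <= q -> wsing p (pker q).
Proof.
move=> pp pq; split => //; first exact: measurable_pker.
move=> T; exists (`|T| `^ (q - p)); first exact: powR_ge0.
move=> t /andP[t0 tT]; rewrite ger0_norm ?pker_ge0// /pker.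
have -> : q - 1 = (q - p) + (p - 1) by lra.
rewrite powRD; last by rewrite (gt_eqF t0) implybT.
rewrite ler_wpM2r ?powR_ge0//; apply: ge0_ler_powR; rewrite ?nnegrE ?subr_ge0 ?(ltW t0)//.
by rewrite (le_trans tT)// ler_norm.
Qed.

Definition locally_bounded f := forall T : R, exists M : R, forall t, 0 < t <= T -> `|f t| <= M.

Lemma wsing_bounded p f : 0 < p <= 1 -> measurable_fun setT f -> locally_bounded f -> wsing p f.
Proof.
move=> pp mf hf; split => // T.
have [M hM] := hf T; have /andP[p0 p1] := pp.
exists (`|M| * `|T| `^ (1 - p)); first by rewrite mulr_ge0// powR_ge0.
move=> t /andP[t0 tT]; have := hM t; rewrite t0 tT => /(_ isT) {}hM.
apply: (le_trans hM); apply: (le_trans (ler_norm _)); rewrite -mulrA ler_peMr//.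
have e : 1 = t `^ (1 - p) * t `^ (p - 1).
  by rewrite -powRD ?(gt_eqF t0) ?implybT// addrC subrKA subrr powRr0.
rewrite {1}e ler_wpM2r ?powR_ge0//; apply: ge0_ler_powR; rewrite ?nnegrE ?subr_ge0 ?(ltW t0)//.
by rewrite (le_trans tT)// ler_norm.
Qed.

Lemma le_conv p q f g f' g' t : wsing p f -> wsing p f' -> wsing q g -> wsing q g' ->
  (forall s, 0 < s < t -> f (t - s) * g s <= f' (t - s) * g' s) -> conv f g t <= conv f' g' t.
Proof.
move=> wf wf' wg wg' h; apply: le_Rintegral => //.
- exact: conv_integrable wf wg.
- exact: conv_integrable wf' wg'.
Qed.

Lemma norm_conv_le p q f g t : wsing p f -> wsing q g ->
  `|conv f g t| <= conv (fun s => `|f s|) (fun s => `|g s|) t.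
Proof.
move=> wf wg; apply: le_trans (le_normr_Rintegral _ _) _ => //.
  exact: conv_integrable wf wg.
by rewrite le_eqVlt; apply/orP; left; apply/eqP; apply: eq_Rintegral => s _; rewrite normrM.
Qed.

Lemma conv_ge0 f g t : (forall s, 0 < s < t -> 0 <= f s) -> (forall s, 0 < s < t -> 0 <= g s) ->
  0 <= conv f g t.
Proof.
move=> f0 g0; apply: Rintegral_ge0 => s; rewrite /= in_itv/= => /andP[s0 st].
by rewrite mulr_ge0 ?g0 ?f0 ?s0//; apply/andP; split; lra.
Qed.

(** Extension by 0 to the negative half-line; it turns [conv] into a
    convolution over the whole line, to which Fubini and translation
    invariance apply directly. *)
Definition causal f : R -> R := f \_ `]0, +oo[%classic.

Lemma causalE f s : 0 < s -> causal f s = f s.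
Proof. by move=> s0; rewrite /causal patchE mem_set//= in_itv/= s0. Qed.

Lemma causal0 f s : s <= 0 -> causal f s = 0.
Proof. by move=> s0; rewrite /causal patchE memNset//= in_itv/= ltNge s0. Qed.

Lemma measurable_causal f : measurable_fun setT f -> measurable_fun setT (causal f).
Proof.
move=> mf; apply/(measurable_restrictT _ _).1 => //; exact: measurable_funS mf.
Qed.

Lemma causal_prodE f g t : (fun s => causal f (t - s) * causal g s) = (fun s => f (t - s) * g s) \_ `]0, t[%classic.
Proof.
apply/funext => s; rewrite patchE.
have [s0|s0] := ltP 0 s; last first.
  by rewrite (@causal0 g)// mulr0 memNset//= in_itv/= ltNge s0.
have [st|st] := ltP s t; last first.
  by rewrite causal0 ?mul0r ?memNset//= ?in_itv/= ?[s < t]ltNge ?st ?andbF//; lra.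
by rewrite mem_set/= ?in_itv/= ?s0 ?st// !causalE// subr_gt0.
Qed.

Lemma convE f g t : conv f g t = \int[mu]_s (causal f (t - s) * causal g s).
Proof. by rewrite /conv Rintegral_mkcond -causal_prodE. Qed.

Lemma integrable_causal_prod p q f g t : wsing p f -> wsing q g ->
  mu.-integrable setT (fun s => (causal f (t - s) * causal g s)%:E).
Proof.
move=> wf wg; have := conv_integrable t wf wg.
rewrite integrable_mkcond// => h; have -> : (fun s => (causal f (t - s) * causal g s)%:E) =
  (fun s => (f (t - s) * g s)%:E) \_ `]0, t[%classic; last exact: h.
by have := causal_prodE f g t => /(congr1 (fun k => EFin \o k)); rewrite -restrict_EFin.
Qed.

Lemma EFin_conv p q f g t : wsing p f -> wsing q g ->
  (\int[mu]_s (causal f (t - s) * causal g s)%:E = (conv f g t)%:E)%E.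
Proof.
move=> wf wg; rewrite convE /Rintegral fineK//.
exact: integrable_fin_num (integrable_causal_prod t wf wg).
Qed.

Lemma measurable_conv p q f g : wsing p f -> wsing q g -> measurable_fun setT (conv f g).
Proof.
move=> wf wg; have [_ mf _] := wf; have [_ mg _] := wg.
pose phi (z : R * R) := (causal f (z.1 - z.2) * causal g z.2)%:E.
have mphi : measurable_fun setT phi.
  apply/measurable_EFinP; apply: measurable_funM.
    apply: (measurableT_comp (measurable_causal mf)); apply: measurable_funB => //.
  exact: (measurableT_comp (measurable_causal mg)).
have -> : conv f g = fine \o ((fun t => \int[mu]_s phi^\+ (t, s)) \- (fun t => \int[mu]_s phi^\- (t, s)))%E.
  apply/funext => t; rewrite convE /Rintegral /=; congr fine.
  by rewrite integralE; congr (_ - _)%E; apply: eq_integral => s _; rewrite /phi ?funeposE ?funenegE.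
apply: (measurableT_comp (fine_measurable measurableT)) => //.
apply: emeasurable_funB; apply: measurable_fun_fubini_tonelli_F => //.
- exact: measurable_funepos.
- exact: measurable_funeneg.
Qed.

Lemma Rintegral_pker p t : 0 < p -> 0 < t -> \int[mu]_(s in `]0, t[) pker p s = t `^ p / p.
Proof. by move=> p0 t0; rewrite /Rintegral integral_pker. Qed.

Lemma Rintegral_rev f t : measurable_fun setT f ->
  \int[mu]_(s in `]0, t[) f (t - s) = \int[mu]_(s in `]0, t[) f s.
Proof.
move=> mf; rewrite /Rintegral; congr fine.
by rewrite (@integral_reflect_itv _ t (EFin \o f))//; exact/measurable_EFinP.
Qed.

(** This bound, from [pker_mul_le], makes the class [wsing] stable under
    convolution. *)
Lemma conv_pker_le p q t : 0 < p <= 1 -> 0 < q <= 1 -> 0 < t ->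
  conv (pker p) (pker q) t <= (2 `^ (1 - p) / q + 2 `^ (1 - q) / p) * t `^ p * pker q t.
Proof.
move=> pp qq t0; have [/andP[p0 p1] /andP[q0 q1]] := (pp, qq).
have ip1 : mu.-integrable `]0, t[ (EFin \o (fun s => pker p (t - s))).
  by apply: (@integrable_rev (pker p)); [exact: measurable_pker|exact: integrable_pker].
have iq1 : mu.-integrable `]0, t[ (EFin \o pker q) by exact: integrable_pker.
apply: (@le_trans _ _ (\int[mu]_(s in `]0, t[)
   (pker p (t / 2) * pker q s + pker q (t / 2) * pker p (t - s)))).
  apply: le_Rintegral => //.
  - by apply: conv_integrable (wsing_pker pp (lexx _)) (wsing_pker qq (lexx _)).
  - by apply: (@integrable_add (fun s => pker p (t / 2) * pker q s)); exact: integrable_scale.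
  - by move=> s; rewrite /= in_itv/= => st; exact: pker_mul_le.
rewrite RintegralD//; [|exact: integrable_scale..].
rewrite !RintegralZl// Rintegral_rev; last exact: measurable_pker.
rewrite !Rintegral_pker// /pker.
have e a : (t / 2) `^ (a - 1) = 2 `^ (1 - a) * t `^ (a - 1).
  rewrite powRM ?(ltW t0)// mulrC; congr (_ * _).
  by rewrite -powR_inv1// -powRrM; congr (_ `^ _); lra.
have e2 a : 0 < a -> t `^ a = t * t `^ (a - 1) by move=> a0; rewrite mulr_powRB1 ?(ltW t0).
rewrite !e (e2 _ p0) (e2 _ q0).
by rewrite le_eqVlt; apply/orP; left; apply/eqP; field; rewrite !gt_eqF.
Qed.

Lemma wsing_conv p q f g : wsing p f -> wsing q g -> wsing q (conv f g).
Proof.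
move=> wf wg; have [pp _ hf] := wf; have [qq _ hg] := wg.
have [/andP[p0 p1] /andP[q0 q1]] := (pp, qq).
split => //; first exact: measurable_conv wf wg.
move=> T; have [C C0 hC] := hf T; have [D D0 hD] := hg T.
exists (C * D * ((2 `^ (1 - p) / q + 2 `^ (1 - q) / p) * `|T| `^ p)).
  by rewrite !mulr_ge0 ?addr_ge0 ?divr_ge0 ?powR_ge0 ?(ltW p0) ?(ltW q0).
move=> t /andP[t0 tT].
apply: (le_trans (norm_conv_le t wf wg)).
apply: (@le_trans _ _ (conv (fun s => C * pker p s) (fun s => D * pker q s) t)).
  apply: (@le_conv p q).
  - exact: wsing_abs.
  - by apply: wsingZ; exact: wsing_pker.
  - exact: wsing_abs.
  - by apply: wsingZ; exact: wsing_pker.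
  - move=> s /andP[s0 st]; apply: ler_pM => //; [apply: hC|apply: hD]; apply/andP; split; lra.
have -> : conv (fun s => C * pker p s) (fun s => D * pker q s) t = C * D * conv (pker p) (pker q) t.
  rewrite /conv -RintegralZl//; first by apply: eq_Rintegral => s _; ring.
  by apply: conv_integrable (wsing_pker pp (lexx _)) (wsing_pker qq (lexx _)).
rewrite -!mulrA; do 2 rewrite ler_wpM2l//.
apply: (le_trans (conv_pker_le pp qq t0)); rewrite -mulrA.
rewrite ler_wpM2l ?addr_ge0 ?divr_ge0 ?powR_ge0 ?(ltW p0) ?(ltW q0)//.
rewrite ler_wpM2r ?pker_ge0//; apply: ge0_ler_powR; rewrite ?nnegrE ?(ltW t0) ?(ltW p0)//.
by rewrite (le_trans tT)// ler_norm.
Qed.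

Lemma integral_shift (u : R) (f : R -> \bar R) : measurable_fun setT f ->
  (\int[mu]_s f (s - u)%R = \int[mu]_s f s)%E.
Proof.
move=> mf.
have key (k : R -> \bar R) : measurable_fun setT k -> (forall x, 0 <= k x)%E ->
    (\int[mu]_s k (s - u)%R = \int[mu]_s k s)%E.
  move=> mk k0.
  have mk' : measurable_fun setT (fun s => k (0 - s)).
    by apply: (measurableT_comp mk); apply: measurable_funB => //; exact: measurable_id.
  rewrite -(ge0_integral_reflect 0 mk k0) -(@ge0_integral_reflect _ u _ mk')//.
  by apply: eq_integral => s _; congr k; lra.
rewrite integralE [RHS]integralE (funepos_comp f (fun x => x - u)) (funeneg_comp f (fun x => x - u)).
have e1 := key _ (measurable_funepos mf) (funepos_ge0 _).
have e2 := key _ (measurable_funeneg mf) (funeneg_ge0 _).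
by congr (_ - _)%E; [exact: e1|exact: e2].
Qed.

Lemma causal_conv f g : causal (conv f g) = conv f g.
Proof.
by apply/funext => s; have [s0|s0] := ltP 0 s; [rewrite causalE|rewrite causal0// conv_le0].
Qed.

(** Fubini for the causal extensions; its integrability condition is the
    existence of |f| * (|g| * |h|), which [wsing_conv] provides. *)
Lemma convA p q r f g h t : wsing p f -> wsing q g -> wsing r h ->
  conv f (conv g h) t = conv (conv f g) h t.
Proof.
move=> wf wg wh; have [_ mf _] := wf; have [_ mg _] := wg; have [_ mh _] := wh.
have mF := measurable_causal mf; have mG := measurable_causal mg; have mH := measurable_causal mh.
pose phi (z : R * R) := (causal f (t - z.1) * (causal g (z.1 - z.2) * causal h z.2))%:E.
have mphi : measurable_fun setT phi.
  apply/measurable_EFinP; apply: measurable_funM.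
    by apply: (measurableT_comp mF); apply: measurable_funB.
  apply: measurable_funM; last exact: (measurableT_comp mH).
  by apply: (measurableT_comp mG); apply: measurable_funB.
have causal_abs k s : `|causal k s| = causal (fun x => `|k x|) s.
  by have [s0|s0] := ltP 0 s; [rewrite !causalE|rewrite !causal0// normr0].
have iphi : (mu \x mu)%E.-integrable setT phi.
  apply/(@integrable12ltyP _ _ _ _ _ mu mu phi mphi).
  have -> : (fun x => \int[mu]_y `|phi (x, y)|)%E = (fun x => (causal (fun s => `|f s|) (t - x) *
      causal (conv (fun s => `|g s|) (fun s => `|h s|)) x)%:E).
    apply/funext => x; rewrite causal_conv EFinM -(EFin_conv x (wsing_abs wg) (wsing_abs wh)).
    rewrite -integralZl//; last exact: integrable_causal_prod (wsing_abs wg) (wsing_abs wh).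
    by apply: eq_integral => y _; rewrite /phi/= !normrM !causal_abs.
  rewrite (EFin_conv t (wsing_abs wf) (wsing_conv (wsing_abs wg) (wsing_abs wh))).
  exact: ltry.
rewrite convE [RHS]convE /Rintegral; congr fine.
transitivity (\int[mu]_x \int[mu]_y phi (x, y))%E.
  apply: eq_integral => x _; rewrite causal_conv EFinM -(EFin_conv x wg wh).
  rewrite -integralZl//; last exact: integrable_causal_prod wg wh.
rewrite (Fubini iphi).
apply: eq_integral => y _; rewrite causal_conv EFinM -(EFin_conv (t - y) wf wg) muleC.
rewrite -integralZl//; last exact: integrable_causal_prod wf wg.
have m : measurable_fun setT (fun s => (causal h y)%:E * (causal f (t - y - s) * causal g s)%:E)%E.
  apply/measurable_EFinP; apply: measurable_funM => //; apply: measurable_funM => //.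
  exact: (measurable_rev _ mF).
rewrite -(integral_shift y m); apply: eq_integral => s _.
rewrite /phi/= -EFinM; congr EFin.
have -> : t - y - (s - y) = t - s by lra.
by rewrite [RHS]mulrCA; congr (_ * _); rewrite mulrC.
Qed.

(** The Euler Beta function. *)
Definition beta p q := conv (pker p) (pker q) 1.

(** Homogeneity: substitute s = t u in the integral. *)
Lemma conv_pker p q t : 0 < p <= 1 -> 0 < q <= 1 -> 0 < t ->
  conv (pker p) (pker q) t = beta p q * pker (p + q) t.
Proof.
move=> pp qq t0.
have wp := wsing_pker pp (lexx _); have wq := wsing_pker qq (lexx _).
pose k := fun s => (pker p (t - s) * pker q s)%:E.
have mk : measurable_fun setT k.
  by apply/measurable_EFinP; apply: measurable_funM; [apply: measurable_rev; exact: measurable_pker|exact: measurable_pker].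
have := @ge0_integral_scale_itv _ _ _ t0 mk (fun x => mulr_ge0 (pker_ge0 _ _) (pker_ge0 _ _)).
have -> : (\int[mu]_(s in `]0%R, t[) k s)%E = (conv (pker p) (pker q) t)%:E.
  by rewrite /conv /Rintegral fineK//; apply: integrable_fin_num => //; exact: conv_integrable wp wq.
have -> : (\int[mu]_(s in `]0%R, 1%R[) k (t * s)%R)%E = (pker (p + q - 1) t * beta p q)%:E.
  rewrite EFinM /beta /conv /Rintegral fineK; last first.
    by apply: integrable_fin_num => //; exact: conv_integrable wp wq.
  rewrite -integralZl//; last exact: conv_integrable wp wq.
  apply: eq_integral => s; rewrite inE/= in_itv/= => /andP[s0 s1].
  rewrite /k -EFinM; congr EFin; rewrite /pker -{1}(mulr1 t) -mulrBr.
  rewrite !powRM ?(ltW t0) ?(ltW s0) ?subr_ge0 ?(ltW s1)//.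
  have -> : p + q - 1 - 1 = (p - 1) + (q - 1) by lra.
  by rewrite (@powRD _ t (p - 1) (q - 1)) ?(gt_eqF t0) ?implybT//; ring.
have inj (a b c : R) : (a%:E = b%:E * c%:E)%E -> a = b * c by rewrite -EFinM; exact: EFin_inj.
move/inj => e.
have h : t * pker (p + q - 1) t = pker (p + q) t.
  rewrite /pker; have -> : t * t `^ (p + q - 1 - 1) = t `^ 1 * t `^ (p + q - 1 - 1) by rewrite powRr1 ?ltW.
  have c0 : (1 + (p + q - 1 - 1) == 0) ==> (t != 0) by rewrite (gt_eqF t0) implybT.
  rewrite -(powRD c0).
  by have -> : 1 + (p + q - 1 - 1) = p + q - 1 by lra.
by rewrite -(mulVKf (lt0r_neq0 t0) (conv _ _ t)) -e mulrA h mulrC.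
Qed.

Lemma beta_gt0 p q : 0 < p <= 1 -> 0 < q <= 1 -> 0 < beta p q.
Proof.
move=> pp qq; have [/andP[p0 p1] /andP[q0 q1]] := (pp, qq).
have ge1 a s : a <= 1 -> 0 < s < 1 -> 1 <= pker a s.
  move=> a1 /andP[s0 s1]; rewrite -[leLHS](powRr0 s) /pker; apply: ger_powR; rewrite ?s0 ?(ltW s1)//.
  by rewrite lerBlDr add0r.
have w1 : wsing 1 (fun=> 1 : R).
  by apply: wsing_bounded; rewrite ?ltr01 ?lexx//; move=> T; exists 1 => t _; rewrite normr1.
apply: (@lt_le_trans _ _ (\int[mu]_(s in `]0, 1[) 1)).
  by rewrite Rintegral_cst//= lebesgue_measure_itv/= lte_fin ltr01/= subr0 mulr1 ltr01.
apply: le_Rintegral => //.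
- exact: (wsing_integrable 1 w1).
- by apply: conv_integrable (wsing_pker pp (lexx _)) (wsing_pker qq (lexx _)).
- move=> s; rewrite /= in_itv/= => /andP[s0 s1].
  by rewrite -[1]mulr1 ler_pM ?ler01// ge1 ?s0//; apply/andP; split; lra.
Qed.
End Convolution.

(** * Fractional integrals of bounded functions *)

Section Smoothing.
Variable R : realType.
Local Notation mu := (@lebesgue_measure R).
Implicit Types (p q s t : R) (f g h : R -> R).

Lemma wsing_cst p (c : R) : 0 < p <= 1 -> wsing p (fun=> c).
Proof. by move=> pp; apply: wsing_bounded => // T; exists `|c|. Qed.

Lemma conv_pker_cst p (c : R) t : 0 < p <= 1 -> 0 < t -> conv (pker p) (fun=> c) t = c * (t `^ p / p).
Proof.
move=> pp t0; have /andP[p0 p1] := pp.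
rewrite -(mulr1 c) (@convZr _ p p (pker p) (fun=> 1)); [|exact: wsing_pker|exact: wsing_cst].
rewrite mulr1 /conv; under eq_Rintegral do rewrite mulr1.
by rewrite Rintegral_rev ?Rintegral_pker//; exact: measurable_pker.
Qed.

(** The values after time T do not influence the convolution before T; this
    turns local bounds into global ones. *)
Lemma conv_trunc f g t T : t <= T -> conv f g t = conv f (g \_ `]0, T[%classic) t.
Proof.
move=> tT; apply: eq_conv => // s /andP[s0 st].
by rewrite patchE mem_set//= in_itv/= s0 (lt_le_trans st tT).
Qed.

Lemma measurable_trunc g T : measurable_fun setT g -> measurable_fun setT (g \_ `]0, T[%classic).
Proof.
by move=> mg; apply/(measurable_restrictT _ _).1 => //; exact: measurable_funS mg.
Qed.

Lemma trunc_bound g T (M : R) s : (forall s, 0 < s < T -> `|g s| <= M) -> 0 <= M ->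
  `|(g \_ `]0, T[%classic) s| <= M.
Proof.
move=> gM M0; rewrite patchE; case: ifPn => [|_]; last by rewrite normr0.
by rewrite inE/= in_itv/=; exact: gM.
Qed.

Lemma wsing_trunc p g T (M : R) : 0 < p <= 1 -> measurable_fun setT g ->
  (forall s, 0 < s < T -> `|g s| <= M) -> 0 <= M -> wsing p (g \_ `]0, T[%classic).
Proof.
move=> pp mg gM M0; apply: wsing_bounded => //; first exact: measurable_trunc.
by move=> T'; exists M => t _; exact: trunc_bound.
Qed.

(** The part of the kernel that looks back at most d; its integral
    d^p / p is what a time step of length d can contribute. *)
Definition pker_head p (d : R) := pker p \_ `]0, d]%classic.

Lemma wsing_pker_head p (d : R) : 0 < p <= 1 -> wsing p (pker_head p d).
Proof.
move=> pp; split => //.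
  by apply/(measurable_restrictT _ _).1 => //; exact: measurable_funS (measurable_pker p).
move=> T; exists 1 => // t _; rewrite mul1r /pker_head patchE; case: ifP => _.
  by rewrite ger0_norm ?pker_ge0.
by rewrite normr0 pker_ge0.
Qed.

Lemma conv_pker_head p (d : R) t : 0 < p <= 1 -> 0 <= d -> conv (pker_head p d) (fun=> 1) t <= d `^ p / p.
Proof.
move=> pp d0; have /andP[p0 p1] := pp; have [_ mk _] := wsing_pker_head d pp.
rewrite /conv; under eq_Rintegral do rewrite mulr1.
rewrite Rintegral_rev// /Rintegral.
move: d0; rewrite le_eqVlt => /predU1P[d0|d0].
  rewrite -{}d0 in mk *; rewrite powR0 ?gt_eqF// mul0r integral0_eq// => s _.
  by rewrite /pker_head set_itvoc0 patch_set0.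
rewrite -lee_fin -integral_pker//.
rewrite fineK; last by apply: integrable_fin_num => //; exact: wsing_integrable (wsing_pker_head d pp).
have -> : (fun x => (pker_head p d x)%:E) = (EFin \o pker p) \_ `]0, d]%classic by rewrite restrict_EFin.
rewrite -integral_mkcondr [leRHS]integral_itv_bndo_bndc; last first.
  by apply/measurable_EFinP; apply: measurable_funS (measurable_pker p).
apply: ge0_subset_integral => //.
- exact: measurableI.
- by apply/measurable_EFinP; apply: measurable_funS (measurable_pker p).
- by move=> x _; rewrite lee_fin pker_ge0.
Qed.

(** For g >= 0 the increase of k_p * g from t to t' is at most the
    contribution of ]t, t'[, because k_p is decreasing and so the
    contribution of the times before t can only shrink. *)
Lemma conv_incr_le p g (N : R) t t' : 0 < p <= 1 -> wsing p g -> t <= t' ->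
  (forall s, 0 < s < t' -> 0 <= g s <= N) -> 0 <= N ->
  conv (pker p) g t' <= conv (pker p) g t + N * ((t' - t) `^ p / p).
Proof.
move=> pp wg tt gN N0; have /andP[p0 p1] := pp.
apply: (@le_trans _ _ (conv (pker p) g t + N * conv (pker_head p (t' - t)) (fun=> 1) t')); last first.
  by rewrite lerD2l ler_wpM2l// conv_pker_head// subr_ge0.
have wk := wsing_pker pp (lexx _).
have i1 := integrable_causal_prod t wk wg.
have i2 := integrable_causal_prod t' (wsingZ N (wsing_pker_head (t' - t) pp)) (wsing_cst 1 pp).
have e2 : N * conv (pker_head p (t' - t)) (fun=> 1) t' = conv (fun s => N * pker_head p (t' - t) s) (fun=> 1) t'.
  rewrite /conv -RintegralZl//; last exact: conv_integrable (wsing_pker_head _ pp) (wsing_cst _ pp).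
  by apply: eq_Rintegral => s _; rewrite mulrA.
rewrite e2 !convE -RintegralD//.
apply: le_Rintegral => //.
- exact: integrable_causal_prod wk wg.
- have := @integrableD _ _ _ mu setT measurableT _ _ i1 i2; exact.
move=> s _; have [s0|s0] := ltP 0 s; last first.
  by rewrite (causal0 g s0) (causal0 (fun=> 1) s0) !mulr0 addr0.
rewrite (causalE g s0) (causalE (fun=> 1) s0) mulr1.
have [st'|st'] := ltP s t'; last first.
  by rewrite !causal0 ?mul0r ?addr0//; lra.
have /andP[g0 gle] : 0 <= g s <= N by apply: gN; rewrite s0.
rewrite !(@causalE _ _ (t' - s)) ?subr_gt0//.
have [ts|ts] := leP t s.
  rewrite (@causal0 _ _ (t - s)) ?subr_le0// mul0r add0r /pker_head patchE mem_set/=; last first.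
    by rewrite in_itv/=; apply/andP; split; lra.
  by rewrite mulrC ler_wpM2r ?pker_ge0.
rewrite (@causalE _ _ (t - s)) ?subr_gt0// /pker_head patchE memNset/= ?in_itv/=; last first.
  by apply/negP; rewrite negb_and -!ltNge; apply/orP; right; lra.
rewrite mulr0 addr0 ler_wpM2r//; apply: pker_nonincr => //; lra.
Qed.

Let sandwich (a b c d e : R) : a <= b -> b + c <= a + d + e ->
  b + -1 * c <= a + -1 * d + e -> `|c - d| <= e.
Proof. by move=> *; rewrite ler_norml; apply/andP; split; lra. Qed.

Let shift_bounds (x M : R) : `|x| <= M -> (0 <= M + x <= 2 * M) /\ (0 <= M + -1 * x <= 2 * M).
Proof. by rewrite ler_norml => /andP[? ?]; split; apply/andP; split; lra. Qed.

(** [conv_incr_le] for the nonnegative functions M + g and M - g, the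
    contribution of the constant M being increasing. *)
Lemma conv_holder p g (M : R) t t' T : 0 < p <= 1 -> measurable_fun setT g -> 0 <= M ->
  (forall s, 0 < s < T -> `|g s| <= M) -> t <= t' -> t' <= T ->
  `|conv (pker p) g t' - conv (pker p) g t| <= 2 * M * ((t' - t) `^ p / p).
Proof.
move=> pp mg M0 gM tt tT; have /andP[p0 p1] := pp.
have wk := wsing_pker pp (lexx _).
rewrite (conv_trunc (pker p) g tT) (conv_trunc (pker p) g (le_trans tt tT)).
set h := _ \_ _; have wh : wsing p h by exact: wsing_trunc gM M0.
have hM s : `|h s| <= M by exact: trunc_bound.
have wM := wsing_cst M pp.
have b2 : 0 <= 2 * M by rewrite mulr_ge0.
have B0 : 0 <= (t' - t) `^ p / p by rewrite divr_ge0 ?powR_ge0 ?ltW.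
have hi : conv (pker p) (fun s => M + h s) t' <= conv (pker p) (fun s => M + h s) t + 2 * M * ((t' - t) `^ p / p).
  apply: conv_incr_le => //; first exact: wsingD.
  by move=> s _; exact: (shift_bounds (hM s)).1.
have lo : conv (pker p) (fun s => M + -1 * h s) t' <= conv (pker p) (fun s => M + -1 * h s) t + 2 * M * ((t' - t) `^ p / p).
  apply: conv_incr_le => //; first by apply: wsingD => //; exact: wsingZ.
  by move=> s _; exact: (shift_bounds (hM s)).2.
have D0 : conv (pker p) (fun=> M) t <= conv (pker p) (fun=> M) t'.
  have [t0|t0] := ltP 0 t; last first.
    rewrite (@conv_le0 _ _ _ t)//; apply: conv_ge0 => // s _; exact: pker_ge0.
  rewrite !conv_pker_cst//; last exact: lt_le_trans tt.
  rewrite ler_wpM2l// ler_wpM2r ?invr_ge0 ?(ltW p0)//.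
  by apply: ge0_ler_powR; rewrite ?nnegrE ?(ltW p0) ?(ltW t0) ?(le_trans (ltW t0) tt).
move: hi lo.
rewrite !(@convDr _ p p) ?(@convZr _ p p)//; try exact: wsingZ.
move=> hi lo; exact: sandwich D0 hi lo.
Qed.

Lemma holder_continuous p (F : R -> R) : 0 < p ->
  (forall T : R, exists2 C : R, 0 <= C & forall t t', t <= t' -> t' <= T -> `|F t' - F t| <= C * (t' - t) `^ p) ->
  continuous F.
Proof.
move=> p0 hF t; apply/cvgrPdist_le => e e0.
have [C C0 hC] := hF (t + 1).
pose d := (e / (C + 1)) `^ p^-1.
have C1 : 0 < C + 1 by lra.
have ec : 0 < e / (C + 1) by rewrite divr_gt0.
have d0 : 0 < d by rewrite powR_gt0.
have dp : d `^ p = e / (C + 1) by rewrite -powRrM mulVf ?gt_eqF// powRr1 ?ltW.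
have key a b : a <= b -> b <= t + 1 -> b - a <= d -> `|F b - F a| <= e.
  move=> ab bt bad; apply: (le_trans (hC _ _ ab bt)).
  apply: (@le_trans _ _ (C * (e / (C + 1)))).
    rewrite ler_wpM2l// -dp; apply: ge0_ler_powR; rewrite ?nnegrE ?subr_ge0 ?(ltW p0) ?(ltW d0)//.
  by rewrite mulrA ler_pdivrMr// mulrC ler_wpM2l ?(ltW e0)// lerDl.
near=> s.
have hs : `|t - s| < Num.min d 1 by near: s; apply: cvgr_dist_lt; [exact: cvg_id|rewrite lt_min d0 ltr01].
move: hs; rewrite lt_min => /andP[hd h1].
have [ts|st] := leP t s.
  rewrite distrC; apply: key => //; move: hd h1; rewrite !ltr_norml => /andP[? ?] /andP[? ?]; lra.
by apply: key; [exact: ltW|lra|move: hd; rewrite ltr_norml => /andP[? ?]; lra].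
Unshelve. all: by end_near.
Qed.

Lemma continuous_conv p g : 0 < p <= 1 -> measurable_fun setT g -> locally_bounded g ->
  continuous (conv (pker p) g).
Proof.
move=> pp mg hg; have /andP[p0 p1] := pp; apply: (holder_continuous p0) => T.
have [M hM] := hg T.
exists (2 * `|M| / p); first by rewrite divr_ge0 ?mulr_ge0 ?(ltW p0).
move=> t t' tt tT; have := @conv_holder p g `|M| t t' T pp mg (normr_ge0 _) _ tt tT.
rewrite [X in _ -> _ <= X](_ : _ = 2 * `|M| * ((t' - t) `^ p / p)); last by rewrite mulrAC -mulrA.
apply => s /andP[s0 sT]; rewrite (le_trans _ (ler_norm M))//; apply: hM; rewrite s0 ltW//.
Qed.

Let expRN_le (x a : R) : 0 < x -> 0 <= a <= 1 -> expR (- x) <= x `^ (- a).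
Proof.
move=> x0 /andP[a0 a1]; rewrite expRN powRN lef_pV2 ?posrE ?expR_gt0 ?powR_gt0//.
apply: le_trans (expR_ge1Dx x).
have [x1|x1] := leP x 1.
  by apply: (@le_trans _ _ 1); [rewrite -(powRr0 x); apply: ger_powR; rewrite ?x0|rewrite lerDl ltW].
by apply: (@le_trans _ _ x); [apply: ler1_powR => //; exact: ltW|rewrite lerDr].
Qed.

(** For the weighted norm sup e^(-k t) |u(t)| the operator u |-> k_p * u is a
    contraction when k is large, because the integral of e^(-k s) s^(p-1) is
    O(k^(-p)).  The proof bounds e^(-x) by x^(-p/2) and so trades k^(-p/2) for
    the exponent p/2 of the kernel. *)
Lemma conv_weight p (e T : R) : 0 < p <= 1 -> 0 < e -> 0 < T ->
  exists2 k : R, 0 <= k & forall (u : R -> R) (A : R) t, measurable_fun setT u -> 0 <= A ->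
    0 < t <= T -> (forall s, 0 < s < t -> `|u s| <= A * expR (k * s)) ->
    `|conv (pker p) u t| <= e * (A * expR (k * t)).
Proof.
move=> pp e0 T0; have /andP[p0 p1] := pp.
have a0 : 0 < p / 2 by rewrite divr_gt0.
have aa : 0 < p / 2 <= 1 by rewrite a0 /=; lra.
pose B := T `^ (p / 2) / (p / 2).
have B0 : 0 < B by rewrite divr_gt0 ?powR_gt0.
(* B = (1 * k_{p/2})(T), so that k^(-p/2) B = e *)
pose k := (B / e) `^ (p / 2)^-1.
have k0 : 0 < k := powR_gt0 _ (divr_gt0 B0 e0).
have kB : k `^ (- (p / 2)) * B = e.
  rewrite /k -powRrM mulrN mulVf ?gt_eqF// powRN powRr1 ?(ltW (divr_gt0 B0 e0))//.
  by field; rewrite !gt_eqF.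
exists k; first exact: ltW.
move=> u A t mu_ A0 /andP[t0 tT] hu.
have hu' s : 0 < s < t -> `|u s| <= A * expR (k * t).
  move=> st; apply: (le_trans (hu _ st)); rewrite ler_wpM2l// ler_expR ler_pM2l//.
  by case/andP: st => _ /ltW.
have E0 : 0 <= A * expR (k * t) by rewrite mulr_ge0 ?expR_ge0.
rewrite (@conv_trunc _ _ t t)//.
set v := _ \_ _; have wv : wsing p v by exact: wsing_trunc hu' E0.
have ve s : 0 < s < t -> v s = u s by move=> st; rewrite /v patchE mem_set//= in_itv.
apply: (le_trans (norm_conv_le t (wsing_pker pp (lexx _)) wv)).
set c := A * expR (k * t) * k `^ (- (p / 2)).
have c0 : 0 <= c by rewrite mulr_ge0 ?powR_ge0.
apply: (@le_trans _ _ (c * (t `^ (p / 2) / (p / 2)))); last first.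
  rewrite /c -mulrA mulrC ler_wpM2r// -kB ler_wpM2l ?powR_ge0//.
  rewrite /B ler_wpM2r ?invr_ge0 ?(ltW a0)//; apply: ge0_ler_powR; rewrite ?nnegrE ?(ltW a0) ?(ltW t0) ?(ltW T0)//.
rewrite -conv_pker_cst//; apply: (@le_conv _ (p / 2) p).
- by apply: wsing_abs; apply: wsing_pker => //; lra.
- exact: wsing_pker.
- exact: wsing_abs.
- exact: wsing_cst.
move=> s st; have /andP[s0 s1] := st; have ts0 : 0 < t - s by rewrite subr_gt0.
rewrite ger0_norm ?pker_ge0// ve//.
apply: (@le_trans _ _ (pker p (t - s) * (A * expR (k * s)))).
  by rewrite ler_wpM2l ?pker_ge0 ?hu.
have -> : k * s = k * t + - (k * (t - s)) by ring.
rewrite expRD.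
apply: (@le_trans _ _ (pker p (t - s) * (A * (expR (k * t) * (k * (t - s)) `^ (- (p / 2)))))).
  rewrite ler_wpM2l ?pker_ge0// ler_wpM2l// ler_wpM2l ?expR_ge0// expRN_le ?mulr_gt0//.
  by rewrite (ltW a0)/=; lra.
rewrite powRM ?(ltW k0) ?(ltW ts0)// /c.
have -> : pker (p / 2) (t - s) = pker p (t - s) * (t - s) `^ (- (p / 2)).
  rewrite /pker -powRD ?(gt_eqF ts0) ?implybT//; have -> // : p / 2 - 1 = p - 1 - p / 2 by lra.
by rewrite le_eqVlt; apply/orP; left; apply/eqP; ring.
Qed.
End Smoothing.

(** * Volterra equations with a Lipschitz nonlinearity *)

Section Picard.
Variable R : realType.
Implicit Types (p s t : R).

Lemma le_geometric0 (x C : R) : (forall n : nat, x <= C / 2 ^+ n) -> x <= 0.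
Proof.
move=> h; rewrite leNgt; apply/negP => x0.
have C0 : 0 < C by have := h 0%N; rewrite expr0 divr1; exact: lt_le_trans.
have [n hn] : exists n : nat, C / x < n%:R.
  by exists (Num.bound (C / x)); apply: archi_boundP; rewrite divr_ge0// ltW.
have := h n; rewrite ler_pdivlMr ?exprn_gt0// leNgt => /negP; apply.
rewrite mulrC -ltr_pdivrMr//; apply: (lt_le_trans hn); rewrite -natrX ler_nat.
by rewrite ltnW// ltn_expl.
Qed.

Lemma geometric_small (B e : R) : 0 < e -> exists n : nat, B / 2 ^+ n < e.
Proof.
move=> e0; apply/not_existsP => h.
suff : e <= 0 by rewrite leNgt e0.
by apply: (@le_geometric0 _ B) => n; rewrite leNgt; apply/negP; exact: h.
Qed.

Lemma geometric_limit (V : completeNormedModType R) (u : nat -> V) (B : R) :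
  (forall n m, (n <= m)%N -> `|u m - u n| <= B / 2 ^+ n) ->
  forall n, `|lim (u @ \oo) - u n| <= B / 2 ^+ n.
Proof.
move=> hu.
have cu : cvgn u.
  apply: cauchy_cvg; apply: cauchy_exP => e e0.
  have [n hn] := geometric_small B e0; exists (u n); exists n => // m /= nm.
  by rewrite -ball_normE/= distrC; apply: le_lt_trans hn; exact: hu.
move=> n; apply/ler_addgt0Pl => e e0.
have /cvgrPdist_lt /(_ e e0) [N _ hN] := cu.
have := hN (maxn n N); rewrite /= leq_maxr => /(_ isT) h1.
rewrite -(subrKA (u (maxn n N))); apply: (le_trans (ler_normD _ _)).
by apply: lerD; [exact: ltW|apply: hu; exact: leq_maxl].
Qed.

Lemma continuous_lbounded (g : R -> R) : continuous g -> locally_bounded g.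
Proof.
move=> cg T; have [T0|T0] := ltP 0 T; last first.
  by exists 0 => t /andP[t0 tT]; have := lt_le_trans t0 (le_trans tT T0); rewrite ltxx.
have cn : {within `[0, T], continuous (fun t => `|g t|)}.
  apply: continuous_subspaceT => t; apply: continuous_comp; first exact: cg.
  exact: norm_continuous.
have [c cT hc] := EVT_max (ltW T0) cn.
by exists `|g c| => t /andP[t0 tT]; apply: hc; rewrite in_itv/= (ltW t0).
Qed.

Lemma continuous_measurable (g : R -> R) : continuous g -> measurable_fun setT g.
Proof. by move=> cg; exact: continuous_measurable_fun. Qed.

Lemma continuous_wsing p (g : R -> R) : 0 < p <= 1 -> continuous g -> wsing p g.
Proof.
by move=> pp cg; apply: wsing_bounded => //; [exact: continuous_measurable|exact: continuous_lbounded].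
Qed.

(** Iterating [conv_weight] halves the weighted bound each time. *)
Lemma gronwall p (L T M : R) (u : R -> R) : 0 < p <= 1 -> 0 <= L -> measurable_fun setT u ->
  (forall t, 0 < t <= T -> `|u t| <= M) ->
  (forall t, 0 < t <= T -> `|u t| <= L * `|conv (pker p) (fun s => `|u s|) t|) ->
  forall t, 0 < t <= T -> u t = 0.
Proof.
move=> pp L0 mu_ uM hu t tT.
have T0 : 0 < T by case/andP: tT; exact: lt_le_trans.
have M0 : 0 <= M by apply: le_trans (uM T _) => //; rewrite T0 lexx.
have e0 : 0 < (2 * (L + 1))^-1 by rewrite invr_gt0; lra.
have [k k0 hk] := conv_weight pp e0 T0.
have bnd n s : 0 < s <= T -> `|u s| <= M / 2 ^+ n * expR (k * s).
  elim: n s => [|n IHn] s sT.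
    rewrite expr0 divr1; apply: (le_trans (uM _ sT)); rewrite ler_peMr//.
    by rewrite -(expR0 R) ler_expR mulr_ge0//; case/andP: sT => /ltW.
  apply: (le_trans (hu _ sT)).
  have mn : measurable_fun setT (fun s => `|u s|) by exact: measurableT_comp.
  have := hk (fun s => `|u s|) (M / 2 ^+ n) s mn.
  have -> : 0 <= M / 2 ^+ n by rewrite divr_ge0// exprn_ge0.
  move=> /(_ isT sT) h; apply: le_trans (ler_wpM2l L0 (h _)) _.
    move=> s' /andP[s0 ss]; rewrite normr_id; apply: IHn; rewrite s0/=.
    by case/andP: sT => _; apply: le_trans; exact: ltW.
  set c := M / 2 ^+ n * _; have c0 : 0 <= c by rewrite mulr_ge0 ?expR_ge0// divr_ge0 ?exprn_ge0.
  have -> : M / 2 ^+ n.+1 * expR (k * s) = c * 2^-1 by rewrite exprSr invfM /c; ring.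
  have -> : L * ((2 * (L + 1))^-1 * c) = c * (L / (2 * (L + 1))) by ring.
  rewrite ler_wpM2l//.
  by rewrite ler_pdivrMr ?mulr_gt0; lra.
apply/eqP; rewrite -normr_eq0 eq_le normr_ge0 andbT; apply: (@le_geometric0 _ (M * expR (k * t))) => n.
by rewrite mulrAC; exact: bnd.
Qed.

Variable n : nat.
Implicit Types (x y z : R -> 'cV[R]_n).

Lemma cV_norm_le (v : 'cV[R]_n) (M : R) : 0 <= M -> (forall i, `|v i ord0| <= M) -> `|v| <= M.
Proof.
move=> M0 h; rewrite /Num.norm/= mx_normrE; apply: bigmax_le => // -[i j] _ /=.
by rewrite ord1.
Qed.

Lemma coord_norm_le (v : 'cV[R]_n) i : `|v i ord0| <= `|v|.
Proof.
rewrite [leRHS]/Num.norm/= mx_normrE; apply: (@le_bigmax _ _ _ _ (fun ij => `|v ij.1 ij.2|) (i, ord0)).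
Qed.

Lemma continuous_coord x i : continuous x -> continuous (fun t => x t i ord0).
Proof.
move=> cx t; apply: (@continuous_comp _ _ _ x (fun M : 'cV[R]_n => M i ord0)).
  exact: cx.
exact: coord_continuous.
Qed.

Lemma continuous_col x : (forall i, continuous (fun t => x t i ord0)) -> continuous x.
Proof.
move=> h t; apply/cvgrPdist_le => e e0.
have : \forall s \near t, forall i : 'I_n, `|x t i ord0 - x s i ord0| <= e.
  apply: (@filter_forall R _ (fun i s => `|x t i ord0 - x s i ord0| <= e) (nbhs t)) => i.
  by have /cvgrPdist_le /(_ e e0) := h i t.
apply: filterS => s hs; apply: cV_norm_le; first exact: ltW.
by move=> i; rewrite !mxE.
Qed.

Lemma continuous_norm x : continuous x -> continuous (fun t => `|x t|).
Proof. by move=> cx t; apply: continuous_comp; [exact: cx|exact: norm_continuous]. Qed.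

Lemma continuous_sub x y : continuous x -> continuous y -> continuous (fun t => x t - y t).
Proof. by move=> cx cy t; apply: cvgB; [exact: cx|exact: cy]. Qed.

Definition vconv p y t : 'cV[R]_n := \col_i conv (pker p) (fun s => y s i ord0) t.

Lemma vconvB p y z t : 0 < p <= 1 -> continuous y -> continuous z ->
  vconv p y t - vconv p z t = vconv p (fun s => y s - z s) t.
Proof.
move=> pp cy cz; apply/matrixP => i j; rewrite !mxE.
have wk := wsing_pker pp (lexx _).
have wy := continuous_wsing pp (continuous_coord (i := i) cy).
have wz := continuous_wsing pp (continuous_coord (i := i) cz).
transitivity (conv (pker p) (fun s => y s i ord0 + -1 * z s i ord0) t).
  by rewrite (convDr _ wk wy (wsingZ _ wz)) (convZr _ _ wk wz) mulN1r.
by apply: eq_conv => // s _; rewrite !mxE mulN1r.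
Qed.

Lemma continuous_vconv p y : 0 < p <= 1 -> continuous y -> continuous (vconv p y).
Proof.
move=> pp cy; apply: continuous_col => i.
have -> : (fun t => vconv p y t i ord0) = conv (pker p) (fun s => y s i ord0).
  by apply/funext => t; rewrite mxE.
apply: continuous_conv => //.
- by apply: continuous_measurable; exact: continuous_coord.
- by apply: continuous_lbounded; exact: continuous_coord.
Qed.

Lemma vconv_le0 p y t : t <= 0 -> vconv p y t = 0.
Proof. by move=> t0; apply/matrixP => i j; rewrite !mxE conv_le0. Qed.

Lemma norm_vconv_le p y t : 0 < p <= 1 -> continuous y ->
  `|vconv p y t| <= conv (pker p) (fun s => `|y s|) t.
Proof.
move=> pp cy; have wk := wsing_pker pp (lexx _).
have wn := continuous_wsing pp (continuous_norm cy).
apply: cV_norm_le => [|i]; first by apply: conv_ge0 => s _; rewrite ?pker_ge0.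
rewrite mxE; have wy := continuous_wsing pp (continuous_coord (i := i) cy).
apply: (le_trans (norm_conv_le t wk wy)).
apply: (le_conv (wsing_abs wk) wk (wsing_abs wy) wn) => s _.
by rewrite ger0_norm ?pker_ge0// ler_wpM2l ?pker_ge0// coord_norm_le.
Qed.

Variables (p : R) (pp : 0 < p <= 1) (G : 'cV[R]_n -> 'cV[R]_n) (L : R).
Hypotheses (L0 : 0 <= L) (hG : forall u v, `|G u - G v| <= L * `|u - v|).

Lemma continuous_lip x : continuous x -> continuous (fun t => G (x t)).
Proof.
move=> cx t; apply/cvgrPdist_le => e e0.
have L1 : 0 < L + 1 by rewrite ltr_wpDl.
have /cvgrPdist_le /(_ (e / (L + 1))) := cx t; rewrite divr_gt0// => /(_ isT).
apply: filterS => s hs; apply: (le_trans (hG _ _)).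
apply: (@le_trans _ _ ((L + 1) * `|x t - x s|)); first by rewrite ler_wpM2r// lerDl.
by rewrite mulrC -ler_pdivlMr.
Qed.

(** The equations are assumed on ]0, T] alone, so that a local solution,
    extended continuously, can be compared with a global one. *)
Lemma volterra_unique (F : R -> 'cV[R]_n) x y (T : R) : continuous x -> continuous y ->
  (forall t, 0 < t <= T -> x t = F t + vconv p (fun s => G (x s)) t) ->
  (forall t, 0 < t <= T -> y t = F t + vconv p (fun s => G (y s)) t) ->
  forall t, 0 < t <= T -> x t = y t.
Proof.
move=> cx cy hx hy t tT.
have cu := continuous_norm (continuous_sub cx cy).
have wk := wsing_pker pp (lexx _).
have [M hM] := continuous_lbounded cu T.
apply/eqP; rewrite -subr_eq0 -normr_eq0; apply/eqP.
apply: (gronwall pp L0 (continuous_measurable cu) hM _ tT) => s sT.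
rewrite normr_id hx// hy// opprD addrACA subrr add0r vconvB//; try exact: continuous_lip.
apply: (le_trans (norm_vconv_le s pp (continuous_sub (continuous_lip cx) (continuous_lip cy)))).
have wu := continuous_wsing pp cu.
rewrite ger0_norm; last by apply: conv_ge0 => r _; rewrite ?pker_ge0.
rewrite -(convZr _ _ wk (wsing_abs wu)).
apply: (le_conv wk wk (continuous_wsing pp (continuous_norm (continuous_sub (continuous_lip cx) (continuous_lip cy))))
  (wsingZ _ (wsing_abs wu))) => r _.
by rewrite ler_wpM2l ?pker_ge0// normr_id.
Qed.

(** Picard iteration.  The weights of [conv_weight] make it converge
    geometrically on every ]0, T], however large T and L are.  The iterates
    equal F on t <= 0, so that the solution is continuous on the whole line. *)
Lemma volterra_exists (F : R -> 'cV[R]_n) : continuous F ->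
  exists2 x, continuous x & forall t, x t = F t + vconv p (fun s => G (x s)) t.
Proof.
move=> cF.
pose Phi x t := F t + vconv p (fun s => G (x s)) t.
have cPhi x : continuous x -> continuous (Phi x).
  by move=> cx t; apply: cvgD; [exact: cF|exact: (continuous_vconv pp (continuous_lip cx))].
have PhiE x t : t <= 0 -> Phi x t = F t by move=> t0; rewrite /Phi vconv_le0 ?addr0.
have contr (T : R) : 0 < T -> exists2 k : R, 0 <= k & forall x y (A : R) t, continuous x -> continuous y ->
    0 <= A -> 0 < t <= T -> (forall s, 0 < s < t -> `|x s - y s| <= A * expR (k * s)) ->
    `|Phi x t - Phi y t| <= A / 2 * expR (k * t).
  move=> T0.
  have L1 : 0 < L + 1 by rewrite ltr_wpDl.
  have e0 : 0 < (2 * (L + 1))^-1 by rewrite invr_gt0 mulr_gt0.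
  have [k k0 hk] := conv_weight pp e0 T0; exists k => // x y A t cx cy A0 tT hxy.
  have cd := continuous_norm (continuous_sub (continuous_lip cx) (continuous_lip cy)).
  rewrite /Phi opprD addrACA subrr add0r vconvB//; try exact: continuous_lip.
  apply: (le_trans (norm_vconv_le t pp (continuous_sub (continuous_lip cx) (continuous_lip cy)))).
  apply: (le_trans (ler_norm _)).
  have LA : 0 <= L * A by rewrite mulr_ge0.
  apply: (le_trans (hk _ (L * A) _ (continuous_measurable cd) LA tT _)).
    move=> s st; rewrite normr_id; apply: (le_trans (hG _ _)).
    by rewrite -mulrA ler_wpM2l// hxy.
  set c := expR _; have c0 : 0 <= c by exact: expR_ge0.
  rewrite mulrA ler_wpM2r//.
  have -> : (2 * (L + 1))^-1 * (L * A) = L / (L + 1) * (A / 2).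
    by field; rewrite gt_eqF.
  by rewrite ler_piMl ?divr_ge0// ler_pdivrMr// mul1r lerDl.
pose X_ m := iter m Phi F.
have cX m : continuous (X_ m) by elim: m => [//|m IHm]; exact: cPhi.
have XS m t : X_ m.+1 t = Phi (X_ m) t by [].
have X0 m t : t <= 0 -> X_ m t = F t by case: m => [//|m] t0; rewrite XS PhiE.
have cauchyX (T : R) : 0 < T -> exists2 B : R, 0 <= B &
    forall m1 m2, (m1 <= m2)%N -> forall t, t <= T -> `|X_ m2 t - X_ m1 t| <= B / 2 ^+ m1.
  move=> T0; have [k k0 hk] := contr T T0.
  have [M hM] := continuous_lbounded (continuous_norm (continuous_sub (cX 1%N) (cX 0%N))) T.
  have M0 : 0 <= M by apply: le_trans (hM T _) => //; rewrite T0 lexx.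
  (* consecutive iterates halve in the weighted norm *)
  have step m t : 0 < t <= T -> `|X_ m.+1 t - X_ m t| <= M / 2 ^+ m * expR (k * t).
    elim: m t => [|m IHm] t tT.
      have := hM _ tT; rewrite normr_id => h; apply: (le_trans h).
      rewrite expr0 divr1 ler_peMr// -(expR0 R) ler_expR mulr_ge0//.
      by case/andP: tT => /ltW.
    rewrite exprSr invfM mulrA.
    apply: (hk (X_ m.+1) (X_ m) (M / 2 ^+ m) t (cX _) (cX _) _ tT).
      by rewrite divr_ge0// exprn_ge0.
    move=> s /andP[s0 st]; apply: IHm; rewrite s0/=.
    by case/andP: tT => _; apply: le_trans; exact: ltW.
  exists (2 * M * expR (k * T)); first by rewrite !mulr_ge0 ?expR_ge0.
  have step' m t : t <= T -> `|X_ m.+1 t - X_ m t| <= M * expR (k * T) / 2 ^+ m.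
    move=> tT; have [t0|t0] := ltP 0 t; last first.
      by rewrite !X0// subrr normr0 !mulr_ge0 ?expR_ge0 ?invr_ge0 ?exprn_ge0.
    have := step m t; rewrite t0 tT => /(_ isT) h; apply: (le_trans h).
    rewrite mulrAC ler_wpM2r ?invr_ge0 ?exprn_ge0// ler_wpM2l// ler_expR ler_wpM2l//.
  move=> m1 m2 m12 t tT; rewrite -(subnKC m12); move: (m2 - m1)%N => j {m12 m2}.
  (* the finite geometric sum, kept exact for the induction on j *)
  suff : `|X_ (m1 + j)%N t - X_ m1 t| <= 2 * M * expR (k * T) / 2 ^+ m1 * (1 - 2^-1 ^+ j).
    move=> h; apply: (le_trans h); rewrite ler_piMr ?divr_ge0 ?exprn_ge0 ?mulr_ge0 ?expR_ge0//.
  elim: j => [|j IHj]; first by rewrite addn0 subrr normr0 expr0 subrr mulr0.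
  rewrite addnS -(subrKA (X_ (m1 + j)%N t)); apply: (le_trans (ler_normD _ _)).
  apply: (le_trans (lerD (step' _ _ tT) IHj)).
  rewrite exprD invfM exprS -!exprVn; set c := expR _; set a := _ ^+ m1; set b := _ ^+ j.
  by rewrite le_eqVlt; apply/orP; left; apply/eqP; field.
pose x t : 'cV[R]_n := \col_i lim ((fun m => X_ m t i ord0) @ \oo).
have bx (T : R) : 0 < T -> exists2 B : R, 0 <= B & forall m t, t <= T -> `|x t - X_ m t| <= B / 2 ^+ m.
  move=> T0; have [B B0 hB] := cauchyX T T0; exists B => // m t tT.
  apply: cV_norm_le => [|i]; first by rewrite divr_ge0 ?exprn_ge0.
  rewrite !mxE; apply: (@geometric_limit R (fun m => X_ m t i ord0)) => m1 m2 m12.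
  by have := coord_norm_le (X_ m2 t - X_ m1 t) i; rewrite !mxE => h; apply: (le_trans h); exact: hB.
have cx : continuous x.
  move=> t; apply/cvgrPdist_le => e e0.
  have T0 : 0 < `|t| + 1 by rewrite ltr_wpDl.
  have [B B0 hB] := bx _ T0; have e3 : 0 < e / 3 by rewrite divr_gt0.
  have [m hm] := geometric_small B e3.
  have /cvgrPdist_le /(_ _ e3) h1 := cX m t.
  have tT' : t < `|t| + 1 by apply: (le_lt_trans (ler_norm t)); rewrite ltrDl.
  apply: filterS2 (lt_nbhsl tT') h1 => s /ltW sT h1.
  have -> : x t - x s = (x t - X_ m t) + (X_ m t - X_ m s) - (x s - X_ m s).
    by rewrite opprB !subrKA.
  apply: (le_trans (ler_normB _ _)).
  have h2 := le_trans (hB m s sT) (ltW hm).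
  have h3 := le_trans (hB m t (ltW tT')) (ltW hm).
  apply: (le_trans (lerD (ler_normD _ _) h2)).
  by rewrite [leRHS](_ : _ = e / 3 + e / 3 + e / 3); [rewrite lerD2r lerD|field].
exists x => // t.
suff h : `|x t - Phi x t| <= 0 by apply/eqP; rewrite -subr_eq0 -normr_le0.
have [t0|t0] := ltP 0 t; last first.
  have [B B0 hB] := bx 1 ltr01; apply: (@le_geometric0 _ B) => m.
  by rewrite PhiE// -(X0 m _ t0); apply: hB; rewrite (le_trans t0).
have [B B0 hB] := bx t t0; have [k k0 hk] := contr t t0.
apply: (@le_geometric0 _ (B + B * expR (k * t))) => m.
rewrite -(subrKA (X_ m.+1 t)); apply: (le_trans (ler_normD _ _)).
rewrite mulrDl lerD//.
  apply: (le_trans (hB _ _ (lexx _))); rewrite ler_wpM2l// lef_pV2 ?posrE ?exprn_gt0//.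
  by rewrite ler_weXn2l// ler1n.
rewrite XS; apply: (le_trans (hk (X_ m) x (B / 2 ^+ m) t (cX m) cx _ _ _)).
- by rewrite divr_ge0 ?exprn_ge0.
- by rewrite t0 lexx.
- move=> s /andP[s0 st]; rewrite distrC; apply: (le_trans (hB m s (ltW st))).
  rewrite ler_peMr ?divr_ge0 ?exprn_ge0//.
  by rewrite -(expR0 R) ler_expR mulr_ge0// ltW.
- rewrite [leRHS]mulrAC ler_wpM2r ?expR_ge0// ler_piMr ?divr_ge0 ?exprn_ge0//.
  by rewrite invf_le1 ?ler1n ?ltr0n.
Qed.
End Picard.

(** * The resolvent for a negative real coefficient *)

#[local] Opaque conv.

Section Resolvent.
Variable R : realType.
Local Notation mu := (@lebesgue_measure R).
Implicit Types (p q s t : R).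

Lemma scalar_volterra p (c : R) (F : R -> R) : 0 < p <= 1 -> continuous F ->
  exists2 x, continuous x & forall t, x t = F t - c * conv (pker p) x t.
Proof.
move=> pp cF.
pose G (v : 'cV[R]_1) := - c *: v.
have hG u v : `|G u - G v| <= `|c| * `|u - v|.
  by rewrite /G -scalerBr normrZ normrN.
pose FF t : 'cV[R]_1 := \col_i F t.
have cFF : continuous FF.
  by apply: continuous_col => i; have -> : (fun t => FF t i ord0) = F by apply/funext => t; rewrite mxE.
have [x cx hx] := volterra_exists pp (normr_ge0 c) hG cFF.
have cx0 := continuous_coord (i := ord0) cx.
exists (fun t => x t ord0 ord0); first exact: cx0.
move=> t; rewrite {1}hx !mxE; congr (_ + _).
rewrite -mulNr -(convZr _ _ (wsing_pker pp (lexx _)) (continuous_wsing pp cx0)).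
by apply: eq_conv => // s _; rewrite mxE.
Qed.

(** For q >= 1 the forcing k_q is continuous and Picard iteration applies.
    Otherwise k_q is subtracted from rho, which replaces q by p + q; finitely
    many steps reach q >= 1. *)
Lemma resolvent_exists p (c : R) q : 0 < p <= 1 -> p <= q <= 2 ->
  exists rho, [/\ wsing p rho, forall t, 0 < t -> {for t, continuous rho} &
    forall t, 0 < t -> rho t = pker q t - c * conv (pker p) rho t].
Proof.
move=> pp; have /andP[p0 p1] := pp.
have wk := wsing_pker pp (lexx _).
have [n] : exists n : nat, 1 <= q + n%:R * p.
  exists (Num.bound ((1 - q) / p)).+1.
  have [h|h] := leP (1 - q) 0.
    by rewrite -lerBlDl (le_trans h)// mulr_ge0 ?(ltW p0).
  rewrite -lerBlDl -ler_pdivrMr// ltW// -natr1 ltr_wpDr//.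
  by apply: archi_boundP; rewrite divr_ge0 ?(ltW p0) ?(ltW h).
elim: n q => [|n IHn] q hn /andP[pq q2].
  move: hn; rewrite mul0r addr0 => q1.
  have [F cF hF] : exists2 F, continuous F & forall t, 0 < t -> F t = pker q t.
    move: q1; rewrite le_eqVlt => /predU1P[<-|q1].
      by exists (fun=> 1) => [t|t _]; [exact: cvg_cst|rewrite /pker subrr powRr0].
    have qq : 0 < q - 1 <= 1 by apply/andP; split; lra.
    exists (conv (pker (q - 1)) (fun=> q - 1)).
      by apply: continuous_conv => // T; exists `|q - 1|.
    move=> t t0; rewrite conv_pker_cst// /pker; field; lra.
  have [x cx hx] := scalar_volterra c pp cF.
  exists x; split; first exact: continuous_wsing.
    by move=> t _; exact: cx.
  by move=> t t0; rewrite {1}hx hF.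
have [q1|q1] := leP 1 q; first by apply: IHn; rewrite ?pq// (le_trans q1)// lerDl mulr_ge0 ?(ltW p0).
have qq : 0 < q <= 1 by rewrite (lt_le_trans p0 pq) ltW.
have [||rho [wr cr hr]] := IHn (q + p).
- by move: hn; rewrite -natr1 mulrDl mul1r addrA addrAC.
- by apply/andP; split; lra.
pose B := beta p q.
have wq := wsing_pker pp pq.
exists (fun t => pker q t + (- c * B) * rho t); split.
- by apply: wsingD => //; exact: wsingZ.
- move=> t t0; apply: cvgD; first exact: continuous_pker.
  by apply: cvgMr; exact: cr.
- move=> t t0; rewrite (convDr _ wk wq (wsingZ _ wr)) (convZr _ _ wk wr) conv_pker//.
  rewrite -/B hr// addrC [p + q]addrC; ring.
Qed.

Variables (p c : R) (r : R -> R).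
Hypotheses (pp : 0 < p <= 1) (c0 : 0 < c) (wr : wsing p r)
  (cr : forall t, 0 < t -> {for t, continuous r})
  (hr : forall t, 0 < t -> r t = pker p t - c * conv (pker p) r t).
Let p0 : 0 < p. Proof. by case/andP: pp. Qed.
Let p1 : p <= 1. Proof. by case/andP: pp. Qed.
Let wk : wsing p (pker p). Proof. exact: wsing_pker. Qed.

(** Near 0 the singular term k_p dominates c k_p * r = O(t^(2p-1)). *)
Lemma resolvent_pos_near0 : exists2 d, 0 < d & forall t, 0 < t < d -> 0 < r t.
Proof.
have [_ _ /(_ 1)[C C0 hC]] := wr.
pose K := c * C * beta p p.
have K0 : 0 <= K by rewrite !mulr_ge0 ?(ltW c0)// ltW// beta_gt0.
have K1 : 0 < (K + 1)^-1 by rewrite invr_gt0; lra.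
pose d := Num.min 1 ((K + 1)^-1 `^ p^-1).
exists d; first by rewrite lt_min ltr01 powR_gt0.
move=> t /andP[t0]; rewrite lt_min => /andP[t1 td].
have tp : t `^ p < (K + 1)^-1.
  have <- : ((K + 1)^-1 `^ p^-1) `^ p = (K + 1)^-1.
    by rewrite -powRrM mulVf ?gt_eqF// powRr1// ltW.
  by apply: gt0_ltr_powR; rewrite ?nnegrE ?powR_ge0 ?(ltW t0).
have h : conv (pker p) r t <= C * (beta p p * pker (p + p) t).
  rewrite -(conv_pker pp pp t0) -(convZr _ _ wk wk).
  apply: (le_conv wk wk wr (wsingZ _ wk)) => s /andP[s0 st].
  rewrite ler_wpM2l ?pker_ge0//; apply: (le_trans (ler_norm _)); apply: hC.
  by rewrite s0 ltW// (lt_trans st).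
rewrite hr// subr_gt0; apply: (@le_lt_trans _ _ (K * (t `^ p * pker p t))).
  rewrite /K -!mulrA ler_wpM2l ?(ltW c0)//; apply: (le_trans h).
  rewrite ler_wpM2l// ler_wpM2l ?(ltW (beta_gt0 pp pp))//.
  rewrite /pker -powRD ?(gt_eqF t0) ?implybT//.
  by have -> : p + p - 1 = p + (p - 1) by lra.
rewrite mulrA -[ltRHS]mul1r ltr_pM2r ?pker_gt0//.
apply: (@le_lt_trans _ _ (K * (K + 1)^-1)); first by rewrite ler_wpM2l// ltW.
by rewrite ltr_pdivrMr; lra.
Qed.

(** Log-convexity of the kernel, k(t0 - s) k(t) <= k(t - s) k(t0) for
    s < t < t0, says that the memory term c k * r, relative to k itself,
    decreases apart from the contribution of ]t, t0[. *)
Lemma resolvent_compare t t0 (M : R) : 0 < t -> t < t0 -> (forall s, 0 < s < t0 -> 0 <= r s) ->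
  0 <= M -> (forall s, t <= s < t0 -> r s <= M) ->
  pker p t0 / pker p t * r t - c * (M * ((t0 - t) `^ p / p)) <= r t0.
Proof.
move=> t_0 tt0 r0 M0 rM.
have t00 : 0 < t0 by exact: lt_trans tt0.
have kt := pker_gt0 p t_0.
suff h : conv (pker p) r t0 <= pker p t0 / pker p t * conv (pker p) r t + M * ((t0 - t) `^ p / p).
  rewrite !hr// mulrBr divfK ?gt_eqF//.
  have := ler_wpM2l (ltW c0) h.
  set X := conv _ _ t0; set Y := conv _ _ t; set Z := M * _; set W := _ / _ => h'.
  by move: h'; clear; move: (pker p t0) => ? ; lra.
apply: (@le_trans _ _ (pker p t0 / pker p t * conv (pker p) r t + M * conv (pker_head p (t0 - t)) (fun=> 1) t0)); last first.
  by rewrite lerD2l ler_wpM2l// conv_pker_head// subr_ge0 ltW.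
have wkd := wsing_pker_head (t0 - t) pp.
have i1 := integrable_causal_prod t (wsingZ (pker p t0 / pker p t) wk) wr.
have i2 := integrable_causal_prod t0 (wsingZ M wkd) (wsing_cst 1 pp).
have e1 : pker p t0 / pker p t * conv (pker p) r t = conv (fun s => pker p t0 / pker p t * pker p s) r t.
  by rewrite (convZl _ _ wk wr).
have e2 : M * conv (pker_head p (t0 - t)) (fun=> 1) t0 = conv (fun s => M * pker_head p (t0 - t) s) (fun=> 1) t0.
  by rewrite (convZl _ _ wkd (wsing_cst _ pp)).
rewrite e1 e2 !convE -RintegralD//.
apply: le_Rintegral => //.
- exact: integrable_causal_prod wk wr.
- have := @integrableD _ _ _ mu setT measurableT _ _ i1 i2; exact.
move=> s _; have [s0|s0] := ltP 0 s; last first.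
  by rewrite (causal0 r s0) (causal0 (fun=> 1) s0) !mulr0 addr0.
rewrite (causalE r s0) (causalE (fun=> 1) s0) mulr1.
have [st0|st0] := ltP s t0; last first.
  rewrite (@causal0 _ _ (t0 - s)) ?subr_le0// (@causal0 _ _ (t - s)) ?subr_le0 ?(le_trans (ltW tt0))//.
  by rewrite (@causal0 _ _ (t0 - s)) ?subr_le0// !mul0r addr0.
have rs0 : 0 <= r s by apply: r0; rewrite s0.
rewrite !(@causalE _ _ (t0 - s)) ?subr_gt0//.
have [ts|ts] := leP t s.
  rewrite (@causal0 _ _ (t - s)) ?subr_le0// mul0r add0r /pker_head patchE mem_set/=; last first.
    by rewrite in_itv/= subr_gt0 st0 lerD2l lerN2.
  by rewrite mulrC ler_wpM2r ?pker_ge0// rM// ts.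
rewrite (@causalE _ _ (t - s)) ?subr_gt0// /pker_head patchE memNset/= ?in_itv/=; last first.
  by apply/negP; rewrite negb_and -!ltNge; apply/orP; right; rewrite ltrD2l ltrN2.
rewrite mulr0 addr0 ler_wpM2r// mulrAC ler_pdivlMr//.
rewrite /pker -!powRM ?subr_ge0 ?(ltW st0) ?(ltW ts) ?(ltW t_0) ?(ltW t00)//.
apply: (@pker_nonincr _ p) => //; first by rewrite mulr_gt0// subr_gt0.
by rewrite mulrBr mulrBl [t0 * t]mulrC lerD2l lerN2 mulrC ler_wpM2r ?(ltW s0)// ltW.
Qed.

(** Let t0 be the first zero.  If M bounds r on an interval [a, t0[,
    [resolvent_compare] and r(t0) <= 0 bound r by M / 2 there as soon as
    t0 - a is small.  Hence r vanishes on [a, t0[, which contradicts the choice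
    of t0. *)
Lemma resolvent_gt0 t : 0 < t -> 0 < r t.
Proof.
move=> t_gt0; rewrite ltNge; apply/negP => rt.
have [d d0 hd] := resolvent_pos_near0.
pose S := [set t | 0 < t /\ r t <= 0].
have Sd s : S s -> d <= s.
  by move=> [s0 rs]; rewrite leNgt; apply/negP => sd; move: rs; rewrite leNgt hd ?s0.
have hS : has_inf S by split; [exists t|exists d => s /Sd].
pose t0 := inf S.
have dt0 : d <= t0 by apply: lb_le_inf; [exists t|move=> s /Sd].
have t00 : 0 < t0 by exact: lt_le_trans dt0.
have rpos s : 0 < s < t0 -> 0 < r s.
  move=> /andP[s0 st]; rewrite ltNge; apply/negP => rs.
  by move: st; rewrite ltNge => /negP; apply; apply: ge_inf; [case: hS|split].
have rt0 : r t0 <= 0.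
  rewrite leNgt; apply/negP => rt0.
  have /cvgrPdist_lt /(_ _ rt0) [e e0 he] := cr t00.
  have [s Ss hs] := inf_adherent e0 hS.
  have t0s : t0 <= s by apply: ge_inf => //; case: hS.
  have := he s; rewrite /ball_/= distrC ger0_norm ?subr_ge0// ltrBlDl => /(_ hs).
  case: Ss => _ rs; rewrite ltr_norml => /andP[_]; rewrite ltrBlDr -ltrBlDl subrr.
  by rewrite ltNge rs.
have [K K0 Ke] : exists2 K, 0 < K & K = pker p (t0 / 2) / pker p t0.
  by eexists; last reflexivity; rewrite divr_gt0 ?pker_gt0 ?divr_gt0.
have [e e0 ee] : exists2 e, 0 < e & e = (p / (2 * K * c)) `^ p^-1.
  by eexists; last reflexivity; rewrite powR_gt0 ?divr_gt0 ?mulr_gt0.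
pose a := t0 - Num.min e (t0 / 2).
have at0 : a < t0 by rewrite ltrBlDr ltrDl lt_min e0 divr_gt0.
have a2 : t0 / 2 <= a by rewrite /a; have : Num.min e (t0 / 2) <= t0 / 2 by [rewrite ge_min lexx orbT]; lra.
have ae : t0 - a <= e by rewrite /a opprB addrCA subrr addr0 ge_min lexx.
have a0 : 0 < a by apply: lt_le_trans a2; rewrite divr_gt0.
(* e is chosen so that K c e^p / p = 1 / 2 *)
have half (M : R) : 0 <= M -> (forall s, a <= s < t0 -> r s <= M) -> forall s, a <= s < t0 -> r s <= M / 2.
  move=> M0 hM s /andP[as_ st0].
  have s0 : 0 < s by exact: lt_le_trans as_.
  have hM' : forall s0, s <= s0 < t0 -> r s0 <= M.
    by move=> s' /andP[ss' s't]; apply: hM; rewrite s't (le_trans as_).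
  have := le_trans (resolvent_compare s0 st0 (fun s h => ltW (rpos s h)) M0 hM') rt0.
  rewrite subr_le0 mulrAC ler_pdivrMr ?pker_gt0// -ler_pdivlMl ?pker_gt0// => h.
  apply: (le_trans h).
  have h1 : (pker p t0)^-1 * pker p s <= K.
    rewrite Ke mulrC ler_wpM2r ?invr_ge0 ?pker_ge0//; apply: pker_nonincr => //; first by rewrite divr_gt0.
    exact: le_trans as_.
  have h2 : (t0 - s) `^ p <= p / (2 * K * c).
    have -> : p / (2 * K * c) = e `^ p.
      by rewrite ee -powRrM mulVf ?gt_eqF// powRr1// divr_ge0 ?mulr_ge0 ?(ltW p0) ?(ltW K0) ?(ltW c0).
    apply: ge0_ler_powR; rewrite ?nnegrE ?(ltW p0) ?(ltW e0) ?subr_ge0 ?(ltW st0)//.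
    by apply: le_trans ae; rewrite lerD2l lerN2.
  have -> : (pker p t0)^-1 * (c * (M * ((t0 - s) `^ p / p)) * pker p s) =
     ((pker p t0)^-1 * pker p s) * (c * M / p * (t0 - s) `^ p) by ring.
  apply: (@le_trans _ _ (K * (c * M / p * (p / (2 * K * c))))).
    apply: ler_pM => //.
    - by rewrite mulr_ge0 ?invr_ge0 ?pker_ge0.
    - by rewrite !mulr_ge0 ?invr_ge0 ?powR_ge0 ?(ltW c0) ?(ltW p0).
    - by rewrite ler_wpM2l ?mulr_ge0 ?invr_ge0 ?(ltW c0) ?(ltW p0).
  by rewrite le_eqVlt; apply/orP; left; apply/eqP; field; rewrite !gt_eqF.
have [_ _ /(_ t0)[C C0 hC]] := wr.
have bnd n s : a <= s < t0 -> r s <= C * pker p a / 2 ^+ n.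
  elim: n s => [|n IHn] s hs.
    rewrite expr0 divr1; have /andP[as_ st0] := hs; have s0 : 0 < s by exact: lt_le_trans as_.
    apply: (le_trans (ler_norm _)); apply: (le_trans (hC s _)); first by rewrite s0 ltW.
    by rewrite ler_wpM2l//; exact: pker_nonincr.
  rewrite exprSr invfM mulrA; apply: (half _ _ IHn _ hs).
  by rewrite divr_ge0 ?exprn_ge0 ?mulr_ge0 ?pker_ge0.
have : r a <= 0 by apply: (@le_geometric0 _ _ (C * pker p a)) => n; apply: bnd; rewrite lexx.
by rewrite leNgt rpos ?a0.
Qed.

Let wone (a : R) : 0 < a <= 1 -> wsing a (fun=> 1 : R). Proof. exact: wsing_cst. Qed.

(** From r > 0 and the monotonicity of the kernel,
    k_p(t) >= c (k_p * r)(t) >= c k_p(t) (1 * r)(t). *)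
Lemma resolvent_mass t : c * conv (fun=> 1) r t <= 1.
Proof.
have [t0|t0] := ltP 0 t; last by rewrite conv_le0// mulr0.
have h : pker p t * conv (fun=> 1) r t <= conv (pker p) r t.
  rewrite (convC _ (measurable_cst _)); last by case: wr.
  rewrite -(convZr _ _ wr (wone pp)).
  rewrite [leRHS]convC; [|exact: measurable_pker|by case: wr].
  apply: (le_conv wr wr (wsingZ _ (wone pp)) wk) => s /andP[s0 st].
  rewrite mulr1 ler_wpM2l ?(ltW (resolvent_gt0 _)) ?subr_gt0//.
  by apply: pker_nonincr => //; exact: ltW.
have := resolvent_gt0 t0; rewrite hr// subr_gt0 => h2.
have kt := pker_gt0 p t0.
rewrite -(ler_pM2l kt) mulr1 mulrCA; apply: le_trans (ltW h2).
by rewrite ler_wpM2l// ltW.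
Qed.

(** The part of the unit mass of c r that lies after time t; it solves
    R = 1 - c k_p * R ([rtailE]), the scalar equation with initial value 1 and
    coefficient -c, and so is the Mittag-Leffler function E_p(- c Gamma(p) t^p). *)
Definition rtail t := 1 - c * conv (fun=> 1) r t.

Lemma rtail_ge0 t : 0 <= rtail t.
Proof. by rewrite subr_ge0 resolvent_mass. Qed.

Lemma resolvent_mass_ge0 t : 0 <= conv (fun=> 1) r t.
Proof. by apply: conv_ge0 => // s /andP[s0 _]; rewrite ltW// resolvent_gt0. Qed.

Lemma rtail_le1 t : rtail t <= 1.
Proof. by rewrite gerBl mulr_ge0 ?resolvent_mass_ge0// ltW. Qed.

Lemma rtail_nonincr t t' : t <= t' -> rtail t' <= rtail t.
Proof.
move=> tt; rewrite lerD2l lerN2 ler_wpM2l ?(ltW c0)// !convE.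
apply: le_Rintegral => //.
- exact: integrable_causal_prod (wone pp) wr.
- exact: integrable_causal_prod (wone pp) wr.
move=> s _; have [s0|s0] := ltP 0 s; last by rewrite !(causal0 r s0) !mulr0.
rewrite (causalE r s0) ler_wpM2r ?(ltW (resolvent_gt0 s0))//.
have [st|st] := ltP s t; last first.
  rewrite (@causal0 _ _ (t - s)) ?subr_le0//.
  by have [st'|st'] := ltP s t'; [rewrite causalE ?subr_gt0|rewrite causal0 ?subr_le0].
by rewrite !causalE ?subr_gt0// (lt_le_trans st).
Qed.

Lemma wsing_rtail : wsing p rtail.
Proof.
have -> : rtail = fun s => 1 + (- c) * conv (fun=> 1) r s by apply/funext => s; rewrite /rtail mulNr.
by apply: wsingD; [exact: wone|apply: wsingZ; exact: wsing_conv (wone pp) wr].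
Qed.

Lemma conv1_conv_pker a t : 0 < a <= 1 -> conv (fun=> 1) (conv (pker a) r) t = conv (pker a) (conv (fun=> 1) r) t.
Proof.
move=> aa; have wa := wsing_pker aa (lexx _).
rewrite (convA _ (wone pp) wa wr) (convA _ wa (wone pp) wr).
have -> // : conv (fun=> 1) (pker a) = conv (pker a) (fun=> 1).
by apply/funext => s; apply: convC; [exact: measurable_cst|exact: measurable_pker].
Qed.

Lemma conv_rtail a t : 0 < a <= 1 ->
  conv (pker a) rtail t = conv (pker a) (fun=> 1) t - c * conv (pker a) (conv (fun=> 1) r) t.
Proof.
move=> aa; have wa := wsing_pker aa (lexx _).
have w1 := wsing_conv (wone pp) wr.
rewrite -mulNr -(convZr _ _ wa w1) -(convDr _ wa (wone pp) (wsingZ _ w1)).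
by apply: eq_conv => // s _; rewrite mulNr.
Qed.

Lemma rtailE t : rtail t = 1 - c * conv (pker p) rtail t.
Proof.
rewrite /rtail; congr (1 - c * _).
transitivity (conv (fun=> 1) (fun s => pker p s + (- c) * conv (pker p) r s) t).
  by apply: eq_conv => // s /andP[s0 _]; rewrite hr// mulNr.
have w1 := wsing_conv wk wr.
rewrite (convDr _ (wone pp) wk (wsingZ _ w1)) (convZr _ _ (wone pp) w1) conv1_conv_pker// mulNr.
by rewrite (convC _ (measurable_cst _) (@measurable_pker _ p)) -conv_rtail.
Qed.

(** R is decreasing, hence R(t) t^p / p <= (k_p * R)(t) <= 1 / c. *)
Lemma rtail_decay t : 0 < t -> rtail t <= p / (c * t `^ p).
Proof.
move=> t0; have h : rtail t * (t `^ p / p) <= conv (pker p) rtail t.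
  rewrite -(conv_pker_cst (rtail t) pp t0).
  apply: (le_conv wk wk (wsing_cst (rtail t) pp) wsing_rtail) => s /andP[s0 st].
  by rewrite ler_wpM2l ?pker_ge0//; apply: rtail_nonincr; exact: ltW.
have : c * conv (pker p) rtail t <= 1 by rewrite -subr_ge0 -rtailE rtail_ge0.
move=> /(le_trans (ler_wpM2l (ltW c0) h)).
have tp : 0 < t `^ p by rewrite powR_gt0.
rewrite ler_pdivlMr ?mulr_gt0// => h2.
by rewrite -(ler_pM2r (_ : 0 < p^-1)) ?invr_gt0// divff ?gt_eqF//; apply: le_trans h2; rewrite le_eqVlt; apply/orP; left; apply/eqP; ring.
Qed.

Lemma continuous_rtail : continuous rtail.
Proof.
have [_ mt _] := wsing_rtail.
have ct : continuous (conv (pker p) rtail).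
  apply: continuous_conv => // T; exists 1 => t _.
  by rewrite ger0_norm ?rtail_ge0// rtail_le1.
have -> : rtail = fun t => 1 - c * conv (pker p) rtail t by apply/funext => t; exact: rtailE.
move=> t; apply: cvgB; first exact: cvg_cst.
by apply: cvgMr; exact: ct.
Qed.

(** The kernel of the solution operator of Y = k_a * H - c k_p * Y, see
    [resolvent_formula]. *)
Definition gker a s := pker a s - c * conv (pker a) r s.

Lemma wsing_gker a : 0 < a <= p -> wsing a (gker a).
Proof.
move=> /andP[a0 ap]; have aa : 0 < a <= 1 by rewrite a0 (le_trans ap).
have wa := wsing_pker aa (lexx _).
have -> : gker a = fun s => pker a s + (- c) * conv r (pker a) s.
  apply/funext => s; rewrite /gker mulNr (convC s (@measurable_pker _ a))//; by case: wr.
by apply: wsingD => //; apply: wsingZ; exact: wsing_conv wr wa.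
Qed.

Lemma gker_le a s : 0 < a <= p -> 0 < s -> gker a s <= pker a s * rtail s.
Proof.
move=> /andP[a0 ap] s0; have aa : 0 < a <= 1 by rewrite a0 (le_trans ap).
have wa := wsing_pker aa (lexx _).
rewrite /gker /rtail mulrBr mulr1 lerD2l lerN2 mulrCA ler_wpM2l ?(ltW c0)//.
rewrite (convC _ (measurable_cst _)); last by case: wr.
rewrite -(convZr _ _ wr (wone aa)).
rewrite [leRHS]convC; [|exact: measurable_pker|by case: wr].
apply: (le_conv wr wr (wsingZ _ (wone aa)) wa) => x /andP[x0 xs].
rewrite mulr1 ler_wpM2l ?(ltW (resolvent_gt0 _)) ?subr_gt0//.
by apply: pker_nonincr => //; [exact: le_trans ap p1|exact: ltW].
Qed.

Lemma integral_pker_tail a T : 0 < a < p -> 1 < T ->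
  \int[mu]_(s in `]1, T[) pker (a - p) s <= (p - a)^-1.
Proof.
move=> /andP[a0 ap] T1; rewrite /Rintegral.
have mp : measurable_fun `]1, T[ (EFin \o pker (a - p)).
  by apply/measurable_EFinP; apply: measurable_funS (measurable_pker _).
rewrite -(integral_itv_bndoo true false mp) integral_pker_cc ?subr_eq0 ?(lt_eqF ap)//=.
have -> : (T `^ (a - p) - 1 `^ (a - p)) / (a - p) = (1 - T `^ (a - p)) / (p - a).
  by rewrite powR1 -[a - p]opprB invrN mulrN -mulNr !opprB.
by rewrite ler_piMl ?invr_ge0 ?subr_ge0 ?(ltW ap)// gerBl powR_ge0.
Qed.

(** The kernel g may change sign, but g <= k_a R and the integral of g up to T
    equals (k_a * R)(T) >= 0.  Hence the integral of |g| is at most twice that of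
    k_a R, which is at most k_a near 0 and O(s^(a-p-1)) at infinity. *)
Lemma gker_mass a : 0 < a < p -> exists C : R, forall T, conv (fun=> 1) (fun s => `|gker a s|) T <= C.
Proof.
move=> /andP[a0 ap]; have a1 : a <= 1 by exact: le_trans (ltW ap) p1.
have aa : 0 < a <= 1 by rewrite a0.
have aap : 0 < a <= p by rewrite a0 ltW.
have wa := wsing_pker aa (lexx _); have wg := wsing_gker aap.
have wkt : wsing a (fun s => pker a s * rtail s).
  split => //; first by apply: measurable_funM; [exact: measurable_pker|case: wsing_rtail].
  move=> T; exists 1 => // t _; rewrite normrM mul1r !ger0_norm ?pker_ge0 ?rtail_ge0//.
  by rewrite ler_piMr ?pker_ge0 ?rtail_le1.
(* |g| <= 2 k_a R - g, because g <= k_a R and k_a R >= 0 *)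
have step1 T : conv (fun=> 1) (fun s => `|gker a s|) T <= 2 * conv (fun=> 1) (fun s => pker a s * rtail s) T.
  apply: (@le_trans _ _ (conv (fun=> 1) (fun s => 2 * (pker a s * rtail s) + -1 * gker a s) T)).
    apply: (le_conv (wone aa) (wone aa) (wsing_abs wg) (wsingD (wsingZ _ wkt) (wsingZ _ wg))) => s /andP[s0 _].
    rewrite !mul1r; have := gker_le aap s0; have : 0 <= pker a s * rtail s by rewrite mulr_ge0 ?pker_ge0 ?rtail_ge0.
    move: (gker a s) (pker a s * rtail s) => x y y0 xy; rewrite ler_norml; apply/andP; split; lra.
  rewrite (convDr _ (wone aa) (wsingZ _ wkt) (wsingZ _ wg)) (convZr _ _ (wone aa) wkt) (convZr _ _ (wone aa) wg).
  rewrite gerDl mulN1r oppr_le0.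
  have -> : conv (fun=> 1) (gker a) T = conv (pker a) rtail T.
    rewrite conv_rtail// -conv1_conv_pker//.
    have w1 : wsing a (conv (pker a) r).
      have -> : conv (pker a) r = conv r (pker a).
        by apply/funext => s; apply: convC; [exact: measurable_pker|case: wr].
      exact: wsing_conv wr wa.
    rewrite -(convC _ (measurable_cst _) (@measurable_pker _ a)).
    rewrite -mulNr -(convZr _ _ (wone aa) w1) -(convDr _ (wone aa) wa (wsingZ _ w1)).
    by apply: eq_conv => // s _; rewrite mulNr.
  by apply: conv_ge0 => s _; [exact: pker_ge0|exact: rtail_ge0].
have [D D0 De] : exists2 D, 0 <= D & D = p / c.
  by eexists; last reflexivity; rewrite divr_ge0 ?(ltW p0) ?(ltW c0).
exists (2 * (a^-1 + D * (p - a)^-1)) => T.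
apply: (le_trans (step1 T)); rewrite ler_wpM2l//.
have B0 : 0 <= a^-1 + D * (p - a)^-1 by rewrite addr_ge0 ?mulr_ge0 ?invr_ge0 ?subr_ge0 ?(ltW a0) ?(ltW ap).
have [T0|T0] := ltP 0 T; last by rewrite conv_le0.
have int1 : mu.-integrable `]0, T[ (EFin \o (fun s => pker a s * rtail s)).
  exact: wsing_integrable wkt.
rewrite conv1l.
(* before time 1 bound R by 1, afterwards by its decay *)
have small S : 0 < S <= 1 -> \int[mu]_(s in `]0, S[) (pker a s * rtail s) <= a^-1.
  move=> /andP[S0 S1]; apply: (@le_trans _ _ (\int[mu]_(s in `]0, S[) pker a s)).
    apply: le_Rintegral => //.
    - exact: wsing_integrable wkt.
    - exact: wsing_integrable wa.
    - by move=> s _; rewrite ler_piMr ?pker_ge0 ?rtail_le1.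
  rewrite Rintegral_pker// ler_pdivrMr// mulVf ?gt_eqF//.
  have <- : 1 `^ a = 1 :> R by rewrite powR1.
  by apply: ge0_ler_powR; rewrite ?nnegrE ?(ltW a0) ?(ltW S0) ?ler01.
have [T1|T1] := leP T 1.
  apply: (le_trans (small T _)); first by rewrite T0.
  by rewrite lerDl mulr_ge0 ?invr_ge0 ?subr_ge0 ?(ltW ap).
have eU : `]0, 1[%classic `|` `[1, T[%classic = `]0, T[%classic :> set R.
  by rewrite -itv_bndbnd_setU// bnd_simp ?ler01// ltW.
have -> : \int[mu]_(s in `]0, T[) (pker a s * rtail s) =
    \int[mu]_(s in `]0, 1[) (pker a s * rtail s) + \int[mu]_(s in `[1, T[) (pker a s * rtail s).
  rewrite -Rintegral_setU//.
  - by rewrite eU.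
  - by rewrite eU.
  - apply/disj_setPS => y [/=]; rewrite !in_itv/= => /andP[_ h] /andP[h' _].
    by have := lt_le_trans h h'; rewrite ltxx.
apply: lerD; first by apply: small; rewrite ltr01 lexx.
have intS : mu.-integrable `]1, T[ (EFin \o (fun s => pker a s * rtail s)).
  apply: integrableS int1 => //; apply: subset_itvr; rewrite bnd_simp; exact: ler01.
rewrite -Rintegral_itv_obnd_cbnd//.
have intp : mu.-integrable `]1, T[ (EFin \o pker (a - p)).
  apply: (@le_integrable _ _ _ mu `]1, T[%classic _ _ (EFin \o pker a)) => //.
  - by apply/measurable_EFinP; apply: measurable_funS (measurable_pker _).
  - move=> s; rewrite /= in_itv/= => /andP[s1 _]; rewrite lee_fin !ger0_norm ?pker_ge0//.
    by apply: ler_powR; [exact: ltW|lra].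
  - apply: integrableS (wsing_integrable T wa) => //.
    by apply: subset_itvr; rewrite bnd_simp; exact: ler01.
apply: (@le_trans _ _ (\int[mu]_(s in `]1, T[) (D * pker (a - p) s))); last first.
  by rewrite RintegralZl// ler_wpM2l// integral_pker_tail// a0.
apply: le_Rintegral => //.
  by have := @integrableZl _ _ _ mu `]1, T[%classic (measurable_itv _) D (EFin \o pker (a - p)) intp.
move=> s; rewrite /= in_itv/= => /andP[s1 sT]; have s0 : 0 < s by exact: lt_trans s1.
apply: (le_trans (ler_wpM2l (pker_ge0 a s) (rtail_decay s0))).
have -> : pker (a - p) s = pker a s / s `^ p.
  rewrite -powRN /pker -powRD ?(gt_eqF s0) ?implybT//.
  by have -> : a - 1 - p = a - p - 1 by lra.
by rewrite De invfM le_eqVlt; apply/orP; left; apply/eqP; ring.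
Qed.
End Resolvent.

(** * Uniform and asymptotic domination *)

Section Domination.
Variable R : realType.
Implicit Types (x y h g : R -> R) (p s t T : R).

(** The first half compares suprema over ]0, T], the second limits superior at
    infinity of a bounded h.  Both are needed: the former to keep
    solutions small, the latter to make them decay. *)
Definition dominated (C : R) x h :=
  (forall T M : R, 0 <= M -> (forall t, 0 < t <= T -> h t <= M) -> forall t, 0 < t <= T -> x t <= C * M) /\
  (forall M b : R, 0 <= M -> 0 <= b -> (forall t, 0 < t -> h t <= M) ->
     (exists T, forall t, T < t -> h t <= b) ->
     forall e, 0 < e -> exists T, forall t, T < t -> x t <= C * b + e).

Lemma dominated_bounded C x h (M : R) : dominated C x h -> 0 <= M -> (forall t, 0 < t -> h t <= M) ->
  forall t, 0 < t -> x t <= C * M.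
Proof.
move=> [d _] M0 hM t t0; apply: (d t) => //; last by rewrite t0 lexx.
by move=> s /andP[s0 _]; exact: hM.
Qed.

Lemma dominated_refl h : dominated 1 h h.
Proof.
split=> [T M M0 hM t tT|M b M0 b0 hM [T hT] e e0]; first by rewrite mul1r hM.
by exists T => t tT; rewrite mul1r (le_trans (hT t tT))// lerDl ltW.
Qed.

Lemma dominated_trans C D x y h : 0 <= C -> 0 <= D -> dominated C x y -> dominated D y h -> dominated (C * D) x h.
Proof.
move=> C0 D0 d1 d2; split=> [T M M0 hM t tT|M b M0 b0 hM hT e e0].
  rewrite -mulrA; apply: (d1.1 T) => //; first by rewrite mulr_ge0.
  exact: (d2.1 T).
have e1 : 0 < e / (2 * (C + 1)) by rewrite divr_gt0 ?mulr_gt0//; lra.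
have hy := d2.2 M b M0 b0 hM hT _ e1.
have e2 : 0 < e / 2 by rewrite divr_gt0.
have [|||T' hT'] := d1.2 (D * M) (D * b + e / (2 * (C + 1))) _ _ _ hy _ e2.
- by rewrite mulr_ge0.
- by rewrite (addr_ge0 (mulr_ge0 D0 b0) (ltW e1)).
- exact: (dominated_bounded d2 M0 hM).
exists T' => t tT; apply: (le_trans (hT' t tT)).
rewrite mulrDr mulrA -addrA lerD2l.
have -> : C * (e / (2 * (C + 1))) = (C / (C + 1)) * (e / 2) by field; lra.
have : C / (C + 1) * (e / 2) <= e / 2.
  by rewrite ler_piMl ?(ltW e2)// ler_pdivrMr; lra.
by lra.
Qed.

Lemma dominated_le K C x x' h : 0 <= K -> (forall t, 0 < t -> x t <= K * x' t) -> dominated C x' h -> dominated (K * C) x h.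
Proof.
move=> K0 xx [d1 d2]; split=> [T M M0 hM t tT|M b M0 b0 hM hT e e0].
  rewrite -mulrA; have /andP[t0 _] := tT; apply: (le_trans (xx t t0)).
  by rewrite ler_wpM2l// (d1 T).
have e1 : 0 < e / (K + 1) by rewrite divr_gt0//; lra.
have [T' hT'] := d2 M b M0 b0 hM hT _ e1.
exists (Num.max 0 T') => t; rewrite gt_max => /andP[t0 tT].
apply: (le_trans (xx t t0)); apply: (le_trans (ler_wpM2l K0 (hT' t tT))).
rewrite mulrDr mulrA lerD2l mulrCA ler_piMr ?(ltW e0)// ler_pdivrMr; lra.
Qed.

Lemma dominated_add C D x y z h : (forall t, 0 < t -> x t <= y t + z t) -> dominated C y h -> dominated D z h ->
  dominated (C + D) x h.
Proof.
move=> xyz d1 d2; split=> [T M M0 hM t tT|M b M0 b0 hM hT e e0].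
  have /andP[t0 _] := tT; apply: (le_trans (xyz t t0)).
  by rewrite mulrDl lerD// ?(d1.1 T) ?(d2.1 T).
have e2 : 0 < e / 2 by rewrite divr_gt0.
have [T1 hT1] := d1.2 M b M0 b0 hM hT _ e2.
have [T2 hT2] := d2.2 M b M0 b0 hM hT _ e2.
exists (Num.max 0 (Num.max T1 T2)) => t; rewrite !gt_max => /and3P[t0 t1 t2].
apply: (le_trans (xyz t t0)); apply: (le_trans (lerD (hT1 _ t1) (hT2 _ t2))).
by rewrite le_eqVlt; apply/orP; left; apply/eqP; field.
Qed.

Lemma dominated_sum (I : eqType) (r : seq I) (C : I -> R) (y : I -> R -> R) h :
  (forall i, i \in r -> dominated (C i) (y i) h) ->
  dominated (\sum_(i <- r) C i) (fun t => \sum_(i <- r) y i t) h.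
Proof.
elim: r => [|i r IHr] hr.
  split=> [T M M0 hM t tT|M b M0 b0 hM hT e e0]; first by rewrite !big_nil mul0r.
  by exists 0 => t _; rewrite !big_nil mul0r add0r ltW.
rewrite big_cons; apply: (@dominated_add _ _ _ (y i) (fun t => \sum_(i <- r) y i t)).
- by move=> t _; rewrite big_cons.
- by apply: hr; rewrite mem_head.
- by apply: IHr => j jr; apply: hr; rewrite in_cons jr orbT.
Qed.

(** In the supremum over ]0, T] and in the limit superior alike: the quantity
    l for x is finite and satisfies l <= C (b + q l), with C q < 1. *)
Lemma dominated_absorb C (q : R) x y h : 0 <= C -> 0 <= q -> C * q < 1 -> locally_bounded x ->
  (forall t, 0 <= x t) ->
  (forall t, 0 < t -> y t <= h t + q * x t) -> dominated C x y -> dominated (C / (1 - C * q)) x h.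
Proof.
move=> C0 q0 Cq xb x0 yh d.
have d0 : 0 < 1 - C * q by lra.
have part1 T (M : R) : 0 <= M -> (forall t, 0 < t <= T -> h t <= M) ->
    forall t, 0 < t <= T -> x t <= C / (1 - C * q) * M.
  move=> M0 hM t tT; have [B hB] := xb T.
  pose S := [set x t | t in [set t | 0 < t <= T]].
  have hS : has_sup S.
    split; first by exists (x t), t.
    by exists B => _ [s sT <-]; rewrite (le_trans (ler_norm _))// hB.
  have supS s : 0 < s <= T -> x s <= sup S.
    by move=> sT; apply: ub_le_sup; [case: hS|exists s].
  have S0 : 0 <= sup S by apply: le_trans (supS t tT).
  have : sup S <= C * (M + q * sup S).
    apply: ge_sup; first by case: hS.
    move=> _ [s sT <-]; apply: (d.1 T) => //; first by rewrite addr_ge0 ?mulr_ge0.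
    move=> r rT; have /andP[r0 _] := rT; apply: (le_trans (yh r r0)).
    by rewrite lerD ?hM// ler_wpM2l// supS.
  move=> h1; apply: (le_trans (supS t tT)).
  rewrite mulrAC ler_pdivlMr//; move: h1; move: (sup S) => u; nra.
split => // M b M0 b0 hM hT e e0.
have bx t : 0 < t -> x t <= C / (1 - C * q) * M.
  by move=> t0; apply: (part1 t) => //; [move=> s /andP[s0 _]; exact: hM|rewrite t0 lexx].
set B := C / (1 - C * q) * M in bx.
have B0 : 0 <= B by rewrite mulr_ge0// divr_ge0// ltW.
clearbody B.
(* the infimum of S is the limit superior of x, bounded below by 0 *)
pose S := [set l | 0 <= l /\ exists T, forall t, T < t -> x t <= l].
have hS : has_inf S.
  split; last by exists 0 => l [].
  by exists B; split=> //; exists 0 => t; exact: bx.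
have L0 : 0 <= inf S by apply: lb_le_inf; [case: hS|move=> l []].
have step l : S l -> inf S <= C * (b + q * l).
  move=> [l0 [T1 hT1]]; apply/ler_addgt0Pr => e' e0'.
  have [T2 hT2] := hT.
  have [||||T3 hT3] := d.2 (M + q * B) (b + q * l) _ _ _ _ e' e0'.
  - by rewrite addr_ge0 ?mulr_ge0.
  - by rewrite addr_ge0 ?mulr_ge0.
  - by move=> t t0; apply: (le_trans (yh t t0)); rewrite lerD ?hM// ler_wpM2l// bx.
  - exists (Num.max 0 (Num.max T1 T2)) => t; rewrite !gt_max => /and3P[t0 t1 t2].
    by apply: (le_trans (yh t t0)); rewrite lerD ?hT2// ler_wpM2l// hT1.
  apply: ge_inf; first by case: hS.
  split; last by exists T3.
  by rewrite addr_ge0 ?(ltW e0') ?mulr_ge0 ?addr_ge0 ?mulr_ge0.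
have : inf S <= C * (b + q * inf S).
  apply/ler_addgt0Pr => e' e0'.
  have e1 : 0 < e' / (C * q + 1) by rewrite divr_gt0// ltr_wpDl ?mulr_ge0.
  have [l Sl hl] := inf_adherent e1 hS.
  apply: (le_trans (step l Sl)).
  have -> : C * (b + q * inf S) + e' = C * b + (C * q * inf S + e') by ring.
  have -> : C * (b + q * l) = C * b + C * q * l by ring.
  rewrite lerD2l; apply: (@le_trans _ _ (C * q * (inf S + e' / (C * q + 1)))).
    by rewrite ler_wpM2l ?mulr_ge0// ltW.
  rewrite mulrDr lerD2l mulrCA ler_piMr ?(ltW e0')// ler_pdivrMr ?mul1r ?lerDl//.
  by rewrite ltr_wpDl ?mulr_ge0.
move=> h1; have h2 : inf S <= C / (1 - C * q) * b.
  by rewrite mulrAC ler_pdivlMr//; move: h1; move: (inf S) => u; nra.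
have [l [_ [T hT']] hl] := inf_adherent e0 hS.
exists T => t tT; apply: (le_trans (hT' t tT)); apply: (le_trans (ltW hl)).
by rewrite lerD2r.
Qed.

Lemma conv1_nonincr p g t t' : 0 < p <= 1 -> wsing p g -> (forall s, 0 <= g s) -> t <= t' ->
  conv (fun=> 1) g t <= conv (fun=> 1) g t'.
Proof.
move=> pp wg g0 tt; have w1 := wsing_cst 1 pp; rewrite !convE.
apply: le_Rintegral => //.
- exact: integrable_causal_prod w1 wg.
- exact: integrable_causal_prod w1 wg.
move=> s _; have [s0|s0] := ltP 0 s; last by rewrite !(causal0 g s0) !mulr0.
rewrite (causalE g s0) ler_wpM2r//.
have [st|st] := ltP s t; last first.
  rewrite (@causal0 _ _ (t - s)) ?subr_le0//.
  by have [st'|st'] := ltP s t'; [rewrite causalE ?subr_gt0|rewrite causal0 ?subr_le0].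
by rewrite !causalE ?subr_gt0// (lt_le_trans st).
Qed.

Definition past T : R -> R := (fun=> 1 : R) \_ `]0, T[%classic.

(** What happened before time T is weighted at time t only by the mass of g
    beyond t - T, and this tends to 0 when g is integrable. *)
Lemma conv_past p g t T : 0 < p <= 1 -> wsing p g -> (forall s, 0 <= g s) -> 0 <= T ->
  conv g (past T) t <= conv (fun=> 1) g t - conv (fun=> 1) g (t - T).
Proof.
move=> pp wg g0 T0; have w1 := wsing_cst 1 pp; have mg : measurable_fun setT g by case: wg.
have wi : wsing p (past T).
  by apply: (@wsing_trunc _ _ _ _ 1) => // [s _]; rewrite ?normr1.
rewrite lerBrDr (convC _ mg); last by case: wi.
have i1 := integrable_causal_prod t wi wg.
have i2 := integrable_causal_prod (t - T) w1 wg.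
rewrite !convE -RintegralD//.
apply: le_Rintegral => //.
- have := @integrableD _ _ _ (@lebesgue_measure R) setT measurableT _ _ i1 i2; exact.
- exact: integrable_causal_prod w1 wg.
move=> s _; have [s0|s0] := ltP 0 s; last by rewrite !(causal0 g s0) !mulr0 addr0.
rewrite (causalE g s0) -mulrDl ler_wpM2r//.
have [st|st] := ltP s t; last first.
  by rewrite !(@causal0 _ _ (t - s)) ?subr_le0// add0r causal0//; lra.
rewrite !(@causalE _ _ (t - s)) ?subr_gt0// /past patchE.
have [sT|sT] := ltP (t - s) T.
  by rewrite mem_set/= ?in_itv/= ?subr_gt0 ?st// causal0 ?addr0//; lra.
rewrite memNset/= ?in_itv/=; last by rewrite [t - s < T]ltNge sT andbF.
rewrite [point]/(0 : R) add0r; have [h|h] := ltP 0 (t - T - s); [by rewrite causalE|by rewrite causal0].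
Qed.

(** Convolution with an integrable kernel: the values of h before a late time
    are forgotten by [conv_past], and the later ones are at most b. *)
Lemma dominated_conv p g x h (C : R) : 0 < p <= 1 -> wsing p g -> wsing p h -> (forall t, 0 <= h t) -> 0 <= C ->
  (forall T, conv (fun=> 1) (fun s => `|g s|) T <= C) ->
  (forall t, 0 < t -> x t <= conv (fun s => `|g s|) h t) -> dominated C x h.
Proof.
move=> pp wg wh h0 C0 gC xh; have wa := wsing_abs wg; have w1 := wsing_cst 1 pp.
have ga s : 0 <= `|g s| by [].
have ma : measurable_fun setT (fun s => `|g s|) by case: wa.
split=> [T M M0 hM t /andP[t0 tT]|M b M0 b0 hM [T hT] e e0].
  apply: (le_trans (xh t t0)).
  apply: (@le_trans _ _ (conv (fun s => `|g s|) (fun s => M * 1) t)).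
    apply: (le_conv wa wa wh (wsingZ _ w1)) => s /andP[s0 st].
    by rewrite ler_wpM2l// mulr1 hM// s0 (le_trans (ltW st)).
  rewrite (convZr _ _ wa w1) (convC _ ma (measurable_cst _)) mulrC.
  by rewrite ler_wpM2r.
pose I := conv (fun=> 1) (fun s => `|g s|).
have e1 : 0 < e / (M + 1) by rewrite divr_gt0// ltr_wpDl.
have hS : has_sup (range I) by split; [exists (I 0), 0|exists C => _ [t _ <-]].
have [_ [t1 _ <-] ht1] := sup_adherent e1 hS.
pose T1 := Num.max 0 T + 1.
have T10 : 0 <= T1 by rewrite addr_ge0// le_max lexx.
exists (Num.max 0 (t1 + T1)) => t; rewrite gt_max => /andP[t0 tt].
apply: (le_trans (xh t t0)).
have wi : wsing p (past T1).
  by apply: (@wsing_trunc _ _ _ _ 1) => // [s _]; rewrite ?normr1.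
apply: (@le_trans _ _ (conv (fun s => `|g s|) (fun s => b * 1 + M * past T1 s) t)).
  apply: (le_conv wa wa wh (wsingD (wsingZ _ w1) (wsingZ _ wi))) => s /andP[s0 st].
  rewrite ler_wpM2l// mulr1 /past patchE.
  have [sT|sT] := ltP s T1.
    by rewrite mem_set/= ?in_itv/= ?s0 ?sT// mulr1 (le_trans (hM s s0))// lerDr.
  rewrite memNset/= ?in_itv/=; last by rewrite [s < _]ltNge sT andbF.
  rewrite [point]/(0 : R) mulr0 addr0.
  by apply: hT; apply: lt_le_trans sT; rewrite ltr_pwDr// le_max lexx orbT.
rewrite (convDr _ wa (wsingZ _ w1) (wsingZ _ wi)) (convZr _ _ wa w1) (convZr _ _ wa wi).
apply: lerD.
  by rewrite (convC _ ma (measurable_cst _)) mulrC ler_wpM2r.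
apply: (@le_trans _ _ (M * (e / (M + 1)))).
  rewrite ler_wpM2l//; apply: (le_trans (conv_past t pp wa ga T10)).
  rewrite -/I lerBlDr; apply: (@le_trans _ _ (sup (range I))).
    by apply: ub_le_sup; [case: hS|exists t].
  rewrite addrC -lerBlDr; apply: (le_trans (ltW ht1)); apply: (conv1_nonincr pp wa ga).
  by rewrite lerBrDr ltW.
rewrite mulrCA ler_piMr ?(ltW e0)// ler_pdivrMr ?mul1r ?lerDl//.
by rewrite ltr_wpDl.
Qed.
End Domination.

(** * Convolution of complex-valued functions *)

Section ComplexLayer.
Import ComplexField.Normc.
Variable R : realType.
Local Notation C := R[i].
Local Notation Re := (@complex.Re R).
Local Notation Im := (@complex.Im R).
Implicit Types (X Y H F : R -> C) (p q s t : R) (z w : C).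

(** Continuity in terms of the real and imaginary parts, the form in which the
    real theory uses it. *)
Definition contC X := continuous (fun t => Re (X t)) /\ continuous (fun t => Im (X t)).

Definition cconv (k : R -> R) X t : C :=
  Complex (conv k (fun s => Re (X s)) t) (conv k (fun s => Im (X s)) t).

Lemma Re_cconv k X t : Re (cconv k X t) = conv k (fun s => Re (X s)) t.
Proof. by []. Qed.
Lemma Im_cconv k X t : Im (cconv k X t) = conv k (fun s => Im (X s)) t.
Proof. by []. Qed.

Lemma complex_ext z w : Re z = Re w -> Im z = Im w -> z = w.
Proof. by case: z w => [a b] [c d] /= -> ->. Qed.

Lemma cReD z w : Re (z + w) = Re z + Re w. Proof. by case: z w => [a b] [c d]. Qed.
Lemma cImD z w : Im (z + w) = Im z + Im w. Proof. by case: z w => [a b] [c d]. Qed.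
Lemma cReM z w : Re (z * w) = Re z * Re w + (- Im z) * Im w.
Proof. by case: z w => [a b] [c d] /=; rewrite mulNr. Qed.
Lemma cImM z w : Im (z * w) = Im z * Re w + Re z * Im w.
Proof. by case: z w => [a b] [c d] /=; rewrite addrC. Qed.
Lemma normc_sqrt z : normc z = Num.sqrt (Re z ^+ 2 + Im z ^+ 2).
Proof. by case: z. Qed.
Lemma normc_ge0 z : 0 <= normc z. Proof. by rewrite normc_sqrt sqrtr_ge0. Qed.

Lemma contCD X Y : contC X -> contC Y -> contC (fun t => X t + Y t).
Proof.
move=> [x1 x2] [y1 y2]; split.
  have -> : (fun t => Re (X t + Y t)) = (fun t => Re (X t) + Re (Y t)).
    by apply/funext => t; rewrite cReD.
  by move=> t; apply: cvgD; [exact: x1|exact: y1].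
have -> : (fun t => Im (X t + Y t)) = (fun t => Im (X t) + Im (Y t)).
  by apply/funext => t; rewrite cImD.
by move=> t; apply: cvgD; [exact: x2|exact: y2].
Qed.

Lemma contCZ z X : contC X -> contC (fun t => z * X t).
Proof.
move=> [x1 x2]; split.
  have -> : (fun t => Re (z * X t)) = (fun t => Re z * Re (X t) + (- Im z) * Im (X t)).
    by apply/funext => t; rewrite cReM.
  by move=> t; apply: cvgD; apply: cvgMr; [exact: x1|exact: x2].
have -> : (fun t => Im (z * X t)) = (fun t => Im z * Re (X t) + Re z * Im (X t)).
  by apply/funext => t; rewrite cImM.
by move=> t; apply: cvgD; apply: cvgMr; [exact: x1|exact: x2].
Qed.

Lemma contC_norm X : contC X -> continuous (fun t => normc (X t)).
Proof.
move=> [x1 x2].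
have -> : (fun t => normc (X t)) = (fun t => Num.sqrt (Re (X t) * Re (X t) + Im (X t) * Im (X t))).
  by apply/funext => t; rewrite normc_sqrt !expr2.
move=> t; apply: (@continuous_comp _ _ _ (fun t => Re (X t) * Re (X t) + Im (X t) * Im (X t)) Num.sqrt); last exact: sqrt_continuous.
by apply: cvgD; apply: cvgM; first [exact: x1|exact: x2].
Qed.

Lemma wsingRe p X : 0 < p <= 1 -> contC X -> wsing p (fun s => Re (X s)).
Proof. by move=> pp [x1 _]; exact: continuous_wsing. Qed.
Lemma wsingIm p X : 0 < p <= 1 -> contC X -> wsing p (fun s => Im (X s)).
Proof. by move=> pp [_ x2]; exact: continuous_wsing. Qed.
Lemma wsing_normc p X : 0 < p <= 1 -> contC X -> wsing p (fun s => normc (X s)).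
Proof. by move=> pp /contC_norm; exact: continuous_wsing. Qed.

Lemma cconvD p k X Y t : wsing p k -> contC X -> contC Y ->
  cconv k (fun s => X s + Y s) t = cconv k X t + cconv k Y t.
Proof.
move=> wk cX cY; have [pp _ _] := wk; apply: complex_ext; rewrite /cconv/=.
  rewrite -(convDr _ wk (wsingRe pp cX) (wsingRe pp cY)).
  by apply: eq_conv => // s _; rewrite cReD.
rewrite -(convDr _ wk (wsingIm pp cX) (wsingIm pp cY)).
by apply: eq_conv => // s _; rewrite cImD.
Qed.

Lemma cconvZ p k z X t : wsing p k -> contC X ->
  cconv k (fun s => z * X s) t = z * cconv k X t.
Proof.
move=> wk cX; have [pp _ _] := wk.
have w1 := wsingRe pp cX; have w2 := wsingIm pp cX.
apply: complex_ext; rewrite ?cReM ?cImM /cconv/=.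
  rewrite -!(convZr _ _ wk w1) -!(convZr _ _ wk w2) -(convDr _ wk (wsingZ _ w1) (wsingZ _ w2)).
  by apply: eq_conv => // s _; rewrite cReM.
rewrite -!(convZr _ _ wk w1) -!(convZr _ _ wk w2) -(convDr _ wk (wsingZ _ w1) (wsingZ _ w2)).
by apply: eq_conv => // s _; rewrite cImM.
Qed.

Lemma eq_cconv k X Y t : (forall s, 0 < s < t -> X s = Y s) -> cconv k X t = cconv k Y t.
Proof.
by move=> h; apply: complex_ext => /=; apply: eq_conv => // s st; rewrite h.
Qed.

Lemma contC_cconv p X : 0 < p <= 1 -> contC X -> contC (cconv (pker p) X).
Proof.
move=> pp [x1 x2]; split; apply: continuous_conv => //;
  first [exact: continuous_measurable|exact: continuous_lbounded].
Qed.

Lemma conv_pker_pker p q (x : R -> R) t : 0 < p <= 1 -> 0 < q <= 1 -> wsing q x ->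
  conv (pker p) (conv (pker q) x) t = beta p q * conv (pker (p + q)) x t.
Proof.
move=> pp qq wx; have wp := wsing_pker pp (lexx _); have wq := wsing_pker qq (lexx _).
have pq : q <= p + q by case/andP: pp => /ltW; rewrite lerDr.
rewrite (convA _ wp wq wx) -(convZl _ _ (wsing_pker qq pq) wx).
by apply: eq_conv => // s /andP[s0 _]; rewrite conv_pker.
Qed.

Lemma cconv_pker p q X t : 0 < p <= 1 -> 0 < q <= 1 -> contC X ->
  cconv (pker p) (cconv (pker q) X) t = (beta p q)%:C%C * cconv (pker (p + q)) X t.
Proof.
move=> pp qq cX; apply: complex_ext; rewrite ?cReM ?cImM /cconv/=.
  by rewrite conv_pker_pker ?oppr0 ?mul0r ?addr0//; exact: wsingRe.
by rewrite conv_pker_pker ?mul0r ?add0r//; exact: wsingIm.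
Qed.

(** Multiply the integral by the conjugate of its value and take real parts; the
    Cauchy-Schwarz inequality is then applied under the integral sign. *)
Lemma normc_cconv_le p g X t : wsing p g -> contC X ->
  normc (cconv g X t) <= conv (fun s => `|g s|) (fun s => normc (X s)) t.
Proof.
move=> wg cX; have [pp _ _] := wg.
have w1 := wsingRe pp cX; have w2 := wsingIm pp cX; have wn := wsing_normc pp cX.
set a := conv g (fun s => Re (X s)) t; set b := conv g (fun s => Im (X s)) t.
have nE : normc (cconv g X t) = Num.sqrt (a ^+ 2 + b ^+ 2) by [].
set N := conv _ _ t; set n := normc _ in nE *.
have n0 : 0 <= n by exact: normc_ge0.
have nn : n * n = a * a + b * b by rewrite -expr2 nE sqr_sqrtr ?addr_ge0 ?sqr_ge0// !expr2.
have N0 : 0 <= N by apply: conv_ge0 => s _; [exact: normr_ge0|exact: normc_ge0].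
suff h : n * n <= n * N.
  move: n0; rewrite le_eqVlt => /predU1P[<-//|n0].
  by rewrite -(ler_pM2l n0).
have -> : n * n = conv g (fun s => a * Re (X s) + b * Im (X s)) t.
  by rewrite (convDr _ wg (wsingZ _ w1) (wsingZ _ w2)) (convZr _ _ wg w1) (convZr _ _ wg w2).
have -> : n * N = conv (fun s => `|g s|) (fun s => n * normc (X s)) t.
  by rewrite (convZr _ _ (wsing_abs wg) wn).
apply: (le_conv wg (wsing_abs wg) (wsingD (wsingZ _ w1) (wsingZ _ w2)) (wsingZ _ wn)) => s _.
apply: (le_trans (ler_norm _)); rewrite normrM ler_wpM2l//.
have CS (u v x y : R) : `|u * x + v * y| <= Num.sqrt (u ^+ 2 + v ^+ 2) * Num.sqrt (x ^+ 2 + y ^+ 2).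
  rewrite -sqrtrM ?addr_ge0 ?sqr_ge0// -sqrtr_sqr ler_sqrt ?mulr_ge0 ?addr_ge0 ?sqr_ge0//.
  rewrite -subr_ge0 [X in 0 <= X](_ : _ = (u * y - v * x) ^+ 2) ?sqr_ge0//; ring.
by rewrite nE (normc_sqrt (X s)); exact: CS.
Qed.

Let cvec (v : 'cV[R]_2) : C := Complex (v ord0 ord0) (v ord_max ord0).
Let vecc z : 'cV[R]_2 := \col_i (if i == ord0 then Re z else Im z).
Let cvecK z : cvec (vecc z) = z.
Proof. by case: z => a b; rewrite /cvec /vecc !mxE. Qed.
Let cont_cvec (x : R -> 'cV[R]_2) : continuous x -> contC (fun t => cvec (x t)).
Proof. by move=> cx; split => /=; exact: continuous_coord. Qed.

Let cont_vecc X : contC X -> continuous (fun t => vecc (X t)).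
Proof.
move=> [x1 x2]; apply: continuous_col => i.
have -> : (fun t => vecc (X t) i ord0) = if i == ord0 then fun t => Re (X t) else fun t => Im (X t).
  by apply/funext => t; rewrite mxE; case: (i == ord0).
by case: (i == ord0).
Qed.

Let vecc_cconv k z X t : vecc (cconv k X t) = \col_i conv k (fun s => vecc (X s) i ord0) t.
Proof.
apply/matrixP => i j; rewrite !mxE /cconv; case: ifP => h /=; apply: eq_conv => // s _.
  by rewrite mxE h.
by rewrite mxE h.
Qed.

Let mulz z (v : 'cV[R]_2) := vecc (z * cvec v).

Let mulz_lip z u v : `|mulz z u - mulz z v| <= (`|Re z| + `|Im z|) * `|u - v|.
Proof.
have e w1 w2 : vecc w1 - vecc w2 = vecc (w1 - w2).
  by apply/matrixP => i j; rewrite !mxE; case: ifP; case: w1 => ? ?; case: w2 => ? ?.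
have ec : cvec u - cvec v = cvec (u - v).
  by rewrite /cvec !mxE.
rewrite /mulz e -mulrBr ec.
have n0 : 0 <= (`|Re z| + `|Im z|) * `|u - v| by rewrite mulr_ge0 ?addr_ge0.
apply: cV_norm_le => // i; rewrite mxE; case: ifP => _.
  rewrite cReM (le_trans (ler_normD _ _))// mulrDl !normrM normrN.
  by apply: lerD; rewrite ler_wpM2l// coord_norm_le.
rewrite cImM (le_trans (ler_normD _ _))// addrC mulrDl !normrM.
by apply: lerD; rewrite ler_wpM2l// coord_norm_le.
Qed.

(** The complex equation is a real one in the plane. *)
Lemma cvolterra_exists p z F : 0 < p <= 1 -> contC F ->
  exists2 X, contC X & forall t, X t = F t + z * cconv (pker p) X t.
Proof.
move=> pp cF.
have L0 : 0 <= `|Re z| + `|Im z| by rewrite addr_ge0.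
have [x cx hx] := volterra_exists pp L0 (@mulz_lip z) (cont_vecc cF).
exists (fun t => cvec (x t)); first exact: cont_cvec.
move=> t; rewrite -(cconvZ _ _ (wsing_pker pp (lexx _)) (cont_cvec cx)).
rewrite -[RHS]cvecK; congr cvec; rewrite hx.
have -> : vecc (F t + cconv (pker p) (fun s => z * cvec (x s)) t) =
   vecc (F t) + vecc (cconv (pker p) (fun s => z * cvec (x s)) t).
  by apply/matrixP => i j; rewrite !mxE cReD cImD; case: ifP.
by rewrite vecc_cconv.
Qed.

Lemma cvolterra_unique p z F X Y : 0 < p <= 1 -> contC X -> contC Y ->
  (forall t, 0 < t -> X t = F t + z * cconv (pker p) X t) ->
  (forall t, 0 < t -> Y t = F t + z * cconv (pker p) Y t) ->
  forall t, 0 < t -> X t = Y t.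
Proof.
move=> pp cX cY hX hY t t0.
have L0 : 0 <= `|Re z| + `|Im z| by rewrite addr_ge0.
have key W : contC W -> (forall t, 0 < t -> W t = F t + z * cconv (pker p) W t) ->
  forall s, 0 < s <= t -> vecc (W s) = vecc (F s) + vconv p (fun s => mulz z (vecc (W s))) s.
  move=> cW hW s /andP[s0 _]; rewrite {1}(hW s s0).
  rewrite -(cconvZ _ _ (wsing_pker pp (lexx _)) cW).
  have -> : vecc (F s + cconv (pker p) (fun s => z * W s) s) =
     vecc (F s) + vecc (cconv (pker p) (fun s => z * W s) s).
    by apply/matrixP => i j; rewrite !mxE cReD cImD; case: ifP.
  rewrite vecc_cconv//; congr (_ + _); apply/matrixP => i j; rewrite !mxE.
  by apply: eq_conv => // r _; rewrite /mulz cvecK.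
rewrite -(cvecK (X t)) -(cvecK (Y t)); congr cvec.
apply: (volterra_unique pp L0 (@mulz_lip z) (cont_vecc cX) (cont_vecc cY) (key _ cX hX) (key _ cY hY)).
by rewrite t0 lexx.
Qed.
End ComplexLayer.

(** * Scalar equations with a complex coefficient *)

#[local] Opaque cconv.

Section Sector.
Import ComplexField.Normc.
Variable R : realType.
Local Notation C := R[i].
Local Notation Re := (@complex.Re R).
Local Notation Im := (@complex.Im R).
Implicit Types (X Y H F : R -> C) (p q s t : R) (z w : C).

Lemma real_complexM (x y : R) : (x * y)%:C%C = x%:C%C * y%:C%C :> C.
Proof. exact: rmorphM. Qed.

Lemma wsing_le a q (f : R -> R) : 0 < a <= 1 -> a <= q -> wsing q f -> wsing a f.
Proof.
move=> aa aq [_ mf hf]; split => // T; have [D D0 hD] := hf T.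
have [_ _ /(_ T)[E E0 hE]] := wsing_pker aa aq.
exists (D * E); first by rewrite mulr_ge0.
move=> t tT; apply: (le_trans (hD t tT)); rewrite -mulrA ler_wpM2l//.
by apply: le_trans (hE t tT); exact: ler_norm.
Qed.

(** Convolve the equation for y with r: since k_q - r = c r * k_q,
    this expresses k_q * y as r * k_a * h. *)
Lemma resolvent_formula q a (c : R) (r y h : R -> R) : 0 < q <= 1 -> 0 < a <= q ->
  wsing q r -> (forall t, 0 < t -> r t = pker q t - c * conv (pker q) r t) ->
  wsing q y -> wsing a h ->
  (forall t, 0 < t -> y t = conv (pker a) h t - c * conv (pker q) y t) ->
  forall t, 0 < t -> y t = conv (gker c r a) h t.
Proof.
move=> qq aq wr hr wy wh hy t t0.
have /andP[a0 aleq] := aq; have /andP[q0 q1] := qq.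
have aa : 0 < a <= 1 by rewrite a0 (le_trans aleq).
have wq := wsing_pker qq (lexx _); have wa := wsing_pker aa (lexx _).
have mr : measurable_fun setT r by case: wr.
have wrq := wsing_conv wr wq; have wra := wsing_conv wr wa.
have wah := wsing_conv wa wh; have wqy := wsing_conv wq wy.
have lin k (u v : R -> R) x s : wsing q k -> wsing a u -> wsing q v ->
    conv k (fun s => u s + x * v s) s = conv k u s + x * conv k v s.
  move=> wk wu /(wsing_le aa aleq) wv.
  by rewrite (convDr _ wk wu (wsingZ _ wv)) (convZr _ _ wk wv).
have e1 : conv r y t = conv r (conv (pker a) h) t - c * conv r (conv (pker q) y) t.
  rewrite -mulNr -lin//; apply: eq_conv => // s /andP[s0 _].
  by rewrite mulNr -hy.
have e2 : c * conv r (conv (pker q) y) t = conv (pker q) y t - conv r y t.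
  rewrite (convA _ wr wq wy) -(convZl _ _ wrq wy).
  transitivity (conv (fun s => pker q s + -1 * r s) y t).
    apply: eq_conv => // s /andP[s0 _].
    by rewrite hr// (convC _ mr (@measurable_pker _ q)); ring.
  rewrite convC; [|by apply: measurable_funD; [exact: measurable_pker|exact: measurable_funM]|by case: wy].
  rewrite (convDr _ wy wq (wsingZ _ wr)) (convZr _ _ wy wr) mulN1r.
  have [_ my _] := wy.
  by rewrite (convC _ my (@measurable_pker _ q)) (convC _ my mr).
have e3 : conv (pker q) y t = conv (conv r (pker a)) h t.
  by rewrite -(convA _ wr wa wh); move: e1; rewrite e2; lra.
rewrite hy// e3 -mulNr -(convZl _ _ wra wh).
have [_ mra _] := wra; have [_ mh _] := wh.
have wcra := wsingZ (- c) wra; have [_ mcra _] := wcra.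
rewrite (convC _ (@measurable_pker _ a) mh) (convC _ mcra mh) -(convDr _ wh wa wcra).
have [_ msum _] := wsingD wa wcra.
rewrite (convC _ mh msum).
apply: eq_conv => // s _.
by rewrite /gker mulNr (convC _ mr (@measurable_pker _ a)).
Qed.

(** The constant 1 / c in the case a = q is what lets
    [stable_coef_halfplane] absorb a perturbation of size < c. *)
Lemma negative_coef_dominated q a (c : R) : 0 < q <= 1 -> 0 < a <= q -> 0 < c ->
  exists2 D : R, 0 <= D /\ (a = q -> D = c^-1) & forall Y H, contC Y -> contC H ->
   (forall t, 0 < t -> Y t = cconv (pker a) H t + (- c)%:C%C * cconv (pker q) Y t) ->
   dominated D (fun t => normc (Y t)) (fun t => normc (H t)).
Proof.
move=> qq aq c0; have /andP[q0 q1] := qq; have /andP[a0 aleq] := aq.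
have aa : 0 < a <= 1 by rewrite a0 (le_trans aleq).
have [|r [wr cr hr]] := @resolvent_exists _ q c q qq.
  by rewrite lexx/=; lra.
have wg := wsing_gker c qq wr aq.
have fin (D : R) : 0 <= D -> (forall T, conv (fun=> 1) (fun s => `|gker c r a s|) T <= D) ->
  forall Y H, contC Y -> contC H ->
   (forall t, 0 < t -> Y t = cconv (pker a) H t + (- c)%:C%C * cconv (pker q) Y t) ->
   dominated D (fun t => normc (Y t)) (fun t => normc (H t)).
  move=> D0 hD Y H cY cH hY.
  apply: (dominated_conv aa wg (wsing_normc aa cH) _ D0 hD); first by move=> t; exact: normc_ge0.
  move=> t t0; have -> : Y t = cconv (gker c r a) H t.
    apply: complex_ext; rewrite ?Re_cconv ?Im_cconv.
      apply: (@resolvent_formula q a c r (fun s => Re (Y s)) (fun s => Re (H s))) => //.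
      - exact: wsingRe.
      - exact: wsingRe.
      - by move=> s s0; rewrite hY// cReD cReM !Re_cconv !Im_cconv /= oppr0 mul0r addr0 mulNr.
    apply: (@resolvent_formula q a c r (fun s => Im (Y s)) (fun s => Im (H s))) => //.
    - exact: wsingIm.
    - exact: wsingIm.
    - by move=> s s0; rewrite hY// cImD cImM !Re_cconv !Im_cconv /= mul0r add0r mulNr.
  exact: (normc_cconv_le t wg cH).
have [aeq|ane] := eqVneq a q.
  exists c^-1; first by rewrite invr_ge0 ltW.
  apply: fin; first by rewrite invr_ge0 ltW.
  move=> T; rewrite -[leRHS]mul1r ler_pdivlMr// mulrC.
  apply: le_trans (resolvent_mass qq c0 wr cr hr T); rewrite ler_wpM2l ?(ltW c0)//.
  rewrite le_eqVlt; apply/orP; left; apply/eqP; apply: eq_conv => // s /andP[s0 _].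
  by rewrite /gker aeq -hr// ger0_norm// ltW// (resolvent_gt0 qq c0 wr cr hr).
have altq : 0 < a < q by rewrite a0 lt_neqAle ane.
have [D hD] := gker_mass qq c0 wr cr hr altq.
have D0 : 0 <= D by apply: le_trans (hD 0); rewrite conv_le0.
exists D; first by split=> // aeq; rewrite aeq eqxx in ane.
exact: fin.
Qed.

Definition stable_coef p z := exists2 D : R, 0 <= D & forall X H, contC X -> contC H ->
  (forall t, 0 < t -> X t = cconv (pker p) (fun s => z * X s + H s) t) ->
  dominated D (fun t => normc (X t)) (fun t => normc (H t)).

Let cconv_affine p z X H t : 0 < p <= 1 -> contC X -> contC H ->
  cconv (pker p) (fun s => z * X s + H s) t = z * cconv (pker p) X t + cconv (pker p) H t.
Proof.
move=> pp cX cH; have wk := wsing_pker pp (lexx _).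
by rewrite (cconvD _ wk (contCZ z cX) cH) (cconvZ _ _ wk cX).
Qed.

(** The disc of radius c centred at -c exhausts the half-plane as c grows, and
    the equation with coefficient -c has the constant 1 / c. *)
Lemma stable_coef_halfplane q z : 0 < q <= 1 -> Re z < 0 -> stable_coef q z.
Proof.
move=> qq z0.
(* |z + c| < c means |z|^2 < - 2 c Re z *)
pose c := (Re z ^+ 2 + Im z ^+ 2) / (- (2 * Re z)) + 1.
have d0 : 0 < - (2 * Re z) by lra.
have c0 : 0 < c by rewrite ltr_wpDl// divr_ge0 ?(ltW d0)// addr_ge0 ?sqr_ge0.
pose w : R := normc (z + c%:C%C).
have w0 : 0 <= w by exact: normc_ge0.
have wc : w < c.
  have cz : 0 < Re z * - 2 * (c - 1 + 1) - (Re z ^+ 2 + Im z ^+ 2).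
    have -> : Re z ^+ 2 + Im z ^+ 2 = (c - 1) * (- (2 * Re z)).
      by rewrite /c addrK divfK// gt_eqF.
    by move: z0; move: (Re z) (c - 1) => u v; lra.
  have ww : w ^+ 2 = (Re z + c) ^+ 2 + Im z ^+ 2.
    by rewrite /w normc_sqrt sqr_sqrtr ?addr_ge0 ?sqr_ge0// cReD cImD /= addr0.
  rewrite -ltr_sqr ?nnegrE ?(ltW c0)// ww.
  by move: cz; rewrite !expr2; clearbody c; nra.
have qq' : 0 < q <= q by case/andP: qq => -> _; rewrite lexx.
have [D [D0 De] hD] := negative_coef_dominated qq qq' c0.
have {De} De : D = c^-1 by exact: De.
have Dw : D * w < 1 by rewrite De mulrC ltr_pdivrMr// mul1r.
exists (D / (1 - D * w)); first by rewrite divr_ge0// subr_ge0 ltW.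
move=> X H cX cH hX.
pose Y t := (z + c%:C%C) * X t + H t.
have cY : contC Y by apply: contCD => //; exact: contCZ.
apply: (@dominated_absorb _ D w _ (fun t => normc (Y t))) => //.
- by apply: continuous_lbounded; exact: contC_norm.
- by move=> t; exact: normc_ge0.
- move=> t t0; rewrite addrC (le_trans (le_normcD _ _))// lerD2r.
  by rewrite normcM.
apply: hD => // t t0; rewrite {1}hX// /Y !cconv_affine// addrAC -mulrDl.
have -> // : z + c%:C%C + (- c)%:C%C = z.
by rewrite rmorphN addrK.
Qed.

Lemma dominated_normcZ z X (D : R) h : 0 <= D -> dominated D (fun t => normc (X t)) h ->
  dominated (normc z * D) (fun t => normc (z * X t)) h.
Proof.
by move=> D0; apply: dominated_le; [exact: normc_ge0|move=> t _; rewrite normcM].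
Qed.

(** The forcing enters through k_a with a <= q.  Subtract the
    solution Y1 for the coefficient -1; the difference solves an
    equation of order q forced by (z + 1) Y1. *)
Lemma lower_order_dominated q a z : 0 < q <= 1 -> 0 < a <= q -> Re z < 0 ->
  exists2 D : R, 0 <= D & forall Y H, contC Y -> contC H ->
   (forall t, 0 < t -> Y t = cconv (pker a) H t + z * cconv (pker q) Y t) ->
   dominated D (fun t => normc (Y t)) (fun t => normc (H t)).
Proof.
move=> qq aq z0; have [D1 [D10 _] h1] := negative_coef_dominated qq aq (@ltr01 R).
have [D2 D20 h2] := stable_coef_halfplane qq z0.
have aa : 0 < a <= 1 by case/andP: aq => -> /le_trans ->//; case/andP: qq.
pose w := z + 1; have w0 := normc_ge0 w.
exists (D1 + D2 * (normc w * D1)); first by rewrite addr_ge0 ?mulr_ge0.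
move=> Y H cY cH hY.
have cKH := contC_cconv aa cH.
have [Y1 cY1 hY1] := cvolterra_exists (-1)%:C%C qq cKH.
have d1 := h1 Y1 H cY1 cH (fun t _ => hY1 t).
pose W t := Y t + -1 * Y1 t.
have cW : contC W by apply: contCD => //; exact: contCZ.
have wk := wsing_pker qq (lexx _).
have cwY1 : contC (fun t => w * Y1 t) by exact: contCZ.
have dW : dominated D2 (fun t => normc (W t)) (fun t => normc (w * Y1 t)).
  apply: h2 => // t t0; rewrite cconv_affine//.
  rewrite (cconvZ _ _ wk cY1) (cconvD _ wk cY (contCZ _ cY1)) (cconvZ _ _ wk cY1).
  rewrite /W hY// {1}hY1 rmorphN rmorph1 /w; ring.
apply: (@dominated_add _ _ _ _ (fun t => normc (Y1 t)) (fun t => normc (W t))) => //.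
  move=> t _; have -> : Y t = Y1 t + W t by rewrite /W; ring.
  exact: le_normcD.
by apply: (dominated_trans _ _ dW); rewrite ?mulr_ge0//; exact: dominated_normcZ.
Qed.

Lemma contC_sum (I : Type) (r : seq I) (u : I -> C) (V : I -> R -> C) : (forall i, contC (V i)) ->
  contC (fun t => \sum_(i <- r) u i * V i t).
Proof.
move=> cV; elim: r => [|i r IHr].
  have -> : (fun t => \sum_(i <- [::]) u i * V i t) = (fun=> 0) by apply/funext => t; rewrite big_nil.
  by split=> x0; exact: cvg_cst.
have -> : (fun t => \sum_(i <- i :: r) u i * V i t) = (fun t => u i * V i t + \sum_(i <- r) u i * V i t).
  by apply/funext => t; rewrite big_cons.
by apply: contCD => //; exact: contCZ.
Qed.

Lemma cconv_sum (I : Type) (r : seq I) (u : I -> C) (V : I -> R -> C) p k t : wsing p k ->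
  (forall i, contC (V i)) ->
  cconv k (fun t => \sum_(i <- r) u i * V i t) t = \sum_(i <- r) u i * cconv k (V i) t.
Proof.
move=> wk cV; elim: r => [|i r IHr].
  have c0 : contC (fun _ : R => 0 : C) by split=> x0; exact: cvg_cst.
  rewrite big_nil -[RHS](mul0r (cconv k (fun=> 0) t)) -(cconvZ 0 t wk c0).
  by apply: eq_cconv => s _; rewrite mul0r big_nil.
rewrite big_cons -IHr -(cconvZ _ _ wk (cV i)) -(cconvD _ wk (contCZ _ (cV i)) (contC_sum r u cV)).
by apply: eq_cconv => s _; rewrite big_cons.
Qed.

Lemma normc_sum (I : Type) (r : seq I) (u : I -> C) :
  normc (\sum_(i <- r) u i) <= \sum_(i <- r) normc (u i).
Proof.
elim: r => [|i r IHr]; first by rewrite !big_nil normc0.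
by rewrite !big_cons (le_trans (le_normcD _ _))// lerD2l.
Qed.

(** The (l+1)-fold convolution power of [pker p] is [power_const p l] times
    [pker (l.+1%:R * p)]. *)
Fixpoint power_const p l : R := if l is l'.+1 then power_const p l' * beta (l'.+1%:R * p) p else 1.

Lemma power_const_gt0 p l : 0 < p -> l.+1%:R * p <= 1 -> 0 < power_const p l.
Proof.
move=> p0; elim: l => [//|l IHl] h; have hl : l.+1%:R * p <= 1.
  by apply: le_trans h; rewrite ler_wpM2r ?(ltW p0)// ler_nat.
rewrite /= mulr_gt0 ?IHl// beta_gt0 ?hl ?mulr_gt0 ?p0//=.
by apply: le_trans hl; rewrite ler_peMl ?(ltW p0)// ler1n.
Qed.

Lemma expand_power p z X H l : 0 < p -> l.+1%:R * p <= 1 -> contC X -> contC H ->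
  (forall t, 0 < t -> X t = cconv (pker p) (fun s => z * X s + H s) t) ->
  forall t, 0 < t -> X t = z ^+ l.+1 * (power_const p l)%:C%C * cconv (pker (l.+1%:R * p)) X t +
    \sum_(j < l.+1) z ^+ j * (power_const p j)%:C%C * cconv (pker (j.+1%:R * p)) H t.
Proof.
move=> p0 + cX cH hX; elim: l => [|l IHl] hl t t0.
  have pp : 0 < p <= 1 by rewrite p0 -[leLHS]mul1r.
  rewrite big_ord_recl big_ord0 addr0 expr1 expr0 /= rmorph1 mulr1 !mul1r.
  by rewrite {1}hX// cconv_affine.
have hl' : l.+1%:R * p <= 1.
  by apply: le_trans hl; rewrite ler_wpM2r ?(ltW p0)// ler_nat.
have pp : 0 < p <= 1.
  by rewrite p0 (le_trans _ hl')// ler_peMl ?(ltW p0)// ler1n.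
have ll : 0 < l.+1%:R * p <= 1 by rewrite mulr_gt0.
rewrite big_ord_recr /= [X in _ = _ + X]addrC addrA {1}IHl//; congr (_ + _).
have -> : cconv (pker (l.+1%:R * p)) X t =
    cconv (pker (l.+1%:R * p)) (cconv (pker p) (fun s => z * X s + H s)) t.
  by apply: eq_cconv => s /andP[s0 _]; rewrite -hX.
have cXH : contC (fun s => z * X s + H s) by apply: contCD => //; exact: contCZ.
have e : l.+1%:R * p + p = l.+2%:R * p by rewrite -[l.+2%:R]natr1; ring.
have ll2 : 0 < l.+2%:R * p <= 1 by rewrite mulr_gt0.
rewrite cconv_pker// e cconv_affine// real_complexM [z ^+ l.+2]exprSr; ring.
Qed.

(** By [expand_power] and linearity X is a sum of solutions of equations
    of order q = m p, forced by H through kernels of order p, 2 p, ..., m p. *)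
Lemma stable_coef_power p z m : 0 < p -> (0 < m)%N -> m%:R * p <= 1 -> Re (z ^+ m) < 0 -> stable_coef p z.
Proof.
case: m => // l p0 _ hl zl.
have pp : 0 < p <= 1.
  by rewrite p0 (le_trans _ hl)// ler_peMl ?(ltW p0)// ler1n.
have qq : 0 < l.+1%:R * p <= 1 by rewrite mulr_gt0.
set q := l.+1%:R * p in hl qq.
pose z' := z ^+ l.+1 * (power_const p l)%:C%C.
have z'0 : Re z' < 0.
  by rewrite /z' cReM /= mulr0 addr0 pmulr_llt0// power_const_gt0.
have aj (j : 'I_l.+1) : 0 < j.+1%:R * p <= q.
  by rewrite mulr_gt0//= ler_wpM2r ?(ltW p0)// ler_nat.
have /choice [D hD] : forall j : 'I_l.+1, exists D : R, 0 <= D /\ forall Y H, contC Y -> contC H ->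
   (forall t, 0 < t -> Y t = cconv (pker (j.+1%:R * p)) H t + z' * cconv (pker q) Y t) ->
   dominated D (fun t => normc (Y t)) (fun t => normc (H t)).
  by move=> j; have [D D0 hD] := lower_order_dominated qq (aj j) z'0; exists D.
pose w (j : 'I_l.+1) := z ^+ j * (power_const p j)%:C%C.
exists (\sum_(j < l.+1) normc (w j) * D j).
  by apply: sumr_ge0 => j _; rewrite mulr_ge0 ?normc_ge0//; case: (hD j).
move=> X H cX cH hX.
have ajj (j : 'I_l.+1) : 0 < j.+1%:R * p <= 1.
  by have /andP[-> /le_trans ->] := aj j; case/andP: qq.
have /choice [Y hY] : forall j : 'I_l.+1, exists Y, contC Y /\
    forall t, Y t = cconv (pker (j.+1%:R * p)) H t + z' * cconv (pker q) Y t.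
  by move=> j; have [Y cY hY] := cvolterra_exists z' qq (contC_cconv (ajj j) cH); exists Y.
pose S t := \sum_(j < l.+1) w j * Y j t.
have cS : contC S by apply: contC_sum => j; exact: (hY j).1.
have XS : forall t, 0 < t -> X t = S t.
  apply: (@cvolterra_unique _ q z' (fun t => \sum_(j < l.+1) w j * cconv (pker (j.+1%:R * p)) H t)) => //.
    by move=> t t0; rewrite addrC; apply: (expand_power p0 hl cX cH hX).
  move=> t t0; rewrite (cconv_sum _ _ _ (wsing_pker qq (lexx _)) (fun j => (hY j).1)) mulr_sumr -big_split /=.
  by apply: eq_bigr => j _; rewrite (hY j).2 mulrDr mulrCA.
rewrite -[X in dominated X]mul1r.
apply: (@dominated_le _ 1 _ _ (fun t => \sum_(j < l.+1) normc (w j * Y j t))) => //.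
  by move=> t t0; rewrite mul1r XS//; exact: normc_sum.
apply: dominated_sum => j _; apply: dominated_normcZ; first by case: (hD j).
by apply: (hD j).2 => //; [exact: (hY j).1|move=> t _; exact: (hY j).2].
Qed.

(** With P = k_p * _ and B = beta p p one has P^2 = B k_2p * _, so that the
    equation reads X = z^2 P^2 X + P^2 H / B.  The partial fractions
    2 z P^2 / (1 - z^2 P^2) = P / (1 - z P) - P / (1 + z P)
    express its solution by those for z and -z. *)
Lemma stable_coef_double p z : 0 < p -> p + p <= 1 -> z != 0 -> stable_coef p z -> stable_coef p (- z) ->
  stable_coef (p + p) ((beta p p)%:C%C * (z * z)).
Proof.
move=> p0 p2 z0 [D1 D10 h1] [D2 D20 h2].
have pp : 0 < p <= 1 by rewrite p0 /=; lra.
have p22 : 0 < p + p <= 1 by rewrite p2 andbT; lra.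
have wk := wsing_pker pp (lexx _).
have wk2 := wsing_pker p22 (lexx _).
have b0 := beta_gt0 pp pp; set b := beta p p in b0 *.
have bC0 : b%:C%C != 0 by rewrite eq_complex /= (gt_eqF b0).
(* W = X1 - X2 below satisfies W = b z^2 k_{2p} * W + 2 b z k_{2p} * H *)
pose v := (2 * z * b%:C%C)^-1.
have v0 := normc_ge0 v.
exists (normc v * (D1 + D2)); first by rewrite mulr_ge0 ?addr_ge0.
move=> X H cX cH hX.
have cKH := contC_cconv pp cH.
have [X1 cX1 hX1] := cvolterra_exists z pp cKH.
have [X2 cX2 hX2] := cvolterra_exists (- z) pp cKH.
have d1 : dominated D1 (fun t => normc (X1 t)) (fun t => normc (H t)).
  by apply: h1 => // t _; rewrite cconv_affine// {1}hX1 addrC.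
have d2 : dominated D2 (fun t => normc (X2 t)) (fun t => normc (H t)).
  by apply: h2 => // t _; rewrite cconv_affine// {1}hX2 addrC.
pose W t := X1 t + -1 * X2 t.
pose V t := X1 t + X2 t.
have cW : contC W by apply: contCD => //; exact: contCZ.
have cV : contC V by exact: contCD.
have hW t : W t = z * cconv (pker p) V t.
  by rewrite /W (cconvD _ wk cX1 cX2) hX1 hX2; ring.
have hV t : V t = z * cconv (pker p) W t + 2 * cconv (pker p) H t.
  by rewrite /W (cconvD _ wk cX1 (contCZ _ cX2)) (cconvZ _ _ wk cX2) /V {1}hX1 {1}hX2; ring.
have hW2 t : W t = z * b%:C%C * (z * cconv (pker (p + p)) W t + 2 * cconv (pker (p + p)) H t).
  rewrite hW; have -> : cconv (pker p) V t = cconv (pker p) (fun s => z * cconv (pker p) W s + 2 * cconv (pker p) H s) t.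
    by apply: eq_cconv => s _.
  have cKW := contC_cconv pp cW.
  rewrite (cconvD _ wk (contCZ _ cKW) (contCZ _ cKH)) !(cconvZ _ _ wk)//.
  by rewrite !cconv_pker// -/b; ring.
have XW t : 0 < t -> X t = v * W t.
  apply: (@cvolterra_unique _ (p + p) (b%:C%C * (z * z)) (fun t => cconv (pker (p + p)) H t)
    X (fun t => v * W t)) => //.
  - exact: contCZ.
  - by move=> s s0; rewrite {1}hX// cconv_affine// addrC.
  - move=> s s0; rewrite {1}hW2 (cconvZ _ _ wk2 cW) /v; field.
    by rewrite bC0 z0.
apply: (@dominated_le _ (normc v) _ _ (fun t => normc (W t))) => //.
  by move=> t t0; rewrite XW// normcM.
apply: (@dominated_add _ _ _ _ (fun t => normc (X1 t)) (fun t => normc (X2 t))) => //.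
by move=> t _; rewrite /W mulN1r (le_trans (le_normcD _ _))// normcN.
Qed.
End Sector.

(** * Coefficients in a sector *)

Section Angle.
Import ComplexField.Normc.
Variable R : realType.
Local Notation C := R[i].
Local Notation Re := (@complex.Re R).
Local Notation Im := (@complex.Im R).
Implicit Types (p b r s : R) (z w : C).

Definition polar (r a : R) : C := Complex (r * cos a) (r * sin a).

Lemma polarM r s (a b : R) : polar r a * polar s b = polar (r * s) (a + b).
Proof.
apply: complex_ext; rewrite ?cReM ?cImM /= ?cosD ?sinD; ring.
Qed.

Lemma polarX r (a : R) n : polar r a ^+ n = polar (r ^+ n) (n%:R * a).
Proof.
elim: n => [|n IHn].
  by rewrite !expr0 mul0r /polar cos0 sin0 mulr1 mulr0.
rewrite !exprS IHn polarM; congr polar; rewrite -natr1; ring.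
Qed.

Lemma cos_lt0 (x : R) : pi / 2 < x <= pi -> cos x < 0.
Proof.
move=> /andP[x1 x2]; rewrite -oppr_gt0 -cosDpi.
have -> : cos (x + pi) = cos (x - pi).
  by rewrite cosD cosB cospi sinpi; ring.
apply: cos_gt0_pihalf; have := pi_gt0 R; lra.
Qed.

(** The least m with m phi > pi / 2.  Then (m - 1) phi <= pi / 2, so that
    m p <= 1 by the hypothesis and, when m > 1, m phi <= pi. *)
Lemma sector_power (p phi : R) : 0 < p -> 0 < phi <= pi -> 1 <= p^-1 - pi / (2 * phi) ->
  exists m, [/\ (0 < m)%N, m%:R * p <= 1 & cos (m%:R * phi) < 0].
Proof.
move=> p0 /andP[f0 fpi] h; have pi0 := pi_gt0 R.
have ex : exists m, pi / 2 < m%:R * phi.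
  exists (Num.bound (pi / 2 / phi)).
  rewrite -ltr_pdivrMr//; apply: archi_boundP.
  by rewrite !divr_ge0 ?ltW.
case: (ex_minnP ex) => m hm minm.
have m0 : (0 < m)%N by case: m hm {minm} => //; rewrite mul0r; lra.
have hm1 : (m%:R - 1) * phi <= pi / 2.
  rewrite leNgt; apply/negP => h1; have := minm m.-1.
  have -> : m.-1%:R = m%:R - 1 :> R by rewrite -subn1 natrB.
  by move=> /(_ h1); rewrite leqNgt prednK // leqnn.
exists m; split => //.
  rewrite -ler_pdivlMr// mul1r.
  have : m%:R - 1 <= pi / (2 * phi) by rewrite invfM mulrA ler_pdivlMr.
  lra.
apply: cos_lt0; rewrite hm /=.
have [m1|m1] := leqP m 1.
  have -> : m = 1%N by apply/eqP; rewrite eqn_leq m1 m0.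
  by rewrite mul1r.
have m2 : 2 <= m%:R :> R by rewrite ler_nat.
have : phi <= pi / 2 by apply: le_trans hm1; rewrite ler_peMl ?(ltW f0)//; lra.
lra.
Qed.

(** Induction on the number k of halvings.  The sign e and the angle phi > 0 are
    kept apart because the argument of -mu is that of mu shifted by pi towards 0,
    with absolute value pi - phi / 2 >= phi / 2. *)
Lemma stable_coef_angle k p (phi e rho : R) : 0 < rho -> (e = 1 \/ e = -1) -> 0 < p <= 1 -> 0 < phi <= pi ->
  1 <= 2 ^+ k * (p^-1 - pi / (2 * phi)) -> stable_coef p (polar rho (e * phi)).
Proof.
have pi0 := pi_gt0 R.
elim: k p phi e rho => [|k IHk] p phi e rho rho0 he pp fpi hk; have /andP[p0 p1] := pp;
    have /andP[f0 f1] := fpi.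
  move: hk; rewrite expr0 mul1r => /(sector_power p0 fpi)[m [m0 mp cm]].
  apply: (stable_coef_power p0 m0 mp); rewrite polarX /= pmulr_rlt0 ?exprn_gt0//.
  by move: cm; rewrite mulrCA; case: he => ->; rewrite ?mul1r ?mulN1r ?cosN.
pose q := p / 2.
have qE : q + q = p by rewrite /q -splitr.
have q0 : 0 < q by rewrite divr_gt0.
have qq : 0 < q <= 1 by rewrite q0 /=; lra.
have b0 := beta_gt0 qq qq.
pose s := Num.sqrt (rho / beta q q).
have s0 : 0 < s by rewrite sqrtr_gt0 divr_gt0.
pose mu := polar s (e * (phi / 2)).
have mu0 : mu != 0.
  rewrite eq_complex /= !mulf_eq0 (gt_eqF s0) /=; apply/negP => /andP[/eqP c0 /eqP s1].
  by have := cos2Dsin2 (e * (phi / 2)); rewrite c0 s1 expr0n /= addr0 => /eqP; rewrite eq_sym oner_eq0.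
have -> : polar rho (e * phi) = (beta q q)%:C%C * (mu * mu).
  rewrite polarM -expr2 sqr_sqrtr; last by rewrite divr_ge0// ltW.
  rewrite -mulrDr -splitr.
  by apply: complex_ext; rewrite ?cReM ?cImM /= ?mul0r ?oppr0 ?mul0r ?addr0 ?add0r mulrA mulrCA divff ?mulr1// gt_eqF.
rewrite -qE; apply: stable_coef_double => //; first by rewrite qE.
  apply: IHk => //; first by apply/andP; split; lra.
  move: hk; rewrite exprSr -mulrA; congr (_ <= _ * _).
  by rewrite /q; field; rewrite !gt_eqF.
(* the other square root, whose argument has absolute value pi - phi / 2 *)
have -> : - mu = polar s (- e * (pi - phi / 2)).
  by apply: complex_ext; rewrite /= mulNr -mulrN opprB mulrBr ?cosB ?sinB;
    case: he => ->; rewrite ?mulN1r ?mul1r ?cosN ?sinN cospi sinpi; ring.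
apply: IHk => //.
- by case: he => ->; [right|left; rewrite opprK].
- by apply/andP; split; lra.
apply: (le_trans hk); rewrite exprSr -mulrA ler_wpM2l ?exprn_ge0//.
have -> : 2 * (p^-1 - pi / (2 * phi)) = q^-1 - pi / phi by rewrite /q; field; rewrite !gt_eqF.
rewrite lerD2l lerN2 ler_wpM2l ?(ltW pi0)// lef_pV2 ?posrE; lra.
Qed.

Lemma polar_carg z : z != 0 -> - pi < carg z <= pi /\
  exists2 r : R, 0 < r & z = polar r (carg z).
Proof.
move=> z0; rewrite /carg.
set S := [set theta | _]; suff : S !=set0 by move=> [x Sx]; have := @getPex _ S (ex_intro _ x Sx).
have pi0 := pi_gt0 R.
pose n := normc z.
have n0 : 0 < n.
  by rewrite lt_neqAle normc_ge0 eq_sym andbT; apply: contraNN z0 => /eqP /eq0_normc ->.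
have n2 : Re z ^+ 2 + Im z ^+ 2 = n ^+ 2.
  by rewrite /n normc_sqrt sqr_sqrtr ?addr_ge0 ?sqr_ge0.
pose x := Re z / n.
have xn : x ^+ 2 + (Im z / n) ^+ 2 = 1.
  by rewrite /x !expr_div_n -mulrDl n2 divff// expf_neq0// gt_eqF.
have x2 : x ^+ 2 <= 1 by rewrite -xn lerDl sqr_ge0.
have x1 : -1 <= x <= 1 by apply/andP; move: x2; rewrite expr2; clearbody x; split; nra.
have sx : sin (acos x) = `|Im z / n|.
  by rewrite sin_acos// -xn addrAC subrr add0r sqrtr_sqr.
have zx : Re z = n * x by rewrite /x mulrCA divff ?mulr1// gt_eqF.
have [i0|i0] := leP 0 (Im z).
  exists (acos x); split.
    by rewrite acos_lepi// andbT (lt_le_trans _ (acos_ge0 x1))// oppr_lt0.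
  exists n => //; apply: complex_ext; rewrite /= ?acosK// sx ger0_norm ?divr_ge0 ?(ltW n0)//.
  by rewrite mulrCA divff ?mulr1// gt_eqF.
have ix : 0 < `|Im z / n| by rewrite normr_gt0 mulf_neq0 ?invr_neq0 ?(gt_eqF n0) ?(lt_eqF i0).
exists (- acos x); split.
  rewrite ltrN2 lt_neqAle acos_lepi// andbT; apply/andP; split.
    by apply/negP => /eqP h; move: ix; rewrite -sx h sinpi ltxx.
  by rewrite lerNl (le_trans _ (acos_ge0 x1))// oppr_le0 ltW.
exists n => //; apply: complex_ext; rewrite /= ?cosN ?acosK// sinN sx.
rewrite ltr0_norm ?opprK; last by rewrite pmulr_llt0 ?invr_gt0.
by rewrite mulrCA divff ?mulr1// gt_eqF.
Qed.

(** The gap 1 / p - pi / (2 |arg z|) is positive, hence at least 2^(-k) for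
    some k. *)
Lemma stable_coef_sector p b z : 0 < p <= 1 -> 0 < b -> z != 0 -> p * pi / 2 < `|carg z| ->
  stable_coef p (b%:C%C * z).
Proof.
move=> pp b0 z0 hz; have pi0 := pi_gt0 R; have /andP[p0 p1] := pp.
have [/andP[c1 c2] [r r0 ->]] := polar_carg z0.
set a := carg z in hz c1 c2 *.
have a0 : 0 < `|a| by apply: le_lt_trans hz; rewrite !mulr_ge0 ?invr_ge0 ?ltW.
have ea : exists2 e : R, e = 1 \/ e = -1 & a = e * `|a|.
  have [h|h] := leP 0 a; first by exists 1; [left|rewrite mul1r ger0_norm].
  by exists (-1); [right|rewrite mulN1r ltr0_norm ?opprK].
have [e he ->] := ea.
have D0 : 0 < p^-1 - pi / (2 * `|a|).
  rewrite subr_gt0 ltr_pdivrMr ?mulr_gt0// ltr_pdivlMl//; lra.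
have [k hk] : exists k : nat, (p^-1 - pi / (2 * `|a|))^-1 <= 2 ^+ k.
  exists (Num.bound (p^-1 - pi / (2 * `|a|))^-1).
  apply: ltW; apply: (lt_le_trans (archi_boundP _)); first by rewrite invr_ge0 ltW.
  by rewrite -natrX ler_nat ltnW// ltn_expl.
have -> : b%:C%C * polar r (e * `|a|) = polar (b * r) (e * `|a|).
  by apply: complex_ext; rewrite ?cReM ?cImM /= ?oppr0 ?mul0r ?addr0 ?add0r mulrA.
apply: (@stable_coef_angle k) => //; first exact: mulr_gt0.
  by rewrite a0 ler_norml c2 (ltW c1).
by rewrite -ler_pdivrMr// div1r.
Qed.
End Angle.

(** * Linear systems *)

Section LinearSystem.
Import ComplexField.Normc.
Variable R : realType.
Local Notation C := R[i].
Local Notation Re := (@complex.Re R).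
Local Notation Im := (@complex.Im R).

Lemma triangular_form n (A : 'M[C]_n) : (0 < n)%N ->
  exists P T : 'M[C]_n, [/\ P \in unitmx, is_trig_mx T, P *m A = T *m P &
    forall i, eigenvalue A (T i i)].
Proof.
move=> n0; have [P /unitarymx_unit Pu] := Schur A n0.
set T := conjmx P A => hT.
have PA : P *m A = T *m P by rewrite /T conjumx// -!mulmxA mulVmx// mulmx1.
exists P, T; split=> // i.
have /eigenvalueP [v /eqP vT v0] : eigenvalue T (T i i).
  by rewrite eigenvalue_root_char char_poly_trig// /root horner_prod (bigD1 i)//= hornerXsubC subrr mul0r.
apply/eigenvalueP; exists (v *m P).
  by rewrite -mulmxA PA mulmxA (eqP vT) scalemxAl.
by apply: contra_neq v0 => vP; rewrite -[v](mulmxK Pu) vP mul0mx.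
Qed.

Lemma cconv_real p (x : R -> R) t : 0 < p <= 1 ->
  cconv (pker p) (fun s => (x s)%:C%C) t = (conv (pker p) x t)%:C%C.
Proof.
move=> pp; apply: complex_ext; rewrite ?Re_cconv ?Im_cconv//=.
have [t0|t0] := ltP 0 t; last by rewrite conv_le0.
by rewrite conv_pker_cst// mul0r.
Qed.

Lemma contC_real (x : R -> R) : continuous x -> contC (fun s => (x s)%:C%C).
Proof. by move=> cx; split=> // t; exact: cvg_cst. Qed.

Lemma mulmx_norm_ge0 n (A : 'M[R]_n) : 0 <= \sum_i \sum_j `|A i j|.
Proof. by apply: sumr_ge0 => i _; apply: sumr_ge0 => j _. Qed.

Lemma mulmx_norm_sub n (A : 'M[R]_n) (u v : 'cV[R]_n) :
  `|A *m u - A *m v| <= (\sum_i \sum_j `|A i j|) * `|u - v|.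
Proof.
rewrite -mulmxBr; set w := u - v.
apply: cV_norm_le => [|i]; first by rewrite mulr_ge0 ?mulmx_norm_ge0.
rewrite mxE (le_trans (ler_norm_sum _ _ _))//.
apply: (@le_trans _ _ ((\sum_j `|A i j|) * `|w|)).
  rewrite mulr_suml; apply: ler_sum => j _.
  by rewrite normrM ler_wpM2l// coord_norm_le.
rewrite ler_wpM2r// [leRHS](bigD1 i)//= lerDl sumr_ge0// => k _.
by apply: sumr_ge0 => j _.
Qed.

Variables (n : nat) (A : 'M[R]_n) (p b : R).
Hypotheses (n0 : (0 < n)%N) (pp : 0 < p <= 1) (b0 : 0 < b).
Hypothesis hA : forall z : R[i], eigenvalue (map_mx (real_complex R) A) z ->
  z != 0 /\ p * pi / 2 < `|carg z|.

Let toC (x : 'cV[R]_n) : 'cV[C]_n := map_mx (real_complex R) x.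

(** In the coordinates Z = P X the i-th equation has the coefficient b T_ii and
    is forced by H and by the coordinates before i, which are dominated by
    induction. *)
Lemma linear_dominated_pos : exists2 D : R, 0 <= D & forall X H : R -> 'cV[R]_n,
  continuous X -> continuous H ->
  (forall t, 0 < t -> X t = vconv p (fun s => b *: (A *m X s) + H s) t) ->
  dominated D (fun t => `|X t|) (fun t => `|H t|).
Proof.
have [P [T [Pu tT PA hT]]] := triangular_form (map_mx (real_complex R) A) n0.
have gT i : stable_coef p (b%:C%C * T i i).
  by have [z0 hz] := hA (hT i); exact: stable_coef_sector.
pose Z (X : R -> 'cV[R]_n) i t : C := \sum_j P i j * (X t j ord0)%:C%C.
have ZE X i t : Z X i t = (P *m toC (X t)) i ord0.
  by rewrite mxE; apply: eq_bigr => j _; rewrite mxE.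
have cZ X i : continuous X -> contC (Z X i).
  by move=> cX; apply: contC_sum => j; apply: contC_real; exact: continuous_coord.
have Zle X i t : normc (Z X i t) <= (\sum_j normc (P i j)) * `|X t|.
  rewrite (le_trans (normc_sum _ _))// mulr_suml; apply: ler_sum => j _.
  rewrite normcM ler_wpM2l ?normc_ge0//.
  by rewrite normc_sqrt /= expr0n addr0 sqrtr_sqr coord_norm_le.
have key (m : nat) : forall i : 'I_n, (i < m)%N -> exists2 D : R, 0 <= D & forall X H : R -> 'cV[R]_n,
    continuous X -> continuous H ->
    (forall t, 0 < t -> X t = vconv p (fun s => b *: (A *m X s) + H s) t) ->
    dominated D (fun t => normc (Z X i t)) (fun t => `|H t|).
  elim: m => // m IHm i im.
  have /choice [D hD] : forall j : 'I_n, exists D : R, 0 <= D /\ ((j < i)%N -> forall X H : R -> 'cV[R]_n,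
      continuous X -> continuous H ->
      (forall t, 0 < t -> X t = vconv p (fun s => b *: (A *m X s) + H s) t) ->
      dominated D (fun t => normc (Z X j t)) (fun t => `|H t|)).
    move=> j; have [ji|ji] := ltnP j i; last by exists 0.
    have [|D D0 hD] := IHm j; first by apply: leq_trans ji _.
    by exists D.
  have [G G0 hG] := gT i.
  (* the coordinates that T couples to the i-th one, besides itself *)
  pose r := [seq j : 'I_n <- index_enum 'I_n | (j < i)%N].
  pose E := \sum_(j <- r) normc (b%:C%C * T i j) * D j + (\sum_j normc (P i j)) * 1.
  have E0 : 0 <= E.
    rewrite addr_ge0// ?mulr1; last by apply: sumr_ge0 => j _; exact: normc_ge0.
    by apply: sumr_ge0 => j _; rewrite mulr_ge0 ?normc_ge0//; case: (hD j).
  exists (G * E); first exact: mulr_ge0.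
  move=> X H cX cH hX.
  pose F s := \sum_(j <- r) (b%:C%C * T i j) * Z X j s + Z H i s.
  have cF : contC F by apply: contCD; [apply: contC_sum => j; exact: cZ|exact: cZ].
  apply: (dominated_trans G0 E0 (hG (Z X i) F (cZ _ _ cX) cF _)).
    move=> t t0.
    pose W s : 'cV[R]_n := b *: (A *m X s) + H s.
    have cW : continuous W.
      have cAX := continuous_lip (mulmx_norm_ge0 A) (fun u v => mulmx_norm_sub A u v) cX.
      by move=> s; apply: cvgD; [apply: cvgZr; exact: cAX|exact: cH].
    have -> : Z X i t = cconv (pker p) (Z W i) t.
      rewrite (cconv_sum _ _ _ (wsing_pker pp (lexx _))); last first.
        by move=> j; apply: contC_real; exact: continuous_coord.
      by apply: eq_bigr => j _; rewrite cconv_real// hX// mxE.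
    apply: eq_cconv => s _.
    have toCW : toC (W s) = b%:C%C *: (map_mx (real_complex R) A *m toC (X s)) + toC (H s).
      by rewrite /toC map_mxD map_mxZ map_mxM.
    rewrite /F ZE toCW mulmxDr -scalemxAr mulmxA PA -mulmxA mxE -ZE addrA; congr (_ + _).
    rewrite mxE [in LHS]mxE mulr_sumr (bigID (fun j : 'I_n => (j < i)%N)) /= addrC.
    rewrite [in RHS]big_filter; congr (_ + _); last first.
      by apply: eq_bigr => j _; rewrite ZE mulrA.
    rewrite (bigD1 i) ?ltnn//= big1 ?addr0 -?ZE ?mulrA// => j /andP[ij ji].
    have /is_trig_mxP hT' := tT.
    have lij : (i < j)%N by rewrite ltn_neqAle leqNgt ij andbT eq_sym.
    by rewrite hT'// mul0r mulr0.
  apply: (@dominated_add _ _ _ _ (fun s => normc (\sum_(j <- r) (b%:C%C * T i j) * Z X j s)) (fun s => normc (Z H i s))).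
  - by move=> t _; exact: le_normcD.
  - rewrite -[X in dominated X]mul1r; apply: (@dominated_le _ 1 _ _ (fun s => \sum_(j <- r) normc ((b%:C%C * T i j) * Z X j s))) => //.
      by move=> t _; rewrite mul1r; exact: normc_sum.
    apply: dominated_sum => j; rewrite mem_filter => /andP[ji _].
    have [Dj0 hDj] := hD j.
    by apply: dominated_normcZ => //; exact: hDj.
  - apply: dominated_le (dominated_refl _) => [|t _]; last exact: Zle.
    by apply: sumr_ge0 => j _; exact: normc_ge0.
have /choice [D hD] : forall i : 'I_n, exists D : R, 0 <= D /\ forall X H : R -> 'cV[R]_n,
    continuous X -> continuous H ->
    (forall t, 0 < t -> X t = vconv p (fun s => b *: (A *m X s) + H s) t) ->
    dominated D (fun t => normc (Z X i t)) (fun t => `|H t|).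
  by move=> i; have [D D0 hD] := key n i (ltn_ord i); exists D.
pose Q := invmx P.
exists (\sum_j \sum_i normc (Q j i) * D i).
  by apply: sumr_ge0 => j _; apply: sumr_ge0 => i _; rewrite mulr_ge0 ?normc_ge0//; case: (hD i).
move=> X H cX cH hX.
rewrite -[X in dominated X]mul1r.
apply: (@dominated_le _ 1 _ _ (fun s => \sum_j \sum_i normc (Q j i * Z X i s))) => //.
  move=> t _; rewrite mul1r.
  have nn (j : 'I_n) : 0 <= \sum_i normc (Q j i * Z X i t) by apply: sumr_ge0 => i _; exact: normc_ge0.
  apply: cV_norm_le => [|j]; first by apply: sumr_ge0 => j _.
  rewrite (bigD1 j)//= ler_wpDr//; first by apply: sumr_ge0 => i _.
  have -> : `|X t j ord0| = normc (X t j ord0)%:C%C by rewrite normc_sqrt /= expr0n addr0 sqrtr_sqr.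
  have -> : (X t j ord0)%:C%C = \sum_i Q j i * Z X i t.
    transitivity ((Q *m (P *m toC (X t))) j ord0); first by rewrite mulKmx// mxE.
    by rewrite mxE; apply: eq_bigr => i _; rewrite ZE.
  exact: normc_sum.
apply: dominated_sum => j _; apply: dominated_sum => i _; apply: dominated_normcZ; first by case: (hD i).
exact: (hD i).2.
Qed.
End LinearSystem.

(** * Positivity of the Gamma function *)

Section GammaPositive.
Variable R : realType.
Local Notation mu := (@lebesgue_measure R).

Lemma integrable_Gamma (a : R) : 0 < a <= 1 ->
  mu.-integrable `]0, +oo[ (fun t => (t `^ (a - 1) * expR (- t))%:E).
Proof.
move=> aa; have /andP[a0 a1] := aa.
have i1 : mu.-integrable setT (EFin \o ((pker a) \_ `]0, 1[%classic)).
  have := @integrable_mkcond _ _ _ mu `]0, 1[%classic (EFin \o pker a) (measurable_itv _).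
  by rewrite restrict_EFin => h; apply/h; exact: integrable_pker.
have i2 := @integrable_exponential_pdf R 1 ltr01.
have i12 : mu.-integrable `]0, +oo[ (fun t => (((pker a) \_ `]0, 1[%classic) t)%:E + (exponential_pdf 1 t)%:E)%E.
  have := @integrableD _ _ _ mu setT measurableT _ _ i1 i2.
  by apply: integrableS.
apply: (le_integrable _ _ _ i12) => //.
  apply/measurable_EFinP; apply: measurable_funM.
    by apply: measurable_funS (@measurable_pker R a).
  by apply: measurableT_comp => //; apply: measurableT_comp.
move=> t; rewrite /= in_itv /= andbT => t0.
rewrite !ger0_norm ?mulr_ge0 ?powR_ge0 ?expR_ge0//; last first.
  by rewrite addr_ge0 ?exponential_pdf_ge0// patchE; case: ifP => // _; exact: pker_ge0.
have [t1|t1] := ltP t 1.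
  rewrite lee_fin patchE ifT; last by rewrite inE /= in_itv /= t0.
  rewrite (@le_trans _ _ (pker a t))// ?lerDl ?exponential_pdf_ge0//.
  by rewrite /pker ler_piMr ?powR_ge0// -expR0 ler_expR oppr_le0 ltW.
rewrite lee_fin (@le_trans _ _ (exponential_pdf 1 t))//; last first.
  by rewrite lerDr patchE; case: ifP => // _; exact: pker_ge0.
rewrite exponential_pdfE ?(ltW t0)// mul1r mulN1r.
rewrite ler_piMl ?expR_ge0//.
have := pker_nonincr a1 ltr01 t1; by rewrite {2}/pker powR1.
Qed.

(** Finiteness of the integral matters too, since [fine] sends +oo to 0. *)
Lemma Gamma_gt0 (a : R) : 0 < a <= 1 -> 0 < Gamma a.
Proof.
move=> aa; have /andP[a0 a1] := aa.
have ig := integrable_Gamma aa.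
rewrite /Gamma /Rintegral fine_gt0// (integrable_lty _ ig)// andbT.
apply: (@lt_le_trans _ _ (expR (-1))%:E); first by rewrite lte_fin expR_gt0.
have [mf _] := integrableP _ _ _ ig.
have f0 t : (0 <= (t `^ (a - 1) * expR (- t))%:E)%E.
  by rewrite lee_fin mulr_ge0 ?powR_ge0 ?expR_ge0.
have s01 : (`]0%R, 1%R[%classic : set R) `<=` `]0%R, +oo[%classic.
  by move=> x; rewrite /= !in_itv /= andbT => /andP[].
apply: (@le_trans _ _ (\int[mu]_(t in `]0%R, 1%R[) (t `^ (a - 1) * expR (- t))%:E)%E); last first.
  by apply: ge0_subset_integral.
apply: (@le_trans _ _ (\int[mu]_(t in `]0%R, 1%R[) (expR (-1))%:E)%E).
  by rewrite integral_cst//= lebesgue_measure_itv /= lte_fin ltr01 oppr0 adde0 mule1.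
apply: ge0_le_integral => //.
  by apply: measurable_funS mf.
move=> t; rewrite /= in_itv /= => /andP[t0 t1].
rewrite lee_fin -[leLHS]mul1r ler_pM//.
  by have := pker_nonincr a1 t0 (ltW t1); rewrite {1}/pker powR1.
by rewrite ler_expR lerN2 ltW.
Qed.
End GammaPositive.

(** * The nonlinear equation *)

Section Nonlinear.
Variable R : realType.
Local Notation mu := (@lebesgue_measure R).

Lemma linear_dominated n (A : 'M[R]_n) (p b : R) : 0 < p <= 1 -> 0 < b ->
  (forall z : R[i], eigenvalue (map_mx (real_complex R) A) z -> z != 0 /\ p * pi / 2 < `|carg z|) ->
  exists2 D : R, 0 <= D & forall X H : R -> 'cV[R]_n, continuous X -> continuous H ->
    (forall t, 0 < t -> X t = vconv p (fun s => b *: (A *m X s) + H s) t) ->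
    dominated D (fun t => `|X t|) (fun t => `|H t|).
Proof.
move=> pp b0 hA; have [n0|n0] := posnP n; last exact: linear_dominated_pos.
subst n; exists 0 => // X H _ _ _.
have X0 t : `|X t| = 0 by rewrite [X t]flatmx0 normr0.
split=> [T M _ _ t _|M e _ _ _ _ eps eps0]; first by rewrite X0 mul0r.
by exists 0 => t _; rewrite X0 mul0r add0r ltW.
Qed.

Section Clamp.
Variables (n : nat) (r : R).
Hypothesis r0 : 0 <= r.

(** The Euclidean projection onto the cube of radius r, one coordinate at a time;
    unlike the radial projection it is 1-Lipschitz for the max norm. *)
Definition clamp (v : 'cV[R]_n) : 'cV[R]_n := \col_i Num.max (- r) (Num.min r (v i ord0)).

Lemma clamp_lip u v : `|clamp u - clamp v| <= `|u - v|.
Proof.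
apply: cV_norm_le => // i; rewrite !mxE.
have := coord_norm_le (u - v) i; rewrite !mxE; apply: le_trans.
move: (u i ord0) (v i ord0) => a b.
have h1 := ler_norm (a - b); have h2 : b - a <= `|a - b| by rewrite distrC ler_norm.
have h0 : 0 <= `|a - b| by [].
rewrite ler_norml; move: h0 h1 h2; move: `|a - b| => w.
by have [h1|h1] := leP r a; have [h2|h2] := leP r b; have [h3|h3] := leP (- r) r;
  have [h4|h4] := leP (- r) a; have [h5|h5] := leP (- r) b; lra.
Qed.

Lemma norm_clamp v : `|clamp v| <= r.
Proof.
apply: cV_norm_le => // i; rewrite !mxE ler_norml le_max lexx ge_max ge_min lexx andbT /=.
by rewrite (le_trans _ r0)// oppr_le0.
Qed.

Lemma clamp_id v : `|v| <= r -> clamp v = v.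
Proof.
move=> vr; apply/matrixP => i j; rewrite ord1 mxE.
have /(le_trans) /(_ vr) := coord_norm_le v i; rewrite ler_norml => /andP[h1 h2].
by rewrite min_r// max_r.
Qed.
End Clamp.

Lemma lip_small n (f : 'cV[R]_n -> 'cV[R]_n) (q : R) : 0 < q ->
  lip_const f r @[r --> 0^'+] --> 0%E ->
  exists2 r : R, 0 < r & forall u v, `|u| <= r -> `|v| <= r -> `|f u - f v| <= q * `|u - v|.
Proof.
move=> q0 hfl.
have h : \forall r \near (0 : R)^'+, (lip_const f r < q%:E)%E.
  have hq : (0 < q%:E)%E by rewrite lte_fin.
  exact: (hfl _ (open_ereal_lt' hq)).
have [r [r0 hr]] : exists r : R, 0 < r /\ (lip_const f r < q%:E)%E.
  near (0 : R)^'+ => r; exists r; split; first by near: r; exact: nbhs_right_gt.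
  by near: r.
exists r => // u v ur vr; have [->|uv] := eqVneq u v; first by rewrite !subrr !normr0 mulr0.
have d0 : 0 < `|u - v| by rewrite normr_gt0 subr_eq0.
rewrite -ler_pdivrMr// -lee_fin; apply: le_trans (ltW hr).
by apply: ereal_sup_ubound; exists (u, v).
Unshelve. all: by end_near. Qed.

Lemma within_comp n (D : set R) (y : R -> 'cV[R]_n) (h : R -> R) : {within D, continuous y} ->
  continuous h -> (forall t, D (h t)) -> continuous (fun t => y (h t)).
Proof.
move=> /subspace_continuousP cy ch hD t U hU.
have := cy _ (hD t) U hU; rewrite /= => hn.
have hns : \forall s \near t, D (h s) -> U (y (h s)) := ch t _ hn.
by apply: filterS hns => s hs; apply: hs; exact: hD.
Qed.

(** The integral over [0, t] only involves the values of h inside ]0, t[, where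
    h may be replaced by a function continuous on the whole line. *)
Lemma caputo_vconv n (p b t : R) (h W : R -> 'cV[R]_n) : 0 < p <= 1 -> 0 <= t -> continuous W ->
  (forall s, 0 < s < t -> h s = W s) ->
  b *: \col_i \int[mu]_(tau in `[0, t]) ((t - tau) `^ (p - 1) * h tau i ord0) =
  vconv p (fun s => b *: W s) t.
Proof.
move=> pp t0 cW hW; apply/matrixP => i j; rewrite !mxE.
have wk := wsing_pker pp (lexx _).
have cWi := continuous_coord (i := i) cW.
have -> : (fun s => (b *: W s) i ord0) = (fun s => b * W s i ord0) by apply/funext => s; rewrite mxE.
rewrite (convZr _ _ wk (continuous_wsing pp cWi)); congr (_ * _).
have hWs s : s \in `]0%R, t[%classic -> (t - s) `^ (p - 1) * W s i ord0 = (t - s) `^ (p - 1) * h s i ord0.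
  by rewrite inE /= in_itv /= => /hW ->.
transitivity (\int[mu]_(tau in `]0, t[) ((t - tau) `^ (p - 1) * h tau i ord0)).
  rewrite /Rintegral -(integral_itv_bndoo true false)//.
  apply/measurable_EFinP; apply: (eq_measurable_fun _ hWs).
  apply: measurable_funS (measurableT) _ _ => //.
  apply: measurable_funM; last exact: continuous_measurable.
  by apply: (measurableT_comp (@measurable_pker R p)); apply: measurable_funB.
by apply: eq_Rintegral => s /hWs.
Qed.

(** Used for the first time at which a solution leaves the cube. *)
Lemma first_hit (u : R -> R) (r t1 : R) : continuous u -> 0 <= t1 -> r <= u t1 ->
  exists t, [/\ 0 <= t <= t1, r <= u t & forall s, 0 <= s < t -> u s < r].
Proof.
move=> cu t10 ru.
pose S := [set t | 0 <= t <= t1 /\ r <= u t].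
have St1 : S t1 by split; rewrite ?t10 ?lexx.
have hS : has_inf S by split; [exists t1|exists 0 => s [/andP[]]].
have i0 : 0 <= inf S by apply: lb_le_inf => [|s [/andP[]]//]; exists t1.
have i1 : inf S <= t1 by apply: ge_inf => //; case: hS.
exists (inf S); split; first by rewrite i0.
  rewrite leNgt; apply/negP => ui.
  have d0 : 0 < r - u (inf S) by rewrite subr_gt0.
  have /cvgrPdist_lt /(_ _ d0) [e e0 he] := cu (inf S).
  have [s Ss hs] := inf_adherent e0 hS.
  have t0s : inf S <= s by apply: ge_inf => //; case: hS.
  have := he s; rewrite /ball_/= distrC ger0_norm ?subr_ge0// ltrBlDl => /(_ hs).
  case: Ss => _ rs; rewrite distrC => /(le_lt_trans (ler_norm _)).
  by rewrite ltrD2r ltNge rs.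
move=> s /andP[s0 si]; rewrite ltNge; apply/negP => rs; have st1 := ltW (lt_le_trans si i1).
move: si; rewrite ltNge => /negP; apply; apply: ge_inf; first by case: hS.
by split=> //; rewrite s0.
Qed.

Section Equation.
Variables (n : nat) (p : R) (A : 'M[R]_n) (f : 'cV[R]_n -> 'cV[R]_n).
Hypotheses (p01 : 0 < p < 1) (f0 : f 0 = 0).
Hypothesis hA : forall z : R[i], eigenvalue (map_mx (real_complex R) A) z ->
  z != 0 /\ p * pi / 2 < `|carg z|.

Let b := (Gamma p)^-1.
Let pp : 0 < p <= 1. Proof. by case/andP: p01 => -> /ltW ->. Qed.
Let b0 : 0 < b. Proof. by rewrite invr_gt0 Gamma_gt0. Qed.
Let L := \sum_i \sum_j `|A i j|.
Let L0 : 0 <= L. Proof. exact: mulmx_norm_ge0. Qed.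
Let AL (v : 'cV[R]_n) : `|A *m v| <= L * `|v|.
Proof. by have := mulmx_norm_sub A v 0; rewrite mulmx0 !subr0. Qed.

Section Truncated.
Variables (q r : R).
Hypotheses (q0 : 0 < q) (r0 : 0 < r).
Hypothesis fq : forall u v, `|u| <= r -> `|v| <= r -> `|f u - f v| <= q * `|u - v|.

Let F v := f (clamp r v).
Let W v : 'cV[R]_n := A *m v + F v.
Let G v : 'cV[R]_n := b *: W v.

Let Flip u v : `|F u - F v| <= q * `|u - v|.
Proof.
rewrite (le_trans (fq (norm_clamp (ltW r0) u) (norm_clamp (ltW r0) v)))//.
by rewrite ler_wpM2l ?(ltW q0)// clamp_lip// ltW.
Qed.

Let F_le v : `|F v| <= q * `|v|.
Proof.
have := Flip v 0; rewrite {2}/F clamp_id ?normr0 ?(ltW r0)// f0 !subr0; exact.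
Qed.

Let Wlip u v : `|W u - W v| <= (L + q) * `|u - v|.
Proof.
rewrite /W opprD addrACA (le_trans (ler_normD _ _))// mulrDl lerD//.
exact: mulmx_norm_sub.
Qed.

Let Glip u v : `|G u - G v| <= b * (L + q) * `|u - v|.
Proof.
by rewrite /G -scalerBr normrZ (gtr0_norm b0) -mulrA ler_wpM2l ?(ltW b0).
Qed.

Let bLq0 : 0 <= b * (L + q).
Proof. by rewrite mulr_ge0 ?addr_ge0 ?(ltW b0) ?(ltW q0). Qed.

Let cW (x : R -> 'cV[R]_n) : continuous x -> continuous (fun t => W (x t)).
Proof. exact: (continuous_lip (addr_ge0 L0 (ltW q0)) Wlip). Qed.

Lemma truncated_solution (x0 : 'cV[R]_n) : exists2 x : R -> 'cV[R]_n, continuous x &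
  forall t, x t = x0 + vconv p (fun s => G (x s)) t.
Proof.
have [|x cx hx] := @volterra_exists _ _ p pp G _ bLq0 Glip (fun=> x0); first by move=> t; exact: cvg_cst.
by exists x.
Qed.

(** A solution y agrees with x as long as |y| < r.  At the first time with
    |y| >= r it would still agree with x, because the equation at time t only
    involves earlier values, whereas |x| < r. *)
Lemma truncated_maximal (x0 : 'cV[R]_n) (x : R -> 'cV[R]_n) : continuous x ->
  (forall t, x t = x0 + vconv p (fun s => G (x s)) t) -> (forall t, `|x t| < r) ->
  maximal_solution p (fun v => A *m v + f v) x0 +oo x.
Proof.
move=> cx hx xr.
have Fx t : F (x t) = f (x t) by rewrite /F clamp_id// ltW.
split.
  split=> //; first exact: continuous_subspaceT.
  move=> t [t0 _]; rewrite hx; congr (_ + _).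
  by rewrite (@caputo_vconv _ _ _ _ _ (fun s => W (x s)) pp t0 (cW cx))// => s _; rewrite /W Fx.
move=> S y [S0 cy hy]; split; first exact: leey.
have x00 : x 0 = x0 by rewrite hx vconv_le0 ?addr0.
have y0 : y 0 = x0.
  rewrite hy; last by split.
  rewrite (@caputo_vconv _ _ _ _ _ (fun s => W (x s)) pp (lexx _) (cW cx)) ?vconv_le0 ?addr0//.
  by move=> s /andP[s0 s1]; have := lt_trans s0 s1; rewrite ltxx.
move=> t1 [t10 t1S].
have [->|t1n] := eqVneq t1 0; first by rewrite y0 x00.
have t1p : 0 < t1 by rewrite lt_neqAle eq_sym t1n.
(* y frozen outside [0, t1], to have a function continuous on the line *)
pose y' t := y (Num.max 0 (Num.min t1 t)).
have y'E t : 0 <= t <= t1 -> y' t = y t.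
  by move=> /andP[h0 h1]; rewrite /y' min_r// max_r.
have cy' : continuous y'.
  apply: (within_comp cy).
    move=> t; apply: continuous_max; first exact: cvg_cst.
    by apply: continuous_min; [exact: cvg_cst|exact: cvg_id].
  move=> t; split; first by rewrite le_max lexx.
  apply: le_lt_trans t1S; rewrite lee_fin ge_max t10 /=.
  by rewrite ge_min lexx.
have upto t : 0 <= t <= t1 -> (forall s, 0 <= s < t -> `|y' s| < r) -> y' t = x t.
  move=> /andP[t_0 tt1] hr.
  have [->|tn] := eqVneq t 0; first by rewrite y'E ?lexx ?y0 ?x00.
  have tp : 0 < t by rewrite lt_neqAle eq_sym tn.
  apply: (@volterra_unique _ _ p pp G _ bLq0 Glip (fun=> x0) y' x t cy' cx) => //; last by rewrite tp lexx.
  move=> s /andP[s0 st]; have st1 := le_trans st tt1.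
  rewrite y'E ?(ltW s0)// hy; last by split; [exact: ltW|apply: le_lt_trans t1S; rewrite lee_fin].
  congr (_ + _); apply: (@caputo_vconv _ _ _ _ _ (fun s => W (y' s)) pp (ltW s0) (cW cy')) => u /andP[u0 us].
  have ut : u < t by exact: lt_le_trans st.
  rewrite -y'E ?(ltW u0) ?(ltW (lt_le_trans ut _))//.
  by rewrite /W /F clamp_id// ltW// hr// (ltW u0).
have cn := continuous_norm cy'.
have yr s : 0 <= s <= t1 -> `|y' s| < r.
  move=> /andP[s0 s1]; rewrite ltNge; apply/negP => rs.
  have [t [/andP[t_0 ts] rt ht]] := first_hit cn s0 rs.
  by move: rt; rewrite (upto t) ?t_0 ?(le_trans ts)// leNgt xr.
rewrite -y'E ?t10 ?lexx// upto ?t10 ?lexx// => s /andP[s0 s1].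
by apply: yr; rewrite s0 ltW.
Qed.

Variable D : R.
Hypotheses (D0 : 0 <= D) (Dq : D * (b * q) < 1).
Hypothesis hD : forall X H : R -> 'cV[R]_n, continuous X -> continuous H ->
  (forall t, 0 < t -> X t = vconv p (fun s => b *: (A *m X s) + H s) t) ->
  dominated D (fun t => `|X t|) (fun t => `|H t|).

(** Subtracting R x0 removes the initial value: z = x - R x0 solves the linear
    equation with zero initial value and the forcing
    H = R x0 + b A (R x0) + b F(x), where F is f after truncation. *)
Lemma truncated_decay : exists2 K : R, 0 < K & forall (x0 : 'cV[R]_n) (x : R -> 'cV[R]_n), continuous x ->
  (forall t, x t = x0 + vconv p (fun s => G (x s)) t) ->
  (forall t, `|x t| <= K * `|x0|) /\ x t @[t --> +oo] --> (0 : 'cV[R]_n).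
Proof.
have [|rr [wr cr hr]] := @resolvent_exists _ p 1 p pp.
  by case/andP: pp => _ p1; rewrite lexx /=; lra.
have p0 : 0 < p by case/andP: pp.
pose Rt := rtail 1 rr.
have Rt0 t : 0 <= Rt t := rtail_ge0 pp ltr01 wr cr hr t.
have Rt1 t : Rt t <= 1 := rtail_le1 pp ltr01 wr cr hr t.
have cRt : continuous Rt := continuous_rtail pp ltr01 wr cr hr.
have RtE t : Rt t = 1 - conv (pker p) Rt t by rewrite {1}/Rt (rtailE pp wr hr) mul1r.
have wk := wsing_pker pp (lexx _).
pose K0 := b * L + 1 + b * q.
have bL : 0 <= b * L by rewrite mulr_ge0 ?(ltW b0).
have bq : 0 <= b * q by rewrite mulr_ge0 ?(ltW b0) ?(ltW q0).
have K01 : 1 <= K0 by rewrite /K0; lra.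
pose D' := D / (1 - D * (b * q)).
have D'0 : 0 <= D' by rewrite divr_ge0// subr_ge0 ltW.
have DK : 0 <= D' * K0 by rewrite mulr_ge0//; lra.
exists (D' * K0 + 1) => [|x0 x cx hx]; first by lra.
pose z s := x s - Rt s *: x0.
pose H s := b *: (A *m (Rt s *: x0)) + Rt s *: x0 + b *: F (x s).
have cRx : continuous (fun s => Rt s *: x0) by move=> s; apply: cvgZr_tmp; exact: cRt.
have cz : continuous z by exact: continuous_sub.
have cF : continuous (fun s => F (x s)) := continuous_lip (ltW q0) Flip cx.
have cH : continuous H.
  have cA := continuous_lip L0 (fun u v => mulmx_norm_sub A u v) cRx.
  move=> s; apply: cvgD; last by apply: cvgZr; exact: cF.
  by apply: cvgD; [apply: cvgZr; exact: cA|exact: cRx].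
have vRx t : vconv p (fun s => Rt s *: x0) t = conv (pker p) Rt t *: x0.
  apply/matrixP => i j; rewrite !mxE (ord1 j) mulrC -(convZr _ _ wk (continuous_wsing pp cRt)).
  by apply: eq_conv => // s _; rewrite mxE mulrC.
have hz t : 0 < t -> z t = vconv p (fun s => b *: (A *m z s) + H s) t.
  move=> t0.
  have -> : (fun s => b *: (A *m z s) + H s) = (fun s => G (x s) + Rt s *: x0).
    apply/funext => s; rewrite /H /z /G /W mulmxBr scalerBr scalerDr.
    move: (Rt s *: x0) (b *: (A *m (Rt s *: x0))) (b *: (A *m x s)) (b *: F _) => w v u y.
    by rewrite 2!addrA subrK addrAC.
  have cG : continuous (fun s => G (x s)) := continuous_lip bLq0 Glip cx.
  have cGR : continuous (fun s => G (x s) + Rt s *: x0).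
    by move=> s; apply: cvgD; [exact: cG|exact: cRx].
  have := vconvB t pp cGR cRx.
  have -> : (fun s => G (x s) + Rt s *: x0 - Rt s *: x0) = (fun s => G (x s)).
    by apply/funext => s; rewrite addrK.
  move/eqP; rewrite subr_eq => /eqP ->.
  by rewrite vRx /z {1}hx RtE scalerBl scale1r opprB addrC addrA subrK addrC.
have Hle s : 0 < s -> `|H s| <= K0 * (Rt s * `|x0|) + b * q * `|z s|.
  move=> _; have nR : `|Rt s *: x0| = Rt s * `|x0| by rewrite normrZ ger0_norm.
  have xz : `|x s| <= `|z s| + Rt s * `|x0|.
    by rewrite -nR (le_trans _ (ler_normD _ _))// /z subrK.
  have e1 : `|b *: (A *m (Rt s *: x0))| <= b * L * (Rt s * `|x0|).
    by rewrite normrZ (gtr0_norm b0) -mulrA ler_wpM2l ?(ltW b0)// -nR AL.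
  have e2 : `|b *: F (x s)| <= b * q * (`|z s| + Rt s * `|x0|).
    rewrite normrZ (gtr0_norm b0) -mulrA ler_wpM2l ?(ltW b0)// (le_trans (F_le _))//.
    by rewrite ler_wpM2l ?(ltW q0).
  rewrite /H (le_trans (ler_normD _ _))// (le_trans (lerD (ler_normD _ _) (lexx _)))// nR.
  move: e1 e2; rewrite /K0 mulrDr; lra.
have d : dominated D' (fun t => `|z t|) (fun t => K0 * (Rt t * `|x0|)).
  apply: (dominated_absorb D0 bq Dq _ _ Hle (hD cz cH hz)) => //.
  by apply: continuous_lbounded; exact: continuous_norm.
have hb t : 0 < t -> K0 * (Rt t * `|x0|) <= K0 * `|x0|.
  by move=> t0; rewrite ler_wpM2l ?(le_trans ler01 K01)// ler_piMl.
have M0 : 0 <= K0 * `|x0| by rewrite mulr_ge0// (le_trans ler01 K01).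
have zb := dominated_bounded d M0 hb.
have xz t : `|x t| <= `|z t| + Rt t * `|x0|.
  have nR : `|Rt t *: x0| = Rt t * `|x0| by rewrite normrZ ger0_norm.
  by rewrite -nR (le_trans _ (ler_normD _ _))// /z subrK.
split.
  move=> t; have [t0|t0] := ltP 0 t.
    apply: (le_trans (xz t)); rewrite [leRHS]mulrDl mul1r -[D' * K0 * _]mulrA.
    by apply: lerD; [exact: zb|rewrite ler_piMl].
  by rewrite hx vconv_le0// addr0 ler_peMl//; lra.
apply/cvgrPdist_le => e e0.
pose be := e / (4 * (D' + 1)).
have be0 : 0 < be by rewrite divr_gt0// mulr_gt0//; lra.
have be1 : D' * be <= e / 4.
  rewrite /be mulrCA ler_wpM2l ?(ltW e0)// ler_pdivrMr ?mulr_gt0//; lra.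
have be2 : be <= e / 4.
  by rewrite /be ler_wpM2l ?(ltW e0)// lef_pV2 ?posrE ?mulr_gt0//; lra.
have [T [T0 hT]] : exists T : R, 0 < T /\ forall t, T < t -> K0 * (Rt t * `|x0|) <= be.
  pose T := (p * (K0 * `|x0| + 1) / be) `^ p^-1.
  have c0 : 0 < p * (K0 * `|x0| + 1) / be by rewrite divr_gt0// mulr_gt0//; lra.
  exists T; split; first by rewrite powR_gt0.
  move=> t Tt; have t0 : 0 < t by apply: lt_trans Tt; rewrite powR_gt0.
  have tp : p * (K0 * `|x0| + 1) / be <= t `^ p.
    have -> : p * (K0 * `|x0| + 1) / be = T `^ p.
      by rewrite /T -powRrM mulVf ?gt_eqF// powRr1// ltW.
    by rewrite ge0_ler_powR ?nnegrE ?(ltW p0) ?(ltW t0) ?powR_ge0 ?(ltW Tt).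
  have tp0 : 0 < t `^ p by rewrite powR_gt0.
  have hR := rtail_decay pp ltr01 wr cr hr t0; rewrite mul1r in hR.
  rewrite mulrCA (le_trans (ler_wpM2r M0 hR))// mulrAC ler_pdivrMr//.
  move: tp; rewrite ler_pdivrMr// => tp; rewrite [leRHS]mulrC (le_trans _ tp)//.
  by rewrite ler_wpM2l ?(ltW p0)// lerDl.
have [T' hT'] := d.2 _ be M0 (ltW be0) hb (ex_intro _ T hT) (e / 4) (divr_gt0 e0 (ltr0Sn _ 3)).
exists (Num.max T T'); split; first by rewrite num_real.
move=> t; rewrite gt_max => /andP[tT tT'].
rewrite sub0r normrN (le_trans (xz t))//.
have h1 := hT' t tT'; have h2 := hT t tT.
have h3 : Rt t * `|x0| <= K0 * (Rt t * `|x0|) by rewrite ler_peMl// mulr_ge0.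
lra.
Qed.
End Truncated.

Hypothesis hfl : lip_const f r @[r --> 0^'+] --> 0%E.

Lemma small_data_solution : exists K r : R, [/\ 0 < K, 0 < r &
  forall x0 : 'cV[R]_n, K * `|x0| < r -> exists2 x,
    maximal_solution p (fun v => A *m v + f v) x0 +oo x &
    (forall t, `|x t| <= K * `|x0|) /\ x t @[t --> +oo] --> (0 : 'cV[R]_n)].
Proof.
have [D D0 hD] := linear_dominated pp b0 hA.
have q0 : 0 < (b * (D + 1))^-1 by rewrite invr_gt0 mulr_gt0//; lra.
have [r r0 fq] := lip_small q0 hfl.
have Dq : D * (b * (b * (D + 1))^-1) < 1.
  have -> : b * (b * (D + 1))^-1 = (D + 1)^-1.
    by rewrite [(b * _)^-1]invfM mulrA [b / b]divff ?mul1r// (gt_eqF b0).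
  rewrite ltr_pdivrMr; lra.
have [K K0 hK] := truncated_decay q0 r0 fq D0 Dq hD.
exists K, r; split=> // x0 x0r.
have [x cx hx] := truncated_solution q0 r0 fq x0.
have [xK x_0] := hK x0 x cx hx.
exists x => //; apply: (truncated_maximal q0 r0 fq cx hx) => t.
exact: le_lt_trans x0r.
Qed.
End Equation.
End Nonlinear.

Theorem theorem5 (R : realType) (d : nat) (alpha : R)
    (halpha : 0 < alpha < 1)
    (A : 'M[R]_d)
    (hA : forall z : R[i], eigenvalue (map_mx (real_complex R) A) z ->
            z != 0 /\ alpha * pi / 2 < `|carg z|)
    (f : 'cV[R]_d -> 'cV[R]_d)
    (hf : locally_lipschitz f)
    (hf0 : f 0 = 0)
    (hfl : lip_const f r @[r --> 0^'+] --> 0%E) :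
  trivial_asymptotically_stable alpha (fun x => A *m x + f x).
Proof.
have [K [r [K0 r0 hK]]] := small_data_solution halpha hf0 hA hfl.
have near_r (delta : R) x0 : delta <= r / K -> `|x0 : 'cV[R]_d| < delta -> K * `|x0| < r.
  by move=> dr /lt_le_trans /(_ dr); rewrite ltr_pdivlMr// mulrC.
split=> [eps eps0|].
  exists (Num.min (r / K) (eps / K)); first by rewrite lt_min !divr_gt0.
  move=> x0 hx0; have [|x mx [xK _]] := hK x0.
    by apply: near_r hx0; rewrite ge_min lexx.
  exists x => // t _; apply: (le_trans (xK t)).
  by move: hx0; rewrite lt_min => /andP[_]; rewrite ltr_pdivlMr// mulrC => /ltW.
exists (r / K) => [|x0 hx0]; first by rewrite divr_gt0.
have [|x mx [_ x_0]] := hK x0; first exact: near_r hx0.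
by exists x.
Qed.
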